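(* Let $m^2\ge0$ and consider the Green's operator $C=(m^2-A)^{-1}=-(A-m^2)^{-1}$ on $1_\pi^\perp$, where $A$ is a densely defined self-adjoint infinitesimal generator on $L^2(S,\pi)$ of a strongly continuous semigroup for an ergodic invariant probability $\pi$ such that $A^{-1}$ is a bounded linear operator on the range $\mathcal{R}(A)=1_\pi^\perp$. Define the bounded linear transformation $T:1_\pi^\perp\to1_\pi^\perp$ by $$Tf=(-A)^{1/2}(m^2-A)^{-1/2}f,\qquad f\in1_\pi^\perp .$$ Let $Z(f,t)=\frac{e^{-t}}{\sqrt2}B(f,e^{2t})$, $f\in1_\pi^\perp$, $t\in\mathbb{R}$, be the stationary UGRF obtained by the Lamperti transformation with dissipative operator $-\mathbf{I}$ from the Brownian field $B$ with spatial covariance operator $-2A^{-1}$. Then the linearly transformed field $TZ$, defined by $(TZ)(f,t)=Z(Tf,t)$, is Itô's OU$\mathcal{L}(1_\pi^\perp)$-process with characteristic operator $\Gamma=-\mathbf{I}$ and equilibrium (stationary) covariance operator $Q$ equal to the Green's operator $C=(m^2-A)^{-1}$; in particular $$\mathbb{E}\big[(TZ)(f,t)\,(TZ)(g,t)\big]=\langle f,(m^2-A)^{-1}g\rangle_\pi,\qquad f,g\in1_\pi^\perp,\ t\in\mathbb{R}.$$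
   Context: Setting: $X=\{X(t):t\ge0\}$ is a progressively measurable Markov process on a measurable state space $(S,\mathcal{S})$, defined on a complete probability space, with initial distribution the ergodic invariant probability $\pi$, and $A$ is the infinitesimal generator of its transition semigroup on the real Hilbert space $L^2(S,\pi)$ with inner product $\langle\cdot,\cdot\rangle_\pi$. $1_\pi^\perp=\{f\in L^2(S,\pi):\int_S f\,d\pi=0\}$. $A^{-1}$ is the inverse of the bijection $A:\mathcal{D}(A)\cap 1_\pi^\perp\to1_\pi^\perp$. Functions of $A$ are defined by the spectral theorem, restricted to $1_\pi^\perp$. Brownian field: $\{B(f,t):f\in1_\pi^\perp,t\ge0\}$ is the centered jointly Gaussian field, linear in $f$ (a.s.), such that for all $f_1,\dots,f_k\in 1_\pi^\perp$ the process $t\mapsto(B(f_1,t),\dots,B(f_k,t))$ is a $k$-dimensional Brownian motion and $\mathbb{E}B(f,s)B(g,t)=(s\wedge t)(-2\langle f,A^{-1}g\rangle_\pi)$; it is the limit in distribution of $n^{-1/2}\int_0^{nt}f(X_s)\,ds$. Itô's notions: for a real vector space $E$, an $\mathcal{L}(E)$-process is a real process $\{Y(f,t):f\in E,t\in\mathbb{R}\}$ that is (a.s.) linear in $f$. It is an OU$\mathcal{L}(E)$-process if it is centered Gaussian, Markov (given the present $\sigma(Y(h,t):h\in E)$, the past and the future are conditionally independent), stationary in $t$, and mean ($L^2$-) continuous in $t$. It is determined, up to equality of finite-dimensional distributions, by its stationary covariance $\mathbb{E}Y(f,t)Y(g,t)$ (given by the equilibrium covariance operator $Q$ as $\langle f,Qg\rangle_\pi$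 when $E=1_\pi^\perp$) and by its characteristic operator $\Gamma$, the generator of the semigroup $S(t)$, $t\ge 0$, determined by $\mathbb{E}[Y(f,t)\mid\sigma(Y(h,s):s\le0,h\in E)]=Y(S(t)f,0)$. *)

(* Defs.v *)
From HB Require Import structures.
From mathcomp Require Import all_boot all_order all_algebra.
From mathcomp Require Import generic_quotient ring_quotient.
From mathcomp Require Import all_classical all_reals all_analysis.

Set Implicit Arguments.
Unset Strict Implicit.
Unset Printing Implicit Defensive.

Import Order.TTheory GRing.Theory Num.Theory.
Import numFieldNormedType.Exports.

Local Open Scope classical_set_scope.
Local Open Scope ring_scope.
Local Open Scope quotient_scope.

Section L2space.
Context d (S : measurableType d) (R : realType) (mu : probability S R).

Notation Lfun2 := (LfunType mu (lee1n 2)).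

Definition ae_zero : {pred Lfun2} :=
  [pred f : Lfun2 | `[< (f : S -> R) = cst 0 %[ae mu] >]].

Lemma ae_zeroP (f : Lfun2) :
  reflect ((f : S -> R) = cst 0 %[ae mu]) (f \in ae_zero).
Proof. exact: asboolP. Qed.

Lemma ae_zero_zmod_closed : zmod_closed ae_zero.
Proof.
split=> [|f g]; first by apply/ae_zeroP/aeW.
move=> /ae_zeroP f0 /ae_zeroP g0; apply/ae_zeroP.
move: f0 g0; apply: filterS2 => x /= f0 g0 Dx.
by transitivity (f x - g x) => //; rewrite f0// g0// subr0.
Qed.

HB.instance Definition _ :=
  GRing.isZmodClosed.Build Lfun2 ae_zero ae_zero_zmod_closed.

(* L^2(S, mu): square-integrable functions modulo a.e. equality, as a quotient
   module (the library's [LspaceType] has no algebraic structure). *)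
Definition L2 : Type := Quotient.quot ae_zero.
HB.instance Definition _ := GRing.Zmodule.on L2.
HB.instance Definition _ := EqQuotient.on L2.

Definition L2_scale (a : R) (f : L2) : L2 := \pi_L2 (a *: (repr f : Lfun2)).

Lemma L2P (f g : Lfun2) :
  reflect ((f : S -> R) = g %[ae mu]) (f == g %[mod L2]).
Proof.
rewrite -Quotient.idealrBE; apply: (iffP (ae_zeroP _)).
  by apply: filterS => x /= fg Dx; apply/eqP; rewrite -subr_eq0; apply/eqP/fg.
apply: filterS => x /= fg Dx.
by transitivity (f x - g x) => //; rewrite fg// subrr.
Qed.

Lemma repr_pi_ae (f : Lfun2) : (repr (\pi_L2 f) : S -> R) = f %[ae mu].
Proof. by apply/L2P/eqP; rewrite reprK. Qed.

Lemma pi_scale a (f : Lfun2) : L2_scale a (\pi_L2 f) = \pi_L2 (a *: f).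
Proof.
apply/eqP/L2P; have := repr_pi_ae f.
by apply: filterS => x /= h Dx; congr (_ * _); exact: h.
Qed.

Lemma L2_scaleA a b f : L2_scale a (L2_scale b f) = L2_scale (a * b) f.
Proof. by rewrite -[f]reprK (pi_scale b) !pi_scale scalerA. Qed.

Lemma L2_scale1 : left_id 1 L2_scale.
Proof. by move=> f; rewrite -[f]reprK pi_scale scale1r. Qed.

Lemma pi_addE (f g : Lfun2) : \pi_L2 f + \pi_L2 g = \pi_L2 (f + g) :> L2.
Proof. by rewrite [RHS](@Quotient.pi_add _ ae_zero). Qed.

Lemma L2_scaleDr : right_distributive L2_scale +%R.
Proof.
move=> a f g; rewrite -[f]reprK -[g]reprK.
by rewrite pi_addE !pi_scale pi_addE scalerDr.
Qed.

Lemma L2_scaleDl f : {morph L2_scale^~ f : a b / a + b}.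
Proof. by move=> a b; rewrite -[f]reprK !pi_scale pi_addE scalerDl. Qed.

HB.instance Definition _ := GRing.Zmodule_isLmodule.Build R L2
  L2_scaleA L2_scale1 L2_scaleDr L2_scaleDl.

Definition L2_fun (f : L2) : S -> R := (repr f : Lfun2).

Definition L2_dot (f g : L2) : R := \int[mu]_x (L2_fun f x * L2_fun g x).

Lemma Lfun2_integrable (f : Lfun2) :
  mu.-integrable setT (EFin \o (f : S -> R)).
Proof.
apply/Lfun1_integrable; apply: Lfun_subset12; last exact: LfunP.
exact: fin_num_measure.
Qed.

Lemma L2_integrable (f : L2) : mu.-integrable setT (EFin \o L2_fun f).
Proof. exact: Lfun2_integrable. Qed.

Definition L2_mean (f : L2) : R := \int[mu]_x L2_fun f x.

Lemma L2_mean_pi (f : Lfun2) : L2_mean (\pi_L2 f) = \int[mu]_x f x.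
Proof.
congr fine; apply: ae_eq_integral => //.
- exact: measurable_int (L2_integrable _).
- exact: measurable_int (Lfun2_integrable _).
- by have := repr_pi_ae f; apply: filterS => x /= h Dx; rewrite /L2_fun h.
Qed.

Definition mean_zero : {pred L2} := [pred f : L2 | L2_mean f == 0].

Lemma mean_zero_submod_closed : submod_closed mean_zero.
Proof.
split=> [|a f g]; rewrite !inE.
  rewrite -(scale0r (\pi_L2 0)) [_ *: _]pi_scale L2_mean_pi.
  by rewrite scale0r /Rintegral integral0_eq.
move=> /eqP f0 /eqP g0.
have iZ : mu.-integrable setT (EFin \o (a *: (repr f : Lfun2) : Lfun2)).
  exact: Lfun2_integrable.
rewrite -[f]reprK -[g]reprK [a *: _]pi_scale pi_addE L2_mean_pi.
rewrite RintegralD//; last exact: Lfun2_integrable.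
rewrite [X in _ + X]g0 addr0 RintegralZl//; last exact: Lfun2_integrable.
by rewrite [X in _ * X]f0 mulr0.
Qed.

HB.instance Definition _ :=
  GRing.isSubmodClosed.Build R L2 mean_zero mean_zero_submod_closed.

(* The orthogonal complement of the constants. *)
Record perp := Perp { perp_val :> L2 ; perp_valP : perp_val \in mean_zero }.

HB.instance Definition _ := [isSub for perp_val].
HB.instance Definition _ := [Choice of perp by <:].
HB.instance Definition _ := [SubChoice_isSubLmodule of perp by <:].

Definition perp_dot (f g : perp) : R := L2_dot f g.

End L2space.

Arguments mean_zero {d S R} mu _.
Arguments L2_dot {d S R} mu f g.
Arguments perp_dot {d S R} mu f g.

(* A possibly unbounded operator on V is given by its graph: [G f g] means that
   f is in the domain of G and G f = g. *)
Section operators.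
Context (R : realType) (V : lmodType R) (dot : V -> V -> R).
Implicit Types (G : V -> V -> Prop) (U : R -> V -> V) (T : V -> V).

Definition hnorm (f : V) : R := Num.sqrt (dot f f).

Definition bounded_linear T :=
  (forall a f g, T (a *: f + g) = a *: T f + T g) /\
  (exists M, forall f, hnorm (T f) <= M * hnorm f).

Definition op_range G : set V := [set g | exists f, G f g].
Definition op_opp G f g := G f (- g).
Definition op_shift (c : R) G f g := G f (g - c *: f).
Definition bijective_op G := forall g, exists! f, G f g.
Definition op_inv G (g : V) : V := xget 0 [set f | G f g].

Definition densely_defined G :=
  forall (f : V) (e : R), 0 < e -> exists u v, G u v /\ hnorm (f - u) < e.
Definition adjoint G f h := forall u v, G u v -> dot v f = dot u h.
Definition self_adjoint G :=
  densely_defined G /\ forall f h, G f h <-> adjoint G f h.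

(* Strongly continuous semigroups; only the values at times t >= 0 matter. *)
Definition C0_semigroup U :=
  [/\ forall t : R, 0 <= t -> bounded_linear (U t),
      forall f, U 0 f = f,
      forall (s t : R) f, 0 <= s -> 0 <= t -> U (s + t) f = U s (U t f) &
      forall f, hnorm (U t f - f) @[t --> 0^'+] --> (0 : R)].

Definition generator U f g :=
  hnorm (t^-1 *: (U t f - f) - g) @[t --> 0^'+] --> (0 : R).

(* Projection-valued measures on the Borel sets of R.
   [pvm_meas f] is the measure B |-> <E(B) f, f>; its existence is the
   sigma-additivity of E. *)
Record pvm := Pvm {
  pvm_proj : set (measurableTypeR R) -> V -> V ;
  pvm_meas : V -> {measure set (measurableTypeR R) -> \bar R} ;
  pvm_linear : forall B, measurable B -> bounded_linear (pvm_proj B) ;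
  pvm_sym : forall B f g, measurable B ->
    dot (pvm_proj B f) g = dot f (pvm_proj B g) ;
  pvm_setT : forall f, pvm_proj setT f = f ;
  pvm_setI : forall B C f, measurable B -> measurable C ->
    pvm_proj (B `&` C) f = pvm_proj B (pvm_proj C f) ;
  pvm_measE : forall B f, measurable B ->
    pvm_meas f B = (dot (pvm_proj B f) f)%:E }.

(* The integral of phi against B |-> <E(B) f, g>, by polarization. *)
Definition pvm_integral (E : pvm) (phi : R -> R) (f g : V) : R :=
  4^-1 * (\int[pvm_meas E (f + g)]_x phi x - \int[pvm_meas E (f - g)]_x phi x).

Definition spectral_dom (E : pvm) (phi : R -> R) (f : V) : Prop :=
  (phi : measurableTypeR R -> R) \in Lfun (pvm_meas E f) 2%:E.

(* Graph of the operator phi(A) = \int phi dE; the test vectors g range over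
   its (dense) domain, where both integrals of [pvm_integral] converge. *)
Definition spectral_op (E : pvm) (phi : R -> R) (f h : V) : Prop :=
  spectral_dom E phi f /\
  forall g, spectral_dom E phi g -> dot h g = pvm_integral E phi f g.

(* E is the resolution of the identity of A: A = \int x dE(x). *)
Definition spectral_resolution (E : pvm) (A : V -> V -> Prop) :=
  forall f g, A f g <-> spectral_op E id f g.

End operators.

Section markov.
Context d (S : measurableType d) (R : realType).
Implicit Types (p : R -> R.-pker S ~> S) (mu : probability S R).

(* Only the kernels p t with t >= 0 matter. *)
Definition transition_function p :=
  (forall x B, measurable B -> p 0 x B = \d_x B) /\
  (forall (s t : R) x B, 0 <= s -> 0 <= t -> measurable B ->
    p (s + t) x B = (\int[p s x]_y p t y B)%E).

Definition invariant_law p mu :=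
  forall (t : R) B, 0 <= t -> measurable B -> (\int[mu]_x p t x B)%E = mu B.

Definition ergodic p mu := forall B, measurable B ->
  (forall t : R, 0 <= t -> {ae mu, forall x, p t x B = (\1_B x)%:E}) ->
  mu B = 0%E \/ mu B = 1%E.

(* (U_t f)(x) = \int f(y) p_t(x, dy), as a class in L^2(mu). *)
Definition transition_semigroup p mu (t : R) (f : L2 mu) : L2 mu :=
  xget 0 [set h : L2 mu |
    {ae mu, forall x, L2_fun h x = \int[p t x]_y L2_fun f y}].

Definition markov_generator p mu : L2 mu -> L2 mu -> Prop :=
  generator (L2_dot mu) (@transition_semigroup p mu).

Context dO (Om : measurableType dO) (P : probability Om R).
Implicit Types (X : R -> Om -> S) (F : R -> set (set Om)).

Definition filtration F :=
  [/\ forall t : R, 0 <= t -> sigma_algebra setT (F t),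
      forall t : R, 0 <= t -> F t `<=` measurable &
      forall s t : R, 0 <= s -> s <= t -> F s `<=` F t].

(* For each t, (s, w) |-> X s w on [0, t] x Om is measurable for the product
   of the Borel sigma-algebra and F t. *)
Definition progressively_measurable F X :=
  forall (t : R) B, 0 <= t -> measurable B ->
  <<s [set I `*` G | I in (measurable : set (set R)) & G in F t] >>
  [set x : R * Om | 0 <= x.1 <= t /\ B (X x.1 x.2)].

Definition markov_process F p X := forall (s t : R) G B,
  0 <= s -> 0 <= t -> F s G -> measurable B ->
  P (G `&` X (s + t) @^-1` B) = (\int[P]_(w in G) p t (X s w) B)%E.

Definition initial_distribution X mu :=
  forall B, measurable B -> P (X 0 @^-1` B) = mu B.

End markov.

Arguments transition_semigroup {d S R} p mu t f.
Arguments markov_generator {d S R} p mu _ _.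

Section gaussian.
Context dO (Om : measurableType dO) (R : realType) (P : probability Om R).

(* X has the normal law N(m, v), degenerate when v = 0. *)
Definition normal_law (X : Om -> R) (m v : R) :=
  [/\ measurable_fun setT X, 0 <= v &
    if v == 0 then {ae P, forall w, X w = m}
    else forall B, measurable B ->
      P (X @^-1` B) = normal_prob m (Num.sqrt v) B].

Definition sigma_of (I : Type) (Y : I -> Om -> R) (D : set I) : set (set Om) :=
  <<s \bigcup_(i in D) preimage_set_system setT (Y i) measurable >>.

(* W is a version of E[Z | G]. *)
Definition cond_exp (G : set (set Om)) (Z W : Om -> R) :=
  [/\ P.-integrable setT (EFin \o Z), P.-integrable setT (EFin \o W),
      forall C, measurable C -> G (W @^-1` C) &
      forall A, G A -> \int[P]_(w in A) W w = \int[P]_(w in A) Z w].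

(* P(A `&` B | G) = P(A | G) P(B | G) a.s. for all A in F1 and B in F2. *)
Definition cond_indep (G F1 F2 : set (set Om)) := forall A B, F1 A -> F2 B ->
  exists U V, [/\ cond_exp G \1_A U, cond_exp G \1_B V &
                  cond_exp G \1_(A `&` B) (U \* V)].

Context (V : lmodType R).
Implicit Types (Y : V -> R -> Om -> R) (D : set R).

Definition LE_process D Y :=
  (forall f t, D t -> measurable_fun setT (Y f t)) /\
  (forall a f g t, D t ->
    {ae P, forall w, Y (a *: f + g) t w = a * Y f t w + Y g t w}).

Definition centered_gaussian D Y :=
  forall n (c : 'I_n -> R) (f : 'I_n -> V) (t : 'I_n -> R),
    (forall i, D (t i)) ->
    exists v, normal_law (fun w => \sum_(i < n) c i * Y (f i) (t i) w) 0 v.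

(* k-dimensional Brownian motion on [0, +oo[ started at 0, with a possibly
   degenerate covariance matrix. *)
Definition brownian_motion k (W : 'I_k -> R -> Om -> R) := exists C : 'M[R]_k,
  [/\ forall i, {ae P, forall w, W i 0 w = 0},
      forall i (t : R), 0 <= t -> measurable_fun setT (W i t),
      forall (s t : R) (c : 'I_k -> R), 0 <= s -> s <= t ->
        normal_law (fun w => \sum_(i < k) c i * (W i t w - W i s w)) 0
          ((t - s) * \sum_(i < k) \sum_(j < k) c i * C i j * c j),
      forall (s t : R) A (B : set (k.-tuple R)), 0 <= s -> s <= t ->
        sigma_of (fun x : 'I_k * R => W x.1 x.2) [set x | 0 <= x.2 <= s] A ->
        measurable B ->
        let incr w := [tuple W i t w - W i s w | i < k] in
        P (A `&` incr @^-1` B) = (P A * P (incr @^-1` B))%E &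
      {ae P, forall w, forall i, {within `[0%R, +oo[, continuous (W i ^~ w)}}].

Definition brownian_field (K : V -> V -> R) (Y : V -> R -> Om -> R) :=
  [/\ LE_process [set t | 0 <= t] Y,
      centered_gaussian [set t | 0 <= t] Y,
      forall k (f : 'I_k -> V), brownian_motion (fun i => Y (f i)) &
      forall f g (s t : R), 0 <= s -> 0 <= t ->
        ('E_P[Y f s \* Y g t])%E = (Num.min s t * K f g)%:E].

Definition lamperti Y f (t : R) (w : Om) : R :=
  expR (- t) / Num.sqrt 2 * Y f (expR (2 * t)) w.

Definition sigma_field Y (D : set R) : set (set Om) :=
  sigma_of (fun x : V * R => Y x.1 x.2) [set x | D x.2].

Definition markov_field Y := forall t : R,
  cond_indep (sigma_field Y [set t])
    (sigma_field Y [set s | s <= t]) (sigma_field Y [set s | t <= s]).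

Definition stationary_field Y :=
  forall n (f : 'I_n -> V) (t : 'I_n -> R) (h : R) (B : set (n.-tuple R)),
    measurable B ->
    P ((fun w => [tuple Y (f i) (t i + h) w | i < n]) @^-1` B) =
    P ((fun w => [tuple Y (f i) (t i) w | i < n]) @^-1` B).

Definition mean_continuous Y := forall f (t : R),
  ('E_P[fun w => ((Y f s w - Y f t w) ^+ 2)%R])%E @[s --> t] --> 0%E.

Definition OU_LE_process Y :=
  [/\ LE_process setT Y, centered_gaussian setT Y, markov_field Y,
      stationary_field Y & mean_continuous Y].

Definition equilibrium_covariance (dot : V -> V -> R) Y (Q : V -> V) :=
  forall f g t, ('E_P[Y f t \* Y g t])%E = (dot f (Q g))%:E.

(* E[Y(f,t) | Y(h,s), s <= 0, h in V] = Y(U_t f, 0) for all t >= 0. *)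
Definition conditional_semigroup Y (U : R -> V -> V) := forall f (t : R), 0 <= t ->
  cond_exp (sigma_field Y [set s | s <= 0]) (Y f t) (Y (U t f) 0).

(* The characteristic operator of Y is the generator of the unique semigroup U
   such that [conditional_semigroup Y U]. *)
Definition characteristic_operator (dot : V -> V -> R) Y (G : V -> V -> Prop) :=
  exists U, [/\ C0_semigroup dot U, conditional_semigroup Y U,
    forall U', conditional_semigroup Y U' ->
      forall (t : R) f, 0 <= t -> U' t f = U t f &
    forall f g, generator dot U f g <-> G f g].

End gaussian.

Section green.
Context d (S : measurableType d) (R : realType) (mu : probability S R).

(* The part of an operator on L^2(mu) in the complement of the constants. *)
Definition op_perp (A : L2 mu -> L2 mu -> Prop) (f g : perp mu) : Prop := A f g.

Definition green (m2 : R) (A : L2 mu -> L2 mu -> Prop) : perp mu -> perp mu :=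
  op_inv (op_shift m2 (op_opp (op_perp A))).

(* A is negative and E({0}) vanishes on [perp mu], so the values of the two
   functions at x >= 0 (where [Num.sqrt] and [^-1] may return 0) do not matter. *)
Definition green_transform_graph (E : pvm (L2_dot mu)) (m2 : R) :
    perp mu -> perp mu -> Prop := fun f h => exists2 u : perp mu,
  op_perp (spectral_op E (fun x => (Num.sqrt (m2 - x))^-1)) f u &
  op_perp (spectral_op E (fun x => Num.sqrt (- x))) u h.

(* T f = (-A)^{1/2} (m2 - A)^{-1/2} f, for E the resolution of A. *)
Definition green_transform (E : pvm (L2_dot mu)) (m2 : R) (f : perp mu) :
  perp mu := xget 0 [set h | green_transform_graph E m2 f h].

End green.

(* Main.v *)
(* Invariance of the law and Jensen's inequality make the Markov generator [A]
   negative, and boundedness of its inverse on the complement of the constants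
   yields d > 0 such that the resolution E of A lives on ]-oo, -d[ there.  Hence
   all the operators involved are bounded functions of A on that complement, and
   the functional calculus gives <T f, - A^-1 T g> = <f, (m^2 - A)^-1 g>.

   With X(f, t) = e^-t B(T f, e^2t) / sqrt 2 this means
   E[X(f, s) X(g, t)] = e^-|s - t| <f, C g>.  The covariance is invariant under
   time shifts, so X is stationary by the Cramer-Wold device.  For s <= t,
   X(f, t) - e^-(t - s) X(f, s) is a multiple of a Brownian increment after time
   e^2s, hence independent of the past of X up to s: this gives both the Markov
   property and the semigroup e^-t I of conditional expectations. *)
Require Import Defs.
From HB Require Import structures.
From mathcomp Require Import all_boot all_order all_algebra generic_quotient.
From mathcomp Require Import all_classical all_reals all_analysis.
From mathcomp Require Import measurable_realfun ring lra.

Set Implicit Arguments.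
Unset Strict Implicit.
Unset Printing Implicit Defensive.

Import Order.TTheory GRing.Theory Num.Theory.
Import numFieldNormedType.Exports.

Local Open Scope classical_set_scope.
Local Open Scope ring_scope.

(** * Inner products and square-integrable functions *)

(** The spectral datum is a projection-valued measure [E]. Unbounded functions of [A] exist only as
    graphs, specified weakly through quadratic forms, and [T], [C] and the inverse of [A] are picked
    from graphs by [xget]. Nothing can be computed with them before existence, uniqueness and
    multiplicativity of the calculus are known. The device is the pair [pvm_op phi L], which ties a
    bounded operator to its symbol: operator identities become pointwise identities on the spectrum.
    Boundedness of the inverse of [A] excludes spectrum in [-d, 0[; the point 0 itself is excluded
    by injectivity on the mean-zero space.

    On the probabilistic side, Gaussian laws come with unspecified variances, so the variance must
    be recovered from the second moment before laws can be compared. Independence of Brownian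
    increments is given for one increment of a finite family of test functions; pi-systems raise it
    to the whole field and to all later times. *)

Record inner_product (R : realType) (V : lmodType R) (dot : V -> V -> R) := {
  dotC : forall f g, dot f g = dot g f ;
  dot_linl : forall a f g h, dot (a *: f + g) h = a * dot f h + dot g h ;
  dot_ge0 : forall f, 0 <= dot f f ;
  dot_eq0 : forall f, dot f f = 0 -> f = 0 }.

(* Completeness, tested only on sequences with geometrically small steps. *)
Definition rapid_complete (R : realType) (V : lmodType R) (dot : V -> V -> R) :=
  forall u : nat -> V,
    (forall n, hnorm dot (u n.+1 - u n) <= 2^-1 ^+ n) ->
    exists l, (fun n => hnorm dot (u n - l)) @ \oo --> (0 : R).

Section hilbert.
Context (R : realType) (V : lmodType R) (dot : V -> V -> R).
Context (ip : inner_product dot).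
Local Notation hnorm := (hnorm dot).

Lemma dotDl f g h : dot (f + g) h = dot f h + dot g h.
Proof. by have := dot_linl ip 1 f g h; rewrite scale1r mul1r. Qed.

Lemma dotDr f g h : dot h (f + g) = dot h f + dot h g.
Proof. by rewrite (dotC ip) dotDl !(dotC ip h). Qed.

Lemma dot0l h : dot 0 h = 0.
Proof. by apply: (@addrI _ (dot 0 h)); rewrite -dotDl !addr0. Qed.

Lemma dot0r h : dot h 0 = 0. Proof. by rewrite (dotC ip) dot0l. Qed.

Lemma dotZl a f h : dot (a *: f) h = a * dot f h.
Proof. by have := dot_linl ip a f 0 h; rewrite !addr0 dot0l addr0. Qed.

Lemma dotZr a f h : dot h (a *: f) = a * dot h f.
Proof. by rewrite (dotC ip) dotZl (dotC ip h). Qed.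

Lemma dotNl f h : dot (- f) h = - dot f h.
Proof. by rewrite -scaleN1r dotZl mulN1r. Qed.

Lemma dotNr f h : dot h (- f) = - dot h f.
Proof. by rewrite (dotC ip) dotNl (dotC ip h). Qed.

Lemma dotBl f g h : dot (f - g) h = dot f h - dot g h.
Proof. by rewrite dotDl dotNl. Qed.

Lemma dotBr f g h : dot h (f - g) = dot h f - dot h g.
Proof. by rewrite dotDr dotNr. Qed.

Definition dotE := (dotDl, dotDr, dotZl, dotZr, dotNl, dotNr).

Lemma hnorm_ge0 f : 0 <= hnorm f. Proof. exact: sqrtr_ge0. Qed.

Lemma sqr_hnorm f : hnorm f ^+ 2 = dot f f.
Proof. by rewrite sqr_sqrtr// (dot_ge0 ip). Qed.

Lemma hnorm_zero : hnorm 0 = 0. Proof. by rewrite /Defs.hnorm dot0l sqrtr0. Qed.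

Lemma hnorm_eq0 f : hnorm f = 0 -> f = 0.
Proof. by move=> f0; apply: (dot_eq0 ip); rewrite -sqr_hnorm f0 expr0n. Qed.

Lemma hnorm_scale a f : hnorm (a *: f) = `|a| * hnorm f.
Proof.
by rewrite /Defs.hnorm dotZl dotZr mulrA sqrtrM -expr2 ?sqr_ge0// sqrtr_sqr.
Qed.

Lemma hnorm_opp f : hnorm (- f) = hnorm f.
Proof. by rewrite -scaleN1r hnorm_scale normrN1 mul1r. Qed.

Lemma hnorm_le f c : 0 <= c -> dot f f <= c ^+ 2 -> hnorm f <= c.
Proof. by move=> c0 h; rewrite -(ler_pXn2r (ltn0Sn 1)) ?nnegrE ?hnorm_ge0 ?sqr_hnorm. Qed.

Lemma cauchy_schwarz f g : `|dot f g| <= hnorm f * hnorm g.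
Proof.
have [g0|g0] := eqVneq (hnorm g) 0.
  by rewrite (hnorm_eq0 g0) dot0r hnorm_zero mulr0 normr0.
have gg : 0 < dot g g by rewrite -sqr_hnorm exprn_gt0// lt_neqAle eq_sym g0 hnorm_ge0.
rewrite -(ler_pXn2r (ltn0Sn 1)) ?nnegrE ?mulr_ge0 ?hnorm_ge0//.
rewrite real_normK ?num_real// exprMn !sqr_hnorm.
(* This vector is [dot g g] times the component of [f] orthogonal to [g]. *)
have := dot_ge0 ip (dot g g *: f - dot f g *: g).
rewrite !dotE (dotC ip g f).
set a := dot f f; set b := dot g g; set c := dot f g => h.
have {}h : 0 <= b * (a * b - c ^+ 2) by move: h; rewrite expr2; lra.
by move: h; rewrite pmulr_rge0// subr_ge0.
Qed.

Lemma dot_le_hnorm f g : dot f g <= hnorm f * hnorm g.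
Proof. exact: le_trans (ler_norm _) (cauchy_schwarz f g). Qed.

Lemma hnorm_add f g : hnorm (f + g) <= hnorm f + hnorm g.
Proof.
apply: hnorm_le; first by rewrite addr_ge0 ?hnorm_ge0.
rewrite !dotE (dotC ip g f) sqrrD !sqr_hnorm.
have := dot_le_hnorm f g; lra.
Qed.

Lemma hnorm_distC f g : hnorm (f - g) = hnorm (g - f).
Proof. by rewrite -hnorm_opp opprB. Qed.

Lemma hnorm_triangle g f h : hnorm (f - h) <= hnorm (f - g) + hnorm (g - h).
Proof. by rewrite -[f - h](subrKA g) hnorm_add. Qed.

Lemma hnorm_cvg_unique (T : Type) (F : set_system T) {FF : ProperFilter F}
  (u : T -> V) l l' :
  hnorm (u t - l) @[t --> F] --> 0 -> hnorm (u t - l') @[t --> F] --> 0 -> l = l'.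
Proof.
move=> ul ul'; apply/eqP; rewrite -subr_eq0; apply/eqP/hnorm_eq0/eqP.
rewrite eq_le hnorm_ge0 andbT.
have h : hnorm (u t - l) + hnorm (u t - l') @[t --> F] --> 0.
  by rewrite -[X in _ --> X](addr0 0); exact: cvgD.
apply: (cvgr_to_ge h).
by apply: nearW => t; rewrite (hnorm_distC (u t) l) hnorm_triangle.
Qed.

Lemma dot_cvg (T : Type) (F : set_system T) {FF : ProperFilter F}
  (u : T -> V) l g :
  hnorm (u t - l) @[t --> F] --> 0 -> dot (u t) g @[t --> F] --> dot l g.
Proof.
move=> ul; apply/cvgrPdist_le => e e0.
have h : hnorm (u t - l) * hnorm g @[t --> F] --> 0.
  by rewrite -[X in _ --> X](mul0r (hnorm g)); exact: cvgMl.
move/cvgrPdist_le : h => /(_ _ e0); apply: filterS => t.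
rewrite sub0r normrN ger0_norm ?mulr_ge0 ?hnorm_ge0//; apply: le_trans.
by rewrite -dotBl (le_trans (cauchy_schwarz _ _))// hnorm_distC.
Qed.

Lemma linear_hom0 (T : V -> V) : (forall a f g, T (a *: f + g) = a *: T f + T g) ->
  [/\ T 0 = 0, forall f g, T (f + g) = T f + T g, forall a f, T (a *: f) = a *: T f
  & forall f g, T (f - g) = T f - T g].
Proof.
move=> lT.
have TD f g : T (f + g) = T f + T g by rewrite -[f]scale1r lT !scale1r.
have T0 : T 0 = 0 by apply: (@addrI _ (T 0)); rewrite -TD !addr0.
have TZ a f : T (a *: f) = a *: T f by rewrite -[a *: f]addr0 lT T0 !addr0.
by split=> // f g; rewrite -scaleN1r TD TZ scaleN1r.
Qed.

End hilbert.

Lemma Lfun2P d (T : measurableType d) (R : realType)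
    (mu : {measure set T -> \bar R}) (f : T -> R) :
  f \in Lfun mu 2%:E <->
  measurable_fun setT f /\ (\int[mu]_x (f x ^+ 2)%:E < +oo)%E.
Proof.
split=> [h|[mf fi]].
  split; first by move: h; rewrite inE => /andP[/[!inE]].
  have /integrableP[_] := Lfun2_integrable_sqr h.
  apply: le_lt_trans; rewrite le_eqVlt; apply/orP; left; apply/eqP.
  by apply: eq_integral => x _ /=; rewrite ger0_norm ?sqr_ge0.
rewrite inE; apply/andP; split; rewrite inE//= /finite_norm unlock /=.
rewrite poweR_lty//; apply: le_lt_trans fi.
rewrite le_eqVlt; apply/orP; left; apply/eqP; apply: eq_integral => x _ /=.
by rewrite powR_mulrn ?normr_ge0// real_normK ?num_real.
Qed.

Lemma Rintegral_dominated_cvg d (T : measurableType d) (R : realType)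
    (mu : {measure set T -> \bar R}) (f_ : nat -> T -> R) (f g : T -> R) :
  (forall n, measurable_fun setT (f_ n)) -> measurable_fun setT f ->
  (forall x, f_ ^~ x @ \oo --> f x) -> mu.-integrable setT (EFin \o g) ->
  (forall n x, `|f_ n x| <= g x) ->
  (fun n => \int[mu]_x f_ n x) @ \oo --> \int[mu]_x f x.
Proof.
move=> mf_ mf f_f ig f_g.
have [| | | | |i _ h] := @dominated_convergence _ _ _ mu _ measurableT
  (fun n => EFin \o f_ n) (EFin \o f) (EFin \o g).
- by move=> n; apply/measurable_EFinP.
- exact/measurable_EFinP.
- by apply: aeW => x _; apply/fine_cvgP; split; [exact: nearW|exact: f_f].
- exact: ig.
- by apply: aeW => x n _; rewrite /= lee_fin.
have fi : (\int[mu]_x (EFin \o f) x)%E \is a fin_num by exact: integrable_fin_num.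
by move: h; rewrite -(fineK fi) => /fine_cvg.
Qed.

Lemma Lfun2_lin d (T : measurableType d) (R : realType)
    (mu : {measure set T -> \bar R}) (a : R) (f g : T -> R) :
  f \in Lfun mu 2%:E -> g \in Lfun mu 2%:E ->
  (fun x => a * f x + g x) \in Lfun mu 2%:E.
Proof.
by move=> hf hg; have [_ /(_ a f g hf hg)] := @Lfun_submod_closed _ _ _ mu 2%:E (lee1n 2).
Qed.

(** * Bounded functional calculus of a projection-valued measure *)

Section functional_calculus.
Context (R : realType) (V : lmodType R) (dot : V -> V -> R).
Context (ip : inner_product dot) (E : pvm dot).
Local Notation hnorm := (hnorm dot).
Local Notation mu := (pvm_meas E).
Local Notation TR := (measurableTypeR R).
Implicit Types (phi psi : TR -> R) (B : set TR) (L M : V -> V) (f g : V).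

Lemma pvm_meas_setT f : mu f setT = (dot f f)%:E.
Proof. by rewrite pvm_measE// pvm_setT. Qed.

Lemma pvm_meas_lty f B : measurable B -> (mu f B < +oo)%E.
Proof. by move=> mB; rewrite pvm_measE ?ltry. Qed.

Lemma pvm_meas_proj f B : measurable B ->
  mu f B = (dot (pvm_proj E B f) (pvm_proj E B f))%:E.
Proof. by move=> mB; rewrite pvm_measE// -{1}(setIid B) pvm_setI// pvm_sym. Qed.

Lemma pvm_integrable f phi m : measurable_fun setT phi ->
  (forall x, `|phi x| <= m) -> (mu f).-integrable setT (EFin \o phi).
Proof.
move=> mphi bphi; apply: measurable_bounded_integrable => //.
  exact: pvm_meas_lty.
exists m; split; first exact: num_real.
by move=> x mx y _ /=; rewrite (le_trans (bphi y))// ltW.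
Qed.

Lemma pvm_int_dist f phi psi c : (mu f).-integrable setT (EFin \o phi) ->
  (mu f).-integrable setT (EFin \o psi) -> (forall x, `|phi x - psi x| <= c) ->
  `|\int[mu f]_x phi x - \int[mu f]_x psi x| <= c * dot f f.
Proof.
move=> ip1 ip2 h; rewrite -RintegralB//.
have i : (mu f).-integrable setT (EFin \o (fun x => phi x - psi x)).
  apply: (pvm_integrable f (m := c)) => //.
  apply: measurable_funB.
    by move/integrableP : ip1 => [/measurable_EFinP].
  by move/integrableP : ip2 => [/measurable_EFinP].
rewrite (le_trans (le_normr_Rintegral _ _))//.
have -> : dot f f = fine (mu f setT) by rewrite pvm_meas_setT.
rewrite -Rintegral_cst//; apply: le_Rintegral => //.
- exact: integrable_norm i.
- by apply: (@pvm_integrable _ _ `|c|) => //=; exact: measurable_cst.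
Qed.

(* [L] is the bounded operator \int phi dE, for a bounded function [phi]. *)
Record pvm_op phi L : Prop := {
  pvm_op_lin : forall a f g, L (a *: f + g) = a *: L f + L g ;
  pvm_op_sym : forall f g, dot (L f) g = dot f (L g) ;
  pvm_op_comm : forall B f, measurable B ->
    L (pvm_proj E B f) = pvm_proj E B (L f) ;
  pvm_op_meas : measurable_fun setT phi ;
  pvm_op_bnd : exists m, forall x, `|phi x| <= m ;
  pvm_op_int : forall f, dot (L f) f = \int[mu f]_x phi x }.

Lemma pvm_op_integrable phi L f : pvm_op phi L ->
  (mu f).-integrable setT (EFin \o phi).
Proof. by case=> _ _ _ mphi [M bphi] _; exact: pvm_integrable bphi. Qed.

Lemma pvm_op_indic B : measurable B -> pvm_op \1_B (pvm_proj E B).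
Proof.
move=> mB; split.
- by case: (pvm_linear E mB).
- by move=> f g; exact: pvm_sym.
- by move=> C f mC; rewrite -!pvm_setI// setIC.
- exact: measurable_indic.
- by exists 1 => x; rewrite indicE normr_nat lern1 leq_b1.
- move=> f; rewrite /Rintegral integral_indic// setIT pvm_measE//.
Qed.

Lemma pvm_op_lincomb a phi psi L M : pvm_op phi L -> pvm_op psi M ->
  pvm_op (fun x => a * phi x + psi x) (fun f => a *: L f + M f).
Proof.
move=> hL hM; have iL f := pvm_op_integrable f hL.
have iM f := pvm_op_integrable f hM.
have iaL f : (mu f).-integrable setT (EFin \o (fun x => a * phi x)).
  have := integrableZl measurableT a (iL f).
  by apply: eq_integrable => // x _.
split.
- move=> b f g; rewrite (pvm_op_lin hL) (pvm_op_lin hM) !scalerDr !scalerA.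
  by rewrite addrACA (mulrC a b).
- by move=> f g; rewrite !(dotE ip) (pvm_op_sym hL) (pvm_op_sym hM).
- move=> B f mB; rewrite (pvm_op_comm hL)// (pvm_op_comm hM)//.
  by case: (pvm_linear E mB) => ->.
- apply: measurable_funD (pvm_op_meas hM).
  exact: measurable_funM (measurable_cst _) (pvm_op_meas hL).
- have [m bL] := pvm_op_bnd hL; have [n bM] := pvm_op_bnd hM.
  exists (`|a| * m + n) => x; rewrite (le_trans (ler_normD _ _))// lerD//.
  by rewrite normrM ler_wpM2l.
- move=> f; rewrite !(dotE ip) RintegralD// RintegralZl//.
  by rewrite (pvm_op_int hL) (pvm_op_int hM).
Qed.

Lemma eq_pvm_op phi psi L M : phi =1 psi -> L =1 M -> pvm_op phi L ->
  pvm_op psi M.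
Proof. by move=> /funext -> /funext ->. Qed.

Lemma pvm_op1 : pvm_op (cst 1) id.
Proof.
apply: eq_pvm_op (pvm_op_indic measurableT) => [x|f]; last exact: pvm_setT.
by rewrite indicT.
Qed.

Lemma pvm_op0 : pvm_op (cst 0) (fun=> 0).
Proof.
apply: eq_pvm_op (pvm_op_lincomb (-1) pvm_op1 pvm_op1) => [x|f] /=.
  by rewrite mulr1 addNr.
by rewrite scaleN1r addNr.
Qed.

Lemma pvm_op_dot phi L f g : pvm_op phi L ->
  dot (L f) g = pvm_integral E phi f g.
Proof.
move=> hL; rewrite /pvm_integral -!(pvm_op_int hL).
have [_ LD _ LB] := linear_hom0 (pvm_op_lin hL).
rewrite LB LD !(dotE ip) (pvm_op_sym hL g f) (dotC ip g); lra.
Qed.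

Lemma pvm_op_le phi L c f : pvm_op phi L -> (forall x, phi x <= c) ->
  dot (L f) f <= c * dot f f.
Proof.
move=> hL cphi; rewrite (pvm_op_int hL).
have -> : dot f f = fine (mu f setT) by rewrite pvm_meas_setT.
rewrite -Rintegral_cst//; apply: le_Rintegral => //.
  exact: pvm_op_integrable hL.
by apply: (@pvm_integrable _ _ `|c|) => //=; exact: measurable_cst.
Qed.

(** For a symmetric operator a bound on the quadratic form is a bound on the norm. The argument
    stays with quadratic forms because the treatment of products of symbols relies on this bound. *)
Lemma pvm_op_norm phi L c f : pvm_op phi L -> (forall x, `|phi x| <= c) ->
  hnorm (L f) <= c * hnorm f.
Proof.
move=> hL cphi; have c0 : 0 <= c by exact: le_trans (cphi 0).
have q g : `|dot (L g) g| <= c * dot g g.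
  rewrite ler_norml; apply/andP; split; last first.
    by apply: pvm_op_le hL _ => x; rewrite (le_trans (ler_norm _)).
  have hN := pvm_op_lincomb (-1) hL pvm_op0.
  rewrite lerNl; have := pvm_op_le (c := c) g hN.
  rewrite addr0 scaleN1r dotNl//; apply => x; rewrite addr0 mulN1r.
  by rewrite (le_trans (ler_norm _))// normrN.
(* The final division by [c] excludes [c = 0], where the quadratic form vanishes and polarization
   gives [L f = 0]. *)
have [e0|c0'] := eqVneq c 0.
  rewrite e0 mul0r le_eqVlt; apply/orP; left; apply/eqP.
  have z g : dot (L g) g = 0.
    by apply/normr0_eq0/eqP; rewrite eq_le normr_ge0 andbT (le_trans (q g))// e0 mul0r.
  have : dot (L f) (L f) = 0.
    rewrite (pvm_op_dot f (L f) hL) /pvm_integral -!(pvm_op_int hL) !z.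
    by rewrite subr0 mulr0.
  by move/(dot_eq0 ip) ->; exact: hnorm_zero.
have cp : 0 < c by rewrite lt_neqAle eq_sym c0'.
apply: hnorm_le; rewrite ?mulr_ge0 ?hnorm_ge0//.
rewrite exprMn (sqr_hnorm ip).
have [_ LD LZ LB] := linear_hom0 (pvm_op_lin hL).
(* The upper bound at [c *: f + L f] and the lower bound at [c *: f - L f] add up to
   [2 c |L f|^2 <= 2 c^3 |f|^2]: the terms in [<L f, f>] and [<L (L f), L f>] cancel. *)
have := q (c *: f + L f); have := q (c *: f - L f).
rewrite LB LD LZ !(dotE ip) -!(pvm_op_sym hL f).
rewrite (pvm_op_sym hL (L f) f) !ler_norml.
set x := dot (L f) f; set y := dot (L f) (L f).
set z := dot (L (L f)) (L f); set w := dot f f => /andP[h1 h2] /andP[h3 h4].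
have : 0 <= 2 * c * (c ^+ 2 * w - y) by lra.
by rewrite pmulr_rge0 ?mulr_gt0// subr_ge0.
Qed.

Lemma pvm_op_dist phi psi L M c f : pvm_op phi L -> pvm_op psi M ->
  (forall x, `|phi x - psi x| <= c) -> hnorm (L f - M f) <= c * hnorm f.
Proof.
move=> hL hM h; have := pvm_op_norm f (pvm_op_lincomb (-1) hM hL) (c := c).
rewrite scaleN1r addrC; apply => x.
by rewrite mulN1r addrC.
Qed.

(** Identities between operators are proved below by exhibiting both sides with the same symbol. *)
Lemma pvm_op_unique phi L M f : pvm_op phi L -> pvm_op phi M -> L f = M f.
Proof.
move=> hL hM; apply/eqP; rewrite -subr_eq0; apply/eqP/(hnorm_eq0 ip)/eqP.
rewrite eq_le (hnorm_ge0 dot) andbT.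
have := pvm_op_dist (c := 0) f hL hM; rewrite mul0r; apply => x.
by rewrite subrr normr0.
Qed.

(** A relation between step functions and operators, not a map: a step function has many
    decompositions, and no independence of the choice has to be shown. *)
Inductive pvm_simple : (TR -> R) -> (V -> V) -> Prop :=
| PvmSimple0 : pvm_simple (cst 0) (fun=> 0)
| PvmSimpleD c B s L : measurable B -> pvm_simple s L ->
    pvm_simple (fun x => c * \1_B x + s x) (fun f => c *: pvm_proj E B f + L f).

Lemma pvm_simple_op s L : pvm_simple s L -> pvm_op s L.
Proof.
elim=> [|c B {}s {}L mB _ h]; first exact: pvm_op0.
by apply: pvm_op_lincomb => //; exact: pvm_op_indic.
Qed.

(** Adding [m] makes the function nonnegative. Subtracting [e] where it is at least [e] removes one
    layer of height [e]; after finitely many layers the remainder lies in [0, e]. *)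
Lemma pvm_simple_approx phi m e : 0 < e -> measurable_fun setT phi ->
  (forall x, `|phi x| <= m) ->
  exists s L, pvm_simple s L /\ forall x, `|phi x - s x| <= e.
Proof.
move=> e0 mphi bphi.
have pos N psi : measurable_fun setT psi ->
    (forall x, 0 <= psi x <= N.+1%:R * e) ->
    exists s L, pvm_simple s L /\ forall x, `|psi x - s x| <= e.
  elim: N psi => [|N IH] psi mpsi bpsi.
    exists (cst 0), (fun=> 0); split; first exact: PvmSimple0.
    move=> x; have /andP[p0 p1] := bpsi x.
    by rewrite subr0 ger0_norm// -(mul1r e).
  pose B := [set x | e <= psi x].
  have mB : measurable B.
    have -> : B = psi @^-1` `[e, +oo[.
      by apply/seteqP; split => x /=; rewrite /B /= in_itv/= andbT.
    by rewrite -[X in measurable X]setTI; exact: mpsi.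
  have [|x|s [L [hs bs]]] := IH (fun x => psi x - e * \1_B x).
  - by apply: measurable_funB => //; apply: measurable_funM => //; exact: measurable_indic.
  - have /andP[p0 p1] := bpsi x; rewrite indicE.
    move: p1; rewrite -natr1 mulrDl mul1r.
    have [|] := boolP (x \in B).
      by rewrite inE /B /= => ex p1; rewrite mulr1; apply/andP; split; lra.
    rewrite notin_setE /B /= => /negP; rewrite -ltNge mulr0 subr0 => ex p1.
    rewrite p0 /=; have : 0 <= N%:R * e by rewrite mulr_ge0 ?ler0n ?ltW.
    by rewrite -natr1 mulrDl mul1r; lra.
  exists (fun x => e * \1_B x + s x), (fun f => e *: pvm_proj E B f + L f).
  split; first exact: PvmSimpleD.
  by move=> x; rewrite opprD addrA.
have [N hN] : exists N : nat, 2 * m <= N.+1%:R * e.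
  exists (Num.truncn (2 * m / e)); rewrite -ler_pdivrMr// ltW//.
  exact: truncnS_gt.
have [|x|s [L [hs bs]]] := pos N (fun x => phi x + m).
- exact: measurable_funD.
- have := bphi x; rewrite ler_norml => /andP[h1 h2]; apply/andP; split; lra.
exists (fun x => (- m) * \1_setT x + s x),
       (fun f => (- m) *: pvm_proj E setT f + L f).
split; first exact: PvmSimpleD.
move=> x; have := bs x; rewrite indicT /=.
by have -> : phi x - (- m * 1 + s x) = phi x + m - s x by ring.
Qed.

(** Step functions approaching [phi] uniformly at rate [2^-n] give operators that are Cauchy at
    every vector. The properties of the limit are read off inner products, which converge. *)
Lemma pvm_op_exists phi m : rapid_complete dot -> measurable_fun setT phi ->
  (forall x, `|phi x| <= m) -> exists L, pvm_op phi L.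
Proof.
move=> cpl mphi bphi.
have half_gt0 n : 0 < (2^-1 : R) ^+ n by rewrite exprn_gt0.
have /choice[s /choice[L hL]] : forall n, exists s L, pvm_simple s L /\
    forall x, `|phi x - s x| <= 2^-1 ^+ n by move=> n; exact: pvm_simple_approx.
have oL n := pvm_simple_op (hL n).1.
have dL n k f : (n <= k)%N -> hnorm (L k f - L n f) <= 2^-1 ^+ n * 2 * hnorm f.
  move=> nk; apply: pvm_op_dist (oL k) (oL n) _ => x.
  have -> : s k x - s n x = (phi x - s n x) - (phi x - s k x) by ring.
  rewrite (le_trans (ler_normB _ _))// mulr_natr mulr2n lerD//.
    by case: (hL n).
  case: (hL k) => _ /(_ x) h; apply: le_trans h _.
  by apply: ler_wiXn2l nk; rewrite ?invr_ge0// invf_le1// ler1n.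
have lim f : exists l, (fun n => hnorm (L n f - l)) @ \oo --> (0 : R).
  (* The distances carry a factor [2 * hnorm f]; dropping the first [k] operators absorbs it into
     the geometric rate that [rapid_complete] requires. *)
  have [k hk] : exists k : nat, 2 * hnorm f <= 2 ^+ k.
    exists (Num.truncn (2 * hnorm f)).+1; rewrite ltW// (lt_le_trans (truncnS_gt _))//.
    by rewrite -natrX ler_nat ltnW// ltn_expl.
  have [n|l hl] := cpl (fun n => L (n + k)%N f).
    have nk : (n + k <= n.+1 + k)%N by rewrite addSn.
    apply: le_trans (dL _ _ f nk) _.
    rewrite exprD -!mulrA ler_piMr ?exprn_ge0// ?invr_ge0//.
    by rewrite exprVn ler_pdivrMl ?exprn_gt0// mulr1.
  by exists l; rewrite -(cvg_shiftn k).
pose Lf f := sval (cid (lim f)).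
have hLf f : (fun n => hnorm (L n f - Lf f)) @ \oo --> (0 : R).
  exact: svalP (cid (lim f)).
have dots f g : (fun n => dot (L n f) g) @ \oo --> dot (Lf f) g.
  exact: dot_cvg (hLf f).
have extp u v : (forall g, dot u g = dot v g) -> u = v.
  move=> h; apply/eqP; rewrite -subr_eq0; apply/eqP/(dot_eq0 ip).
  by rewrite dotBl// h subrr.
exists Lf; split.
- move=> a f g; apply: extp => h.
  have h1 : (fun n => a * dot (L n f) h + dot (L n g) h) @ \oo -->
      a * dot (Lf f) h + dot (Lf g) h.
    by apply: cvgD (dots g h); apply: cvgMr; exact: dots.
  rewrite (dot_linl ip); apply: cvg_unique (dots _ h) _ => //.
  apply: cvg_trans h1; apply: near_eq_cvg; apply: nearW => n.
  by rewrite (pvm_op_lin (oL n)) (dot_linl ip).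
- move=> f g; rewrite (dotC ip f); apply: cvg_unique (dots f g) _ => //.
  apply: cvg_trans (dots g f); apply: near_eq_cvg; apply: nearW => n.
  by rewrite (pvm_op_sym (oL n)) (dotC ip).
- move=> B f mB; apply: extp => h; rewrite pvm_sym//.
  apply: cvg_unique (dots _ h) _ => //.
  apply: cvg_trans (dots f (pvm_proj E B h)); apply: near_eq_cvg.
  by apply: nearW => n; rewrite (pvm_op_comm (oL n))// pvm_sym.
- by [].
- by exists m.
- move=> f; apply: cvg_unique (dots f f) _ => //.
  have e n : `|\int[mu f]_x phi x - dot (L n f) f| <= 2^-1 ^+ n * dot f f.
    rewrite (pvm_op_int (oL n)); apply: pvm_int_dist; last by case: (hL n).
    - exact: pvm_integrable bphi.
    - exact: pvm_op_integrable (oL n).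
  have z : (fun n => (2^-1 : R) ^+ n * dot f f) @ \oo --> (0 : R).
    rewrite -[X in _ --> X](mul0r (dot f f)); apply: cvgMl.
    by apply: cvg_expr; rewrite ger0_norm ?invf_lt1 ?ltr1n ?invr_ge0.
  apply/cvgrPdist_le => e' e0; move/cvgrPdist_le : z => /(_ _ e0).
  apply: filterS => n; rewrite sub0r normrN ger0_norm; first exact: le_trans (e n).
  by rewrite mulr_ge0 ?(dot_ge0 ip)// ltW.
Qed.


Lemma pvm_meas_projI f B C : measurable B -> measurable C ->
  mu (pvm_proj E B f) C = mu f (C `&` B).
Proof.
move=> mB mC; rewrite pvm_measE// pvm_meas_proj; last exact: measurableI.
rewrite pvm_setI// -{1}[in LHS](setIid C) pvm_setI//.
by rewrite pvm_sym.
Qed.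

(** Projecting [f] by [E(B)] restricts the measure [mu f] to [B], which multiplies the integrand by
    the indicator of [B]. *)
Lemma pvm_op_restrict B phi L : measurable B -> pvm_op phi L ->
  pvm_op (fun x => \1_B x * phi x) (fun f => pvm_proj E B (L f)).
Proof.
move=> mB hL; have [lB _] := pvm_linear E mB; split.
- by move=> a f g; rewrite (pvm_op_lin hL) lB.
- by move=> f g; rewrite pvm_sym// (pvm_op_sym hL) (pvm_op_comm hL).
- by move=> C f mC; rewrite (pvm_op_comm hL)// -!pvm_setI// setIC.
- by apply: measurable_funM (pvm_op_meas hL); exact: measurable_indic.
- have [m bL] := pvm_op_bnd hL; exists m => x; rewrite normrM indicE.
  by case: (_ \in _); rewrite ?normr1 ?mul1r// normr0 mul0r (le_trans _ (bL x)).
- move=> f; transitivity (dot (L (pvm_proj E B f)) (pvm_proj E B f)).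
    by rewrite (pvm_op_comm hL)// -[RHS]pvm_sym// -pvm_setI// setIid.
  rewrite (pvm_op_int hL).
  transitivity (\int[mu (pvm_proj E B f)]_(x in B) phi x).
    rewrite /Rintegral (@negligible_integral _ _ _ _ setT (~` B))//.
    - by rewrite setTD setCK.
    - exact: measurableC.
    - exact: pvm_op_integrable hL.
    - transitivity (mu f set0); last exact: measure0.
      by rewrite pvm_meas_projI ?setICl//; exact: measurableC.
  transitivity (\int[mu f]_(x in B) phi x).
    rewrite /Rintegral; congr fine; apply: eq_measure_integral => A mA AB.
    by rewrite pvm_meas_projI// (setIidl AB).
  rewrite Rintegral_mkcond; apply: eq_Rintegral => x _.
  by rewrite patchE indicE; case: (_ \in _); rewrite ?mul1r ?mul0r.
Qed.

(** Only [phi] is approximated: for a step function the claim is [pvm_op_restrict] and linearity, as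
    [M] commutes with the projections. That [L] and [M] commute is obtained by the same
    approximation, since symmetry of the product needs it. *)
Lemma pvm_op_mul phi psi L M : pvm_op phi L -> pvm_op psi M ->
  pvm_op (fun x => phi x * psi x) (fun f => L (M f)).
Proof.
move=> hL hM.
have [m bL] := pvm_op_bnd hL; have [n bM] := pvm_op_bnd hM.
have simp s K : pvm_simple s K ->
    pvm_op (fun x => s x * psi x) (fun f => K (M f)) /\ forall f, K (M f) = M (K f).
  elim=> [|c B {}s {}K mB _ [IH1 IH2]].
    split; first by apply: eq_pvm_op pvm_op0 => x /=; rewrite ?mul0r.
    by move=> f; case: (linear_hom0 (pvm_op_lin hM)) => ->.
  split.
    apply: eq_pvm_op (pvm_op_lincomb c (pvm_op_restrict mB hM) IH1) => x //.
    by rewrite mulrDl mulrA.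
  by move=> f; rewrite (pvm_op_lin hM) (pvm_op_comm hM)// IH2.
have apx e : 0 < e -> exists s K, [/\ pvm_op (fun x => s x * psi x) (fun f => K (M f)),
    forall f, K (M f) = M (K f), forall x, `|phi x - s x| <= e &
    forall f, hnorm (L f - K f) <= e * hnorm f].
  move=> e0; have [s [K [hK sK]]] := pvm_simple_approx e0 (pvm_op_meas hL) bL.
  have [h1 h2] := simp _ _ hK; exists s, K; split=> // f.
  exact: pvm_op_dist hL (pvm_simple_op hK) sK.
have LM f : L (M f) = M (L f).
  apply/eqP; rewrite -subr_eq0; apply/eqP/(hnorm_eq0 ip)/eqP.
  rewrite eq_le (hnorm_ge0 dot) andbT; apply/ler_addgt0Pl => e e0; rewrite addr0.
  have n0 : 0 <= n by exact: le_trans (bM 0).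
  (* Approximation within [e / c] leaves an error of [e / c * (hnorm (M f) + n * hnorm f)], at most
     [e]; the [+ 1] keeps [c] positive. *)
  pose c := hnorm (M f) + n * hnorm f + 1.
  have c0 : 0 < c by rewrite ltr_wpDl// addr_ge0 ?hnorm_ge0// mulr_ge0 ?hnorm_ge0.
  have [|s [K [h1 h2 h3 h4]]] := apx (e / c); first by rewrite divr_gt0.
  rewrite (le_trans (hnorm_triangle ip (K (M f)) _ _))//.
  have {}h5 : hnorm (M (K f) - M (L f)) <= n * (e / c * hnorm f).
    case: (linear_hom0 (pvm_op_lin hM)) => _ _ _ <-.
    rewrite (le_trans (pvm_op_norm _ hM bM))// ler_wpM2l//.
    by rewrite (hnorm_distC ip).
  rewrite {2}h2 (le_trans (lerD (h4 _) h5))//.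
  rewrite mulrCA -mulrDr mulrAC ler_pdivrMr// ler_wpM2l ?ltW//.
  by rewrite /c ltrDl.
split.
- by move=> a f g; rewrite (pvm_op_lin hM) (pvm_op_lin hL).
- by move=> f g; rewrite (pvm_op_sym hL) (pvm_op_sym hM) LM.
- by move=> B f mB; rewrite (pvm_op_comm hM)// (pvm_op_comm hL).
- exact: measurable_funM (pvm_op_meas hL) (pvm_op_meas hM).
- exists (m * n) => x; rewrite normrM; apply: ler_pM => //.
- move=> f; apply/eqP; rewrite -subr_eq0 -normr_le0.
  apply/ler_addgt0Pl => e e0; rewrite addr0.
  have n0 : 0 <= n by exact: le_trans (bM 0).
  pose c := hnorm (M f) * hnorm f + n * dot f f + 1.
  have c0 : 0 < c.
    by rewrite ltr_wpDl// addr_ge0// mulr_ge0 ?hnorm_ge0// (dot_ge0 ip).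
  have [|s [K [h1 h2 h3 h4]]] := apx (e / c); first by rewrite divr_gt0.
  rewrite -(subrKA (dot (K (M f)) f)) (le_trans (ler_normD _ _))//.
  have h5 : `|dot (L (M f)) f - dot (K (M f)) f| <= e / c * (hnorm (M f) * hnorm f).
    rewrite -dotBl// (le_trans (cauchy_schwarz ip _ _))// mulrA.
    by rewrite ler_wpM2r ?hnorm_ge0.
  have iM := pvm_op_integrable f h1.
  have iL : (mu f).-integrable setT (EFin \o (fun x => phi x * psi x)).
    apply: (@pvm_integrable _ _ (m * n)).
      exact: measurable_funM (pvm_op_meas hL) (pvm_op_meas hM).
    by move=> x; rewrite normrM ler_pM.
  have h6 : `|dot (K (M f)) f - \int[mu f]_x (phi x * psi x)| <= e / c * (n * dot f f).
    rewrite (pvm_op_int h1) distrC mulrA.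
    apply: pvm_int_dist => // x; rewrite -mulrBl normrM.
    by apply: ler_pM.
  rewrite (le_trans (lerD h5 h6))// -mulrDr mulrAC ler_pdivrMr// ler_wpM2l ?ltW//.
  by rewrite /c ltrDl.
Qed.

End functional_calculus.

(** * Unbounded functions of an operator *)

Section unbounded.
Context (R : realType) (V : lmodType R) (dot : V -> V -> R).
Context (ip : inner_product dot) (cpl : rapid_complete dot) (E : pvm dot).
Local Notation hnorm := (hnorm dot).
Local Notation mu := (pvm_meas E).
Local Notation TR := (measurableTypeR R).
Implicit Types (phi psi : TR -> R) (B : set TR) (L M : V -> V) (f g : V).

Definition level phi n : set TR := [set x | `|phi x| <= n%:R].
(** Truncation by the indicator of a level set, not by clamping values, so that the truncated
    operator is [phi(A)] followed by a projection of [E]. *)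
Definition cut phi n (x : TR) : R := \1_(level phi n) x * phi x.

Lemma measurable_level phi n : measurable_fun setT phi -> measurable (level phi n).
Proof.
move=> mphi.
have -> : level phi n = ((@Num.norm R R) \o phi) @^-1` `]-oo, n%:R].
  by apply/seteqP; split => x /=; rewrite /level /= in_itv.
by rewrite -[X in measurable X]setTI; apply: measurableT_comp => //.
Qed.

Lemma measurable_cut phi n : measurable_fun setT phi -> measurable_fun setT (cut phi n).
Proof.
move=> mphi; apply: measurable_funM => //; apply: measurable_indic.
exact: measurable_level.
Qed.

Lemma cut_le phi n x : `|cut phi n x| <= n%:R.
Proof.
rewrite /cut indicE; have [|_] := boolP (x \in _); last by rewrite mul0r normr0.
by rewrite inE mul1r.
Qed.

Lemma cut_le_id phi n x : `|cut phi n x| <= `|phi x|.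
Proof.
by rewrite /cut indicE; case: (x \in _); rewrite ?mul1r// mul0r normr0.
Qed.

Lemma level_nd phi : nondecreasing_seq (level phi).
Proof.
by move=> m n mn; apply/subsetPset => x; rewrite /level /= => /le_trans; apply; rewrite ler_nat.
Qed.

Lemma bigcup_level phi : \bigcup_n level phi n = setT.
Proof.
apply/seteqP; split => // x _; exists (Num.truncn `|phi x|).+1 => //.
by rewrite /level /= ltW// truncnS_gt.
Qed.

Lemma cut_nd phi x m n : (m <= n)%N -> cut phi m x ^+ 2 <= cut phi n x ^+ 2.
Proof.
move=> /(@level_nd phi)/subsetPset mn; rewrite /cut !indicE.
have [|_] := boolP (x \in level phi m); last by rewrite mul0r expr0n sqr_ge0.
by rewrite inE => /mn xn; rewrite mem_set.
Qed.

Lemma cut_near phi x : \forall n \near \oo, cut phi n x = phi x.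
Proof.
have : (\bigcup_n level phi n) x by rewrite bigcup_level.
move=> [k _ xk]; exists k => // n /= kn; rewrite /cut indicE mem_set ?mul1r//.
by have /subsetPset := level_nd phi kn; apply.
Qed.

Lemma cut_cvg phi x : cut phi n x @[n --> \oo] --> phi x.
Proof. by apply: cvg_near_cst; exact: cut_near. Qed.

Lemma pvm_op_cut phi n : measurable_fun setT phi -> exists L, pvm_op E (cut phi n) L.
Proof.
move=> mphi; apply: (@pvm_op_exists _ _ _ ip _ _ n%:R)=> //.
  exact: measurable_cut.
exact: cut_le.
Qed.

Lemma pvm_op_sqr phi L f : pvm_op E phi L -> \int[mu f]_x (phi x ^+ 2) = hnorm (L f) ^+ 2.
Proof.
move=> hL; have h := pvm_op_mul ip hL hL.
rewrite (sqr_hnorm ip) -(pvm_op_sym hL); have /= -> := pvm_op_int h f.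
by apply: eq_Rintegral => x _; rewrite expr2.
Qed.

(** The squared distance is the mass that [mu f] leaves outside the level set, and the level sets
    increase to the whole line. *)
Lemma pvm_level_cvg phi f : measurable_fun setT phi ->
  hnorm (pvm_proj E (level phi n) f - f) @[n --> \oo] --> 0.
Proof.
move=> mphi; have mL n := measurable_level n mphi.
have h : (mu f \o level phi) @ \oo --> mu f setT.
  rewrite -(bigcup_level phi); apply: nondecreasing_cvg_mu => //.
  - by rewrite bigcup_level.
  - exact: level_nd.
have {}h : dot (pvm_proj E (level phi n) f) f @[n --> \oo] --> dot f f.
  move: h; rewrite pvm_meas_setT => /fine_cvg; apply: cvg_trans.
  by apply: near_eq_cvg; apply: nearW => n /=; rewrite pvm_measE.
have {}h : dot f f - dot (pvm_proj E (level phi n) f) f @[n --> \oo] --> 0.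
  by rewrite -(subrr (dot f f)); apply: cvgB => //; exact: cvg_cst.
rewrite -(@sqrtr0 R) (_ : (fun n => _) =
    (fun n => Num.sqrt (dot f f - dot (pvm_proj E (level phi n) f) f))).
  by apply: (cvg_comp _ _ h); exact: sqrt_continuous.
apply/funext => n; rewrite /Defs.hnorm; congr Num.sqrt.
rewrite dotBl// !dotBr// (dotC ip f (pvm_proj E _ f)).
rewrite -(pvm_sym E _ f (mL n)) -pvm_setI// setIid; ring.
Qed.

(** By monotone convergence, square integrability of [phi] is boundedness of the integrals of its
    squared truncations, which are the numbers [hnorm (L f) ^+ 2]. In this form the domain is stable
    under linear combinations, without comparing [mu (f + g)] with [mu f] and [mu g]. *)
Lemma spectral_domP phi f : measurable_fun setT phi ->
  spectral_dom E phi f <->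
  exists c, forall n L, pvm_op E (cut phi n) L -> hnorm (L f) <= c.
Proof.
move=> mphi; rewrite /spectral_dom Lfun2P.
have mc n := measurable_cut n mphi.
have cutE n L : pvm_op E (cut phi n) L ->
    (\int[mu f]_x (cut phi n x ^+ 2)%:E = (hnorm (L f) ^+ 2)%:E)%E.
  move=> hL; rewrite -(pvm_op_sqr _ hL) /Rintegral fineK//.
  apply: integrable_fin_num => //.
  have := pvm_op_integrable f (pvm_op_mul ip hL hL).
  by apply: eq_integrable => // x _; rewrite /= expr2.
split=> [[_ fi]|[c hc]].
  pose I := (\int[mu f]_x (phi x ^+ 2)%:E)%E.
  have I0 : (0 <= I)%E by apply: integral_ge0 => x _; rewrite lee_fin sqr_ge0.
  exists (Num.sqrt (fine I)) => n L hL; rewrite -(ger0_norm (hnorm_ge0 dot (L f))).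
  rewrite -sqrtr_sqr ler_sqrt; last by rewrite fine_ge0.
  rewrite -lee_fin fineK ?ge0_fin_numE// -(cutE n)//.
  apply: ge0_le_integral => //.
  - by move=> x _; rewrite lee_fin sqr_ge0.
  - by apply/measurable_EFinP; exact: measurable_funX.
  - by apply/measurable_EFinP; exact: measurable_funX.
  - move=> x _; rewrite lee_fin -(real_normK (num_real (cut _ _ _))).
    by rewrite -(real_normK (num_real (phi x))) lerXn2r ?nnegrE// cut_le_id.
split=> //.
have : (\int[mu f]_x (cut phi n x ^+ 2)%:E)%E @[n --> \oo] --> (\int[mu f]_x (phi x ^+ 2)%:E)%E.
  have := @cvg_monotone_convergence _ _ _ (mu f) _ measurableT
    (fun n x => (cut phi n x ^+ 2)%:E).
  rewrite (_ : (fun x => limn _) = (fun x => (phi x ^+ 2)%:E)); last first.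
    apply/funext => x; apply/cvg_lim => //; apply: cvg_near_cst.
    by near=> n; rewrite (near (cut_near phi x) n).
  apply.
  - by move=> n; apply/measurable_EFinP; exact: measurable_funX.
  - by move=> n x _; rewrite lee_fin sqr_ge0.
  - by move=> x _ m n mn; rewrite lee_fin cut_nd.
move=> h; apply: (@le_lt_trans _ _ (c ^+ 2)%:E); last exact: ltry.
rewrite -(cvg_lim _ h)//; apply: lime_le; first by apply/cvg_ex; eexists; exact: h.
apply: nearW => n; have [L hL] := pvm_op_cut n mphi.
by rewrite (cutE _ _ hL) lee_fin lerXn2r ?nnegrE ?hnorm_ge0 ?(le_trans (hnorm_ge0 dot (L f))) ?(hc n).
Unshelve. all: by end_near. Qed.

Lemma spectral_dom_lin phi a f g : measurable_fun setT phi ->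
  spectral_dom E phi f -> spectral_dom E phi g -> spectral_dom E phi (a *: f + g).
Proof.
move=> mphi /(spectral_domP _ mphi)[c hc] /(spectral_domP _ mphi)[c' hc'].
apply/spectral_domP => //; exists (`|a| * c + c') => n L hL.
rewrite (pvm_op_lin hL) (le_trans (hnorm_add ip _ _))// lerD ?(hc' n)//.
by rewrite (hnorm_scale ip) ler_wpM2l// (hc n).
Qed.

Lemma spectral_int_cvg phi (L_ : nat -> V -> V) f : measurable_fun setT phi ->
  (forall n, pvm_op E (cut phi n) (L_ n)) -> spectral_dom E phi f ->
  dot (L_ n f) f @[n --> \oo] --> \int[mu f]_x phi x.
Proof.
move=> mphi hL df.
have iphi : (mu f).-integrable setT (EFin \o phi).
  by apply/Lfun1_integrable; apply: Lfun_subset12 df; rewrite pvm_meas_setT.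
have -> : (fun n => dot (L_ n f) f) = (fun n => \int[mu f]_x cut phi n x).
  by apply/funext => n; rewrite (pvm_op_int (hL n)).
apply: (@Rintegral_dominated_cvg _ _ _ _ _ _ (fun x => `|phi x|)) => //.
- by move=> n; exact: measurable_cut.
- by move=> x; exact: cut_cvg.
- exact: integrable_norm.
- by move=> n x; exact: cut_le_id.
Qed.

Lemma spectral_form_cvg phi (L_ : nat -> V -> V) f g : measurable_fun setT phi ->
  (forall n, pvm_op E (cut phi n) (L_ n)) ->
  spectral_dom E phi f -> spectral_dom E phi g ->
  dot (L_ n f) g @[n --> \oo] --> pvm_integral E phi f g.
Proof.
move=> mphi hL df dg.
have -> : (fun n => dot (L_ n f) g) = (fun n => 4^-1 *
    (dot (L_ n (f + g)) (f + g) - dot (L_ n (f - g)) (f - g))).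
  apply/funext => n; rewrite (pvm_op_dot ip f g (hL n)) /pvm_integral.
  by rewrite !(pvm_op_int (hL n)).
apply: cvgMr; apply: cvgB; apply: spectral_int_cvg => //.
  by rewrite -[f]scale1r; exact: spectral_dom_lin.
by rewrite addrC -scaleN1r; exact: spectral_dom_lin.
Qed.

(** This is [phi(A) psi(A) = (phi psi)(A)] for possibly unbounded [phi] when [psi] and [phi psi] are
    bounded; it supplies the members of the graphs used below. The truncations of [phi(A)] send
    [M f] to projections of [N f], which stay bounded and converge to [N f]. *)
Lemma spectral_op_pvm phi psi M N f : measurable_fun setT phi ->
  pvm_op E psi M -> pvm_op E (fun x => phi x * psi x) N ->
  spectral_op E phi (M f) (N f).
Proof.
move=> mphi hM hN.
have KM n K : pvm_op E (cut phi n) K -> K (M f) = pvm_proj E (level phi n) (N f).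
  move=> hK; have h1 := pvm_op_mul ip hK hM.
  have h2 := pvm_op_restrict (measurable_level n mphi) hN.
  have h3 : pvm_op E (fun x => \1_(level phi n) x * (phi x * psi x)) (fun f => K (M f)).
    by apply: eq_pvm_op h1 => // x; rewrite /cut mulrA.
  exact: (pvm_op_unique ip f h3 h2).
have dM : spectral_dom E phi (M f).
  apply/spectral_domP => //; exists (hnorm (N f)) => n K hK; rewrite (KM n)//.
  have h := pvm_op_indic E (measurable_level n mphi).
  rewrite -[leRHS]mul1r; apply: (pvm_op_norm ip _ h) => x.
  by rewrite indicE normr_nat lern1 leq_b1.
split=> // g dg.
have /choice[K hK] : forall n, exists K, pvm_op E (cut phi n) K.
  by move=> n; exact: pvm_op_cut.
have h := spectral_form_cvg mphi hK dM dg.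
apply/esym; apply: (cvg_unique _ h) => //.
rewrite (_ : (fun n => dot (K n (M f)) g) =
    (fun n => dot (pvm_proj E (level phi n) (N f)) g)).
  exact: (dot_cvg ip (pvm_level_cvg (N f) mphi)).
by apply/funext => n; rewrite (KM n).
Qed.

Lemma spectral_dom_level phi f n : measurable_fun setT phi ->
  spectral_dom E phi (pvm_proj E (level phi n) f).
Proof.
move=> mphi; have [N hN] := pvm_op_cut n mphi.
have hM := pvm_op_indic E (measurable_level n mphi).
have h : pvm_op E (fun x => phi x * \1_(level phi n) x) N.
  by apply: eq_pvm_op hN => // x; rewrite /cut mulrC.
by case: (spectral_op_pvm f mphi hM h).
Qed.

(** The projections of [h - h'] on level sets lie in the domain and serve as test vectors: each is
    orthogonal to [h - h'], hence zero, and they converge to [h - h']. *)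
Lemma spectral_op_unique phi f h h' :
  spectral_op E phi f h -> spectral_op E phi f h' -> h = h'.
Proof.
move=> [df H] [_ H'].
have mphi : measurable_fun setT phi by move: df => /Lfun2P[].
apply/eqP; rewrite -subr_eq0; apply/eqP.
apply: (hnorm_cvg_unique ip (F := \oo) (u := fun n => pvm_proj E (level phi n) (h - h'))).
  exact: pvm_level_cvg.
rewrite (_ : (fun n => _) = fun=> 0); first exact: cvg_cst.
apply/funext => n; rewrite subr0; have mL := measurable_level n mphi.
rewrite /Defs.hnorm -(pvm_sym E _ _ mL) -pvm_setI// setIid.
have dg := spectral_dom_level (h - h') n mphi.
by rewrite pvm_sym// dotBl// H// H'// subrr sqrtr0.
Qed.

End unbounded.

(** * L^2 as a Hilbert space *)

Section L2.
Context d (S : measurableType d) (R : realType) (mu : probability S R).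
Local Notation H := (L2 mu).
Local Notation dot := (L2_dot mu).
Local Open Scope quotient_scope.
Implicit Types (f g : H) (F G : S -> R).

Lemma L2_funP f : L2_fun f \in Lfun mu 2%:E.
Proof. exact: LfunP. Qed.

Lemma measurable_L2_fun f : measurable_fun setT (L2_fun f).
Proof. by have /Lfun2P[] := L2_funP f. Qed.

Lemma L2_eq f g : {ae mu, forall x, L2_fun f x = L2_fun g x} -> f = g.
Proof.
move=> h; rewrite -[f]reprK -[g]reprK; apply/eqP/L2P.
by apply: filterS h => x /= fg _; exact: fg.
Qed.

Lemma L2_of F : F \in Lfun mu 2%:E ->
  exists f : H, {ae mu, forall x, L2_fun f x = F x}.
Proof.
move=> hF; have [G GF] : exists G : LfunType mu (lee1n 2), (G : S -> R) = F.
  by exists (Lfun_Sub (lee1n 2) hF); exact: Lfun_valP.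
exists (\pi_(L2 mu) G); have := repr_pi_ae G.
by rewrite GF; apply: filterS => x /=; apply.
Qed.

Lemma L2_fun_lin a f g :
  {ae mu, forall x, L2_fun (a *: f + g) x = a * L2_fun f x + L2_fun g x}.
Proof.
have -> : a *: f + g = \pi_(L2 mu) (a *: (repr f : LfunType mu (lee1n 2)) + repr g).
  by rewrite -pi_addE -pi_scale !reprK.
have := repr_pi_ae (a *: (repr f : LfunType mu (lee1n 2)) + repr g).
by apply: filterS => x /=; apply.
Qed.

Lemma L2_dotE f g F G : measurable_fun setT F -> measurable_fun setT G ->
  {ae mu, forall x, L2_fun f x = F x} -> {ae mu, forall x, L2_fun g x = G x} ->
  dot f g = \int[mu]_x (F x * G x).
Proof.
move=> mF mG fF gG; congr fine; apply: ae_eq_integral => //.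
- by apply/measurable_EFinP; apply: measurable_funM; exact: measurable_L2_fun.
- by apply/measurable_EFinP; exact: measurable_funM.
- by apply: filterS2 fF gG => x /= -> ->.
Qed.

Lemma L2_dot_integrable f g :
  mu.-integrable setT (EFin \o (fun x => L2_fun f x * L2_fun g x)).
Proof. by apply/Lfun1_integrable; apply: Lfun2_mul_Lfun1; exact: L2_funP. Qed.

Lemma L2_inner_product : inner_product dot.
Proof.
split.
- by move=> f g; apply: eq_Rintegral => x _; rewrite mulrC.
- move=> a f g h.
  have mF : measurable_fun setT (fun x => a * L2_fun f x + L2_fun g x).
    apply: measurable_funD (measurable_L2_fun g).
    exact: measurable_funM (measurable_cst _) (measurable_L2_fun f).
  rewrite (L2_dotE mF (measurable_L2_fun h) (L2_fun_lin a f g) (aeW _ (fun=> erefl))).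
  under eq_Rintegral do rewrite mulrDl -mulrA.
  rewrite RintegralD// ?RintegralZl//; try exact: L2_dot_integrable.
  have := integrableZl measurableT a (L2_dot_integrable f h).
  by apply: eq_integrable => // x _.
- by move=> f; apply: Rintegral_ge0 => x _; rewrite -expr2 sqr_ge0.
- move=> f f0; apply: L2_eq.
  have i := L2_dot_integrable f f.
  have e : (\int[mu]_x (EFin \o (fun x => (L2_fun f x * L2_fun f x)%R)) x = 0)%E.
    by rewrite -(fineK (integrable_fin_num measurableT i)) [fine _]f0.
  have : (\int[mu]_x `|(EFin \o (fun x => (L2_fun f x * L2_fun f x)%R)) x| = 0)%E.
    rewrite -[RHS]e; apply: eq_integral => x _.
    by rewrite gee0_abs// lee_fin -expr2 sqr_ge0.
  move/ae_eq_integral_abs => /(_ measurableT (measurable_int _ i)).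
  have h0 := L2_fun_lin 0 (0 : H) 0; rewrite addr0 scaler0 in h0.
  have h1 : {ae mu, forall x, L2_fun (0 : H) x = 0}.
    (* The representative of the zero class vanishes only almost everywhere: [(-1) *: 0 + 0 = 0]
       forces its values to satisfy [z = - z + z]. *)
    have h2 := L2_fun_lin (-1) (0 : H) 0; rewrite addr0 scaler0 in h2.
    by apply: filterS h2 => x; lra.
  apply: filterS2 h1 => x -> /(_ Logic.I)[] /eqP.
  by rewrite mulf_eq0 => /orP[] /eqP.
Qed.

Lemma hnorm_L2_sqr f F : measurable_fun setT F ->
  {ae mu, forall x, L2_fun f x = F x} ->
  ((hnorm dot f ^+ 2)%:E = \int[mu]_x (F x ^+ 2)%:E)%E.
Proof.
move=> mF fF; rewrite (sqr_hnorm L2_inner_product) (L2_dotE mF mF fF fF).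
rewrite /Rintegral fineK//.
have i := L2_dot_integrable f f.
rewrite (_ : (\int[mu]_x _)%E = (\int[mu]_x (L2_fun f x * L2_fun f x)%:E)%E).
  exact: integrable_fin_num i.
apply: ae_eq_integral => //.
- by apply/measurable_EFinP; exact: measurable_funM.
- exact: measurable_int i.
- by apply: filterS fF => x /= ->.
Qed.

Lemma L2_fun_sub f g : {ae mu, forall x, L2_fun (f - g) x = L2_fun f x - L2_fun g x}.
Proof.
have := L2_fun_lin (-1) g f; rewrite scaleN1r (addrC _ f).
by apply: filterS => x ->; rewrite mulN1r addrC.
Qed.


Lemma Lfun2_le F c : measurable_fun setT F ->
  (\int[mu]_x (F x ^+ 2)%:E <= c%:E)%E -> F \in Lfun mu 2%:E.
Proof. by move=> mF h; apply/Lfun2P; split=> //; rewrite (le_lt_trans h)// ltry. Qed.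

(* AM-GM: [|F| <= (e^-1 F^2 + e) / 2]. *)
Lemma integral_abs_le F e : 0 < e -> measurable_fun setT F ->
  (\int[mu]_x (F x ^+ 2)%:E <= (e ^+ 2)%:E)%E ->
  (\int[mu]_x `|F x|%:E <= e%:E)%E.
Proof.
move=> e0 mF h; have l2 := Lfun2_le mF h.
have i2 := Lfun2_integrable_sqr l2.
have i1 : mu.-integrable setT (EFin \o F).
  by apply/Lfun1_integrable; apply: Lfun_subset12 l2; exact: fin_num_measure.
have fi : (\int[mu]_x (F x ^+ 2)%:E)%E \is a fin_num by exact: integrable_fin_num i2.
have ia := integrable_norm i1.
have fa : (\int[mu]_x `|F x|%:E)%E \is a fin_num by exact: integrable_fin_num ia.
rewrite -(fineK fa) lee_fin.
have {}h : \int[mu]_x (F x ^+ 2) <= e ^+ 2 by rewrite -lee_fin /Rintegral fineK.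
have ic c : mu.-integrable setT (EFin \o cst c) by exact: finite_measure_integrable_cst.
have ib : mu.-integrable setT (EFin \o (fun x => (2 * e)^-1 * F x ^+ 2)).
  by have := integrableZl measurableT (2 * e)^-1 i2; apply: eq_integrable => // x _.
apply: (@le_trans _ _ (\int[mu]_x ((2 * e)^-1 * F x ^+ 2 + e / 2))).
  apply: le_Rintegral => //.
    have := integrableD measurableT ib (ic (e / 2)).
    by apply: eq_integrable => // x _.
  move=> x _; rewrite -(ler_pM2l (_ : 0 < 2 * e)) ?mulr_gt0//.
  rewrite mulrDr mulVKf ?mulf_neq0 ?gt_eqF// -(real_normK (num_real (F x))).
  have := sqr_ge0 (`|F x| - e); rewrite !expr2; nra.
have -> : \int[mu]_x ((2 * e)^-1 * F x ^+ 2 + e / 2) =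
    (2 * e)^-1 * \int[mu]_x (F x ^+ 2) + e / 2.
  have -> := RintegralD measurableT ib (ic (e / 2)).
  by rewrite (RintegralZl _ measurableT i2) Rintegral_cst//= probability_setT mulr1.
apply: (@le_trans _ _ ((2 * e)^-1 * e ^+ 2 + e / 2)).
  by rewrite lerD2r ler_wpM2l// invr_ge0 mulr_ge0// ltW.
rewrite le_eqVlt; apply/orP; left; apply/eqP; field; lra.
Qed.

(** Riesz-Fischer. On a probability space the L^1 norms of the increments are bounded by their L^2
    norms, so the sum [W] of the absolute increments is integrable and the representatives converge
    almost everywhere; Fatou's lemma turns this into L^2 convergence. *)
Lemma L2_rapid_complete : rapid_complete dot.
Proof.
move=> u hu; pose G n := L2_fun (u n).
have mG n : measurable_fun setT (G n) by exact: measurable_L2_fun.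
pose D n x := `|G n.+1 x - G n x|.
have mGB m n : measurable_fun setT (fun x => G m x - G n x) by exact: measurable_funB.
have mD n : measurable_fun setT (D n) by exact: measurableT_comp.
have hG m n : ((hnorm dot (u m - u n) ^+ 2)%:E = \int[mu]_x ((G m x - G n x) ^+ 2)%:E)%E.
  by apply: hnorm_L2_sqr => //; exact: L2_fun_sub.
have half0 n : 0 < (2^-1 : R) ^+ n by rewrite exprn_gt0.
have iD n : (\int[mu]_x (D n x)%:E <= (2^-1 ^+ n)%:E)%E.
  apply: integral_abs_le => //; rewrite -hG lee_fin lerXn2r ?nnegrE ?hnorm_ge0 ?hu//.
have D0 n x : (0 <= (D n x)%:E)%E by rewrite lee_fin normr_ge0.
pose W x := (\sum_(0 <= n <oo) (D n x)%:E)%E.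
have mW : measurable_fun setT W.
  have -> : W = (fun x => \sum_(n <oo | n \in xpredT) (D n x)%:E)%E.
    by apply/funext => x; apply: eq_eseriesl => n.
  apply: ge0_emeasurable_sum; first by move=> n x _ _; exact: D0.
  by move=> n _; exact/measurable_EFinP.
have iW : (\int[mu]_x W x < +oo)%E.
  rewrite integral_nneseries//; last by move=> n; exact/measurable_EFinP.
  apply: (@le_lt_trans _ _ 2%:E); last exact: ltry.
  apply: lime_le.
    apply: is_cvg_nneseries => n _ _.
    by apply: integral_ge0 => x _; exact: D0.
  apply: nearW => n; apply: (@le_trans _ _ (2 - 2 * 2^-1 ^+ n)%:E); last first.
    by rewrite lee_fin gerBl mulr_ge0// ltW.
  elim: n => [|n IH]; first by rewrite big_geq// expr0 mulr1 subrr.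
  rewrite big_nat_recr//=; apply: (le_trans (leeD IH (iD n))).
  by rewrite -EFinD lee_fin exprS; lra.
pose C := [set x | (W x < +oo)%E].
have mC : measurable C.
  rewrite (_ : C = W @^-1` [set x | (x < +oo)%E])// -[X in measurable X]setTI.
  by apply: mW => //; rewrite -set_itvNyo; exact: emeasurable_itv.
have C1 : {ae mu, forall x, C x}.
  have : mu.-integrable setT W.
    apply/integrableP; split => //; apply: le_lt_trans iW.
    rewrite le_eqVlt; apply/orP; left; apply/eqP; apply: eq_integral => x _.
    by rewrite gee0_abs// nneseries_ge0// => n _ _; exact: D0.
  move=> /(integrable_ae measurableT); apply: filterS => x /(_ Logic.I).
  by rewrite /C /= fin_numElt => /andP[].
(* Setting the representatives to 0 off [C] makes them converge everywhere, so that the pointwise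
   limit is measurable. *)
pose G' n x := G n x * \1_C x.
have mG' n : measurable_fun setT (G' n) by apply: measurable_funM => //; exact: measurable_indic.
have cG' x : cvgn (G' ^~ x).
  rewrite /G' indicE; have [|_] := boolP (x \in C); last first.
    by under eq_fun do rewrite mulr0; exact: is_cvg_cst.
  rewrite inE /C /= => Wx; under eq_fun do rewrite mulr1.
  have : cvgn (series (telescope (G ^~ x))).
    apply: normed_cvg; apply: nondecreasing_is_cvgn.
      by apply: nondecreasing_series => n _ _; exact: normr_ge0.
    exists (fine (W x)) => _ [n _ <-].
    have W0 : (0 <= W x)%E by apply: nneseries_ge0 => k _ _; exact: D0.
    rewrite -lee_fin fineK ?ge0_fin_numE// -sumEFin.
    by apply: nneseries_lim_ge => k _ _; exact: D0.
  move=> h; have -> : G ^~ x = (fun n => G 0%N x + series (telescope (G ^~ x)) n).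
    by apply/funext => n; exact: eq_sum_telescope.
  exact: is_cvgD (is_cvg_cst _) h.
pose F x := lim (G' n x @[n --> \oo]).
have mF : measurable_fun setT F.
  by apply: (@measurable_fun_cvg _ _ _ _ G') => // x _; exact: cG'.
have dist n k : hnorm dot (u (n + k)%N - u n) <= 2 * 2^-1 ^+ n.
  apply: (@le_trans _ _ (2 * 2^-1 ^+ n - 2 * 2^-1 ^+ (n + k))); last first.
    by rewrite gerBl mulr_ge0// ltW.
  elim: k => [|k IH]; first by rewrite addn0 !subrr (hnorm_zero L2_inner_product).
  rewrite addnS (le_trans (hnorm_triangle L2_inner_product (u (n + k)%N) _ _))//.
  by rewrite (le_trans (lerD (hu _) IH))// exprS; lra.
have fat n : (\int[mu]_x ((G' n x - F x) ^+ 2)%:E <= ((2 * 2^-1 ^+ n) ^+ 2)%:E)%E.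
  pose f_ m x := ((G' n x - G' (n + m)%N x) ^+ 2)%:E.
  have mf_ m : measurable_fun setT (f_ m).
    by apply/measurable_EFinP; apply: measurable_funX; exact: measurable_funB.
  have f_cvg x : f_ m x @[m --> \oo] --> ((G' n x - F x) ^+ 2)%:E.
    apply: cvg_EFin; first exact: nearW.
    apply: (@cvg_trans _ _ (((G' n x - G' (n + m)%N x) * (G' n x - G' (n + m)%N x)) @[m --> \oo])).
      by apply: near_eq_cvg; exact: nearW.
    have h : G' n x - G' (n + m)%N x @[m --> \oo] --> G' n x - F x.
      apply: cvgB; first exact: cvg_cst.
      under eq_fun do rewrite addnC.
      have h0 : G' ^~ x @ \oo --> F x := cG' x.
      by rewrite -(cvg_shiftn n) in h0.
    exact: (cvgM h h).
  have -> : (\int[mu]_x ((G' n x - F x) ^+ 2)%:E = \int[mu]_x limn_einf (f_ ^~ x))%E.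
    apply: eq_integral => x _.
    by rewrite is_cvg_limn_einfE; [apply/esym/cvg_lim|apply/cvg_ex; eexists; exact: f_cvg].
  apply: le_trans.
    by apply: fatou => // m x _; rewrite lee_fin sqr_ge0.
  rewrite limn_einf_lim; apply: lime_le; first exact: is_cvg_einfs.
  apply: nearW => m; apply: (@le_trans _ _ (\int[mu]_x f_ m x)%E).
    by apply: ereal_inf_lbound; exists m => //=.
  apply: (@le_trans _ _ (\int[mu]_x ((G (n + m)%N x - G n x) ^+ 2)%:E)%E).
    apply: ge0_le_integral => //.
    - by move=> x _; rewrite lee_fin sqr_ge0.
    - by apply/measurable_EFinP; apply: measurable_funX; exact: measurable_funB.
    - move=> x _; rewrite lee_fin /G' indicE; case: (x \in C).
        by rewrite !mulr1 -sqrrN opprB.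
      by rewrite !mulr0 subrr expr0n sqr_ge0.
  rewrite -hG lee_fin lerXn2r ?dist// nnegrE ?hnorm_ge0//.
have G'L n : G' n \in Lfun mu 2%:E.
  rewrite Lfun2P; split=> //.
  have /Lfun2P[_] := L2_funP (u n); apply: le_lt_trans.
  apply: ge0_le_integral => //.
  - by move=> x _; rewrite lee_fin sqr_ge0.
  - by apply/measurable_EFinP; exact: measurable_funX.
  - by apply/measurable_EFinP; exact: measurable_funX.
  - move=> x _; rewrite lee_fin /G' indicE; case: (x \in C); first by rewrite mulr1.
    by rewrite mulr0 expr0n sqr_ge0.
have FL : F \in Lfun mu 2%:E.
  have h : (fun x => G' 0%N x - F x) \in Lfun mu 2%:E.
    by apply: Lfun2_le (fat 0%N); exact: measurable_funB.
  have -> : F = (fun x => -1 * (G' 0%N x - F x) + G' 0%N x).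
    by apply/funext => x; ring.
  exact: Lfun2_lin.
have [l lF] := L2_of FL.
exists l; apply: (@squeeze_cvgr _ _ _ _ (cst 0) (fun n => 2 * 2^-1 ^+ n)).
- apply: nearW => n; rewrite hnorm_ge0 /=.
  apply: (@hnorm_le _ _ _ L2_inner_product _ (2 * 2^-1 ^+ n)).
    by rewrite mulr_ge0// ltW.
  rewrite -(sqr_hnorm L2_inner_product) -lee_fin; apply: le_trans (fat n).
  rewrite (@hnorm_L2_sqr _ (fun x => G' n x - F x))//; first exact: measurable_funB.
  have := L2_fun_sub (u n) l; apply: filterS3 lF C1 => x Fx Cx ->.
  by rewrite Fx /G' indicE mem_set// mulr1.
- exact: cvg_cst.
- rewrite -[X in _ --> X](mulr0 2); apply: cvgMr.
  by apply: cvg_expr; rewrite ger0_norm ?invf_lt1 ?ltr1n ?invr_ge0.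
Qed.

End L2.

(** * Markov generators are negative *)

Section markov_semigroup.
Context d (S : measurableType d) (R : realType) (p : R -> R.-pker S ~> S).
Context (mu : probability S R) (inv : invariant_law p mu).
Local Notation dot := (L2_dot mu).

Import HBNNSimple.

(** Invariance is stated for sets; simple approximations carry it to nonnegative functions, with
    monotone convergence under [mu], under each kernel [p t x], and for the outer integral. *)
Lemma invariant_integral t (f : S -> \bar R) : 0 <= t ->
  (forall x, 0 <= f x)%E -> measurable_fun setT f ->
  (\int[mu]_x \int[p t x]_y f y = \int[mu]_x f x)%E.
Proof.
move=> t0 f0 mf; pose g := nnsfun_approx measurableT mf.
pose gE n := EFin \o g n.
have mgE n : measurable_fun setT (gE n) by exact/measurable_EFinP.
have gE0 n x : (0 <= gE n x)%E by rewrite lee_fin.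
have nd_gE x : {homo gE ^~ x : n m / (n <= m)%N >-> (n <= m)%E}.
  by move=> *; exact/lefP/nd_nnsfun_approx.
have lim_gE (m : {measure set S -> \bar R}) :
    (\int[m]_x f x = limn (fun n => \int[m]_x gE n x))%E.
  rewrite -monotone_convergence//; apply: eq_integral => x _.
  by apply/esym/cvg_lim => //; exact: cvg_nnsfun_approx.
rewrite (lim_gE mu); under eq_integral do rewrite lim_gE.
rewrite monotone_convergence//; last 3 first.
- move=> n; apply: measurable_fun_integral_kernel => //.
  by move=> B mB; exact: measurable_kernel.
- by move=> n x _; apply: integral_ge0.
- by move=> x _ m n mn; apply: ge0_le_integral => // y _; exact: nd_gE.
apply: congr_lim; apply/funext => n.
rewrite integralT_nnsfun sintegralE; under eq_integral do rewrite integralT_nnsfun sintegralE.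
rewrite ge0_integral_fsum//; last 2 first.
- by move=> r; apply: measurable_funeM; exact: measurable_kernel.
- by move=> r x _; exact: nnsfun_mulemu_ge0.
apply: eq_fsbigr => r _; have [r0|r0] := leP 0 r.
  by rewrite ge0_integralZl// ?inv//; exact: measurable_kernel.
rewrite preimage_nnfun0// measure0 mule0 integral0_eq// => x _.
by rewrite measure0 mule0.
Qed.

(* <U_t f, f> <= (|U_t f|^2 + |f|^2) / 2, where |U_t f|^2 <= U_t (f^2) pointwise. *)
Lemma transition_semigroup_le t (f : L2 mu) : 0 <= t ->
  dot (transition_semigroup p mu t f) f <= dot f f.
Proof.
(* If no class represents the kernel average of [f], [xget] returns 0 and the bound reads
   [0 <= dot f f]. *)
move=> t0; rewrite /transition_semigroup; case: xgetP => [h _ /= hU|_]; last first.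
  by rewrite (dot0l (L2_inner_product mu)) (dot_ge0 (L2_inner_product mu)).
pose F := L2_fun f; pose q x := (\int[p t x]_y (F y ^+ 2)%:E)%E.
have mF : measurable_fun setT F by exact: measurable_L2_fun.
have mF2 : measurable_fun setT (fun x => (F x ^+ 2)%:E).
  by apply/measurable_EFinP; exact: measurable_funX.
have q0 x : (0 <= q x)%E by apply: integral_ge0 => y _; rewrite lee_fin sqr_ge0.
have mq : measurable_fun setT q.
  apply: measurable_fun_integral_kernel => //; first by move=> B mB; exact: measurable_kernel.
  by move=> y; rewrite lee_fin sqr_ge0.
have iq : (\int[mu]_x q x = \int[mu]_x (F x ^+ 2)%:E)%E.
  by apply: invariant_integral => // y; rewrite lee_fin sqr_ge0.
have key : {ae mu, forall x, `|(L2_fun h x * F x)%:E| <= 2^-1%:E * (q x + (F x ^+ 2)%:E)}%E.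
  apply: filterS hU => x ->.
  have [qy|] := ltP (q x) +oo%E; last first.
    by rewrite leye_eq => /eqP ->; rewrite addye// gt0_muley ?leey// lte_fin invr_gt0.
  have l2 : F \in Lfun (p t x) 2%:E by apply/Lfun2P.
  have i2 := Lfun2_integrable_sqr l2.
  have i1 : (p t x).-integrable setT (EFin \o F).
    by apply/Lfun1_integrable; apply: Lfun_subset12 l2; rewrite prob_kernel.
  (* The integral of [(F y + c) ^+ 2] against [p t x]. At [c = F x] and [c = - F x] it bounds the
     product of [F x] and the average of [F], in absolute value, by the half sum of [q x] and
     [F x ^+ 2]: Jensen and AM-GM in one step. *)
  have e c : 0 <= \int[p t x]_y (F y ^+ 2) + (2 * c) * \int[p t x]_y F y + c ^+ 2.
    have ic : (p t x).-integrable setT (EFin \o cst (c ^+ 2)).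
      apply: measurable_bounded_integrable => //; last exact: bounded_cst.
      by rewrite prob_kernel ltry.
    have il : (p t x).-integrable setT (EFin \o (fun y => 2 * c * F y)).
      by have := integrableZl measurableT (2 * c) i1; apply: eq_integrable => // y _.
    have iS : (p t x).-integrable setT (EFin \o (fun y => F y ^+ 2 + 2 * c * F y)).
      by have := integrableD measurableT i2 il; apply: eq_integrable => // y _.
    have h1 := RintegralD measurableT i2 il.
    have h2 := RintegralD measurableT iS ic.
    move: h2; rewrite h1 (RintegralZl _ measurableT i1) Rintegral_cst//= prob_kernel mulr1 => <-.
    apply: Rintegral_ge0 => y _; have := sqr_ge0 (F y + c); rewrite sqrrD; lra.
  have qE : q x = (\int[p t x]_y (F y ^+ 2))%:E.
    by rewrite /Rintegral fineK// integrable_fin_num.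
  rewrite qE -EFinD -EFinM abse_EFin lee_fin ler_norml.
  have := e (F x); have := e (- F x); rewrite sqrrN => h1 h2.
  by apply/andP; split; lra.
have sq0 x : (0 <= (F x ^+ 2)%:E)%E by rewrite lee_fin sqr_ge0.
have half0 : (0 <= (2^-1 : R)%:E)%E by rewrite lee_fin invr_ge0.
have i := L2_dot_integrable h f.
rewrite -lee_fin /L2_dot /Rintegral !fineK; try exact: integrable_fin_num (L2_dot_integrable _ _).
apply: (@le_trans _ _ (\int[mu]_x `|(L2_fun h x * F x)%:E|)%E).
  apply: le_trans (lee_abs _) _; apply: le_abse_integral => //.
  exact: measurable_int i.
apply: (@le_trans _ _ (\int[mu]_x (2^-1%:E * (q x + (F x ^+ 2)%:E)))%E).
  apply: ae_ge0_le_integral => //.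
  - by apply: measurableT_comp => //; exact: measurable_int i.
  - by move=> x _; rewrite mule_ge0// adde_ge0.
  - by apply: measurable_funeM; exact: emeasurable_funD.
  - by apply: filterS key => x + _.
rewrite ge0_integralZl//; last 2 first.
- exact: emeasurable_funD.
- by move=> x _; rewrite adde_ge0.
rewrite ge0_integralD// iq -ge0_integralD//.
rewrite -ge0_integralZl//; last 2 first.
- exact: emeasurable_funD.
- by move=> x _; rewrite adde_ge0.
rewrite le_eqVlt; apply/orP; left; apply/eqP; apply: eq_integral => x _.
by rewrite -EFinD -EFinM; congr EFin; rewrite -/(F x); lra.
Qed.

Lemma markov_generator_le0 (f g : L2 mu) : markov_generator p mu f g -> dot g f <= 0.
Proof.
move=> /(dot_cvg (L2_inner_product mu) (g := f)) h; apply: (cvgr_to_le h).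
near=> t; have t0 : 0 < t by near: t; exact: nbhs_right_gt.
rewrite dotZl; last exact: L2_inner_product.
rewrite dotBl; last exact: L2_inner_product.
rewrite pmulr_rle0 ?invr_gt0// subr_le0.
by apply: transition_semigroup_le; exact: ltW.
Unshelve. all: by end_near. Qed.

End markov_semigroup.

(** * The spectral gap *)

Lemma measurable_inv (R : realType) :
  measurable_fun setT (fun x : measurableTypeR R => x^-1 : R).
Proof.
rewrite -(setvU [set 0]); apply/measurable_funU => //.
- exact: measurableC.
split.
  apply: open_continuous_measurable_fun => [|x].
    by rewrite openC; exact: closed_eq.
  by rewrite inE /= => /eqP; exact: inv_continuous.
move=> _ Y mY; have [Y0|Y0] := pselect (Y 0).
  rewrite (_ : _ `&` _ = [set 0])//; apply/seteqP; split => [x []//|x /= ->].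
  by rewrite /= invr0.
rewrite (_ : _ `&` _ = set0)//; apply/seteqP; split => // x /= [->].
by rewrite invr0.
Qed.

Section green.
Context d (S : measurableType d) (R : realType) (mu : probability S R).
Local Notation dot := (L2_dot mu).
Local Notation H := (L2 mu).
Local Notation TR := (measurableTypeR R).
Let ip := L2_inner_product mu.
Let cpl := @L2_rapid_complete _ _ _ mu.
Context (A : H -> H -> Prop) (E : pvm dot).
Context (A_range : op_range A = [set f | f \in mean_zero mu]).
Context (A_bij : bijective_op (op_perp A)).
Context (A_le0 : forall f g, A f g -> dot g f <= 0).
Context (E_res : spectral_resolution E A).
Context (A_bnd : bounded_linear (perp_dot mu) (op_inv (op_perp A))).

Lemma measurable_idTR : measurable_fun setT (@id TR : TR -> R).
Proof. exact: measurable_id. Qed.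

Lemma resolution_op chi M N f : pvm_op E chi M ->
  pvm_op E (fun x => x * chi x) N -> A (M f) (N f).
Proof.
move=> hM hN; apply/E_res; apply: (spectral_op_pvm ip cpl (psi := chi)) => //.
Qed.

Lemma A_mean_zero f g : A f g -> g \in mean_zero mu.
Proof. by move=> Afg; have : op_range A g by [exists f]; rewrite A_range. Qed.

Lemma pvm_op_ex (phi : TR -> R) m : measurable_fun setT phi ->
  (forall x, `|phi x| <= m) -> exists L, pvm_op E phi L.
Proof. exact: pvm_op_exists. Qed.


Lemma pvm_proj_le0 B f : measurable B -> pvm_meas E f B = 0%E -> pvm_proj E B f = 0.
Proof.
move=> mB; rewrite pvm_meas_proj// => -[h]; exact: (dot_eq0 ip).
Qed.

(** [E(B) f = 0] means that [B] is null for the measure of [f]. This lets the line be treated in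
    slices on which the symbols are bounded. *)
Lemma pvm_proj_bigcup0 (B_ : nat -> set TR) f : (forall n, measurable (B_ n)) ->
  (forall n, pvm_proj E (B_ n) f = 0) -> pvm_proj E (\bigcup_n B_ n) f = 0.
Proof.
move=> mB h; have mU : measurable (\bigcup_n B_ n) by exact: bigcup_measurable.
apply: pvm_proj_le0 => //; apply/negligibleP => //; apply: negligible_bigcup => n.
apply: (proj2 (negligibleP _ (mB n))).
by have := pvm_meas_proj E f (mB n); rewrite h (dot0l ip).
Qed.

(** As [chi] vanishes near 0, [chi(x) / x] is bounded and [M f] is [A] applied to some vector; the
    range of [A] has mean zero. *)
Lemma pvm_op_mean_zero chi M e f : 0 < e -> pvm_op E chi M ->
  (forall x, chi x != 0 -> e <= `|x|) -> M f \in mean_zero mu.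
Proof.
move=> e0 hM hchi; have [m bM] := pvm_op_bnd hM.
have [||N hN] := @pvm_op_ex (fun x => x^-1 * chi x) (e^-1 * m).
- apply: measurable_funM (pvm_op_meas hM).
  exact: measurable_inv.
- move=> x; have [->|xn0] := eqVneq (chi x) 0.
    by rewrite mulr0 normr0 mulr_ge0 ?invr_ge0 ?(ltW e0)// (le_trans _ (bM 0)).
  rewrite normrM ler_pM// normfV lef_pV2 ?posrE// ?hchi//.
  by rewrite (lt_le_trans e0)// hchi.
apply: (@A_mean_zero (N f)); apply: resolution_op hN _.
apply: eq_pvm_op hM => // x.
have [->|xn0] := eqVneq (chi x) 0; first by rewrite !mulr0.
by rewrite mulrA mulfV ?mul1r// -normr_gt0 (lt_le_trans e0)// hchi.
Qed.

(** On the slice [1/(n+1), n+1] the quadratic form of [A] is at least [1/(n+1)] times the squared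
    norm, while negativity of [A] makes it at most 0. *)
Lemma resolution_pos0 f : pvm_proj E `]0, +oo[%classic f = 0.
Proof.
have -> : `]0, +oo[%classic = \bigcup_n `[n.+1%:R^-1, n.+1%:R]%classic :> set TR.
  apply/seteqP; split => x /=; rewrite in_itv/= ?andbT.
    move=> x0; exists (maxn (Num.truncn x) (Num.truncn x^-1)) => //=.
    rewrite in_itv/=; apply/andP; split.
      rewrite invf_ple ?posrE// ltW// (lt_le_trans (truncnS_gt _))//.
      by rewrite ler_nat ltnS leq_maxr.
    by rewrite ltW// (lt_le_trans (truncnS_gt _))// ler_nat ltnS leq_maxl.
  by move=> [n _ /=]; rewrite in_itv/= => /andP[h _]; exact: lt_le_trans h.
apply: pvm_proj_bigcup0 => n; first exact: measurable_itv.
set B := (X in pvm_proj E X); have mB : measurable B by exact: measurable_itv.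
have hB := pvm_op_indic E mB.
have [||N hN] := @pvm_op_ex (fun x => x * \1_B x) n.+1%:R.
- by apply: measurable_funM measurable_idTR _; exact: measurable_indic.
- move=> x; rewrite indicE; have [|_] := boolP (x \in B); last first.
    by rewrite mulr0 normr0.
  rewrite inE /B /= in_itv/= mulr1 => /andP[x0 xn].
  by rewrite ger0_norm// (le_trans _ x0)// invr_ge0.
have h1 := A_le0 (resolution_op f hB hN).
have BN : pvm_proj E B (N f) = N f.
  apply: (pvm_op_unique ip f (pvm_op_restrict mB hN)); apply: eq_pvm_op hN => // x.
  by rewrite indicE; case: (x \in B); rewrite ?mulr1 ?mul1r// !mulr0.
rewrite -pvm_sym// BN in h1.
have h2 := pvm_op_lincomb ip n.+1%:R^-1 hB (pvm_op_lincomb ip (-1) hN (pvm_op0 ip E)).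
have := pvm_op_le (c := 0) f h2.
rewrite !(dotE ip) mul0r dot0l// => h3.
apply: pvm_proj_le0 => //; rewrite pvm_measE//; congr EFin; apply/eqP.
rewrite eq_le; apply/andP; split; last first.
  by rewrite -{1}(setIid B) pvm_setI// pvm_sym// (dot_ge0 ip).
rewrite -(@ler_pM2l _ n.+1%:R^-1) ?invr_gt0// mulr0.
apply: (le_trans _ h1); rewrite -subr_le0.
have -> : n.+1%:R^-1 * dot (pvm_proj E B f) f - dot (N f) f =
  n.+1%:R^-1 * dot (pvm_proj E B f) f + (-1 * dot (N f) f + 0) by rewrite mulN1r addr0.
apply: h3 => x; rewrite indicE; have [|_] := boolP (x \in B); last first.
  by rewrite !mulr0 !addr0.
by rewrite inE /B /= in_itv/= => /andP[h _]; rewrite /= !mulr1 addr0 mulN1r subr_le0.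
Qed.

(** On the slice [A] multiplies norms by at most [de] and its inverse by at most [K]; with
    [de * K < 1] only 0 is left. The lower bound [e] keeps [x^-1] bounded there, so that the
    preimage under [A] is given by the calculus. *)
Lemma pvm_proj_inv_bound (K de e : R) (B : set TR) f : 0 < e -> 0 <= de -> de * K < 1 ->
  (forall g, hnorm (perp_dot mu) (op_inv (op_perp A) g) <= K * hnorm (perp_dot mu) g) ->
  measurable B -> (forall x : R, B x -> e <= `|x| <= de) -> pvm_proj E B f = 0.
Proof.
move=> e0 de0 deK hK mB hB; have oB := pvm_op_indic E mB.
have B0 x : \1_B x != 0 :> R -> B x.
  by rewrite indicE; have [|_] := boolP (x \in B); rewrite ?inE// eqxx.
have g0 : pvm_proj E B f \in mean_zero mu.
  by apply: (pvm_op_mean_zero f e0 oB) => x /B0/hB/andP[].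
have [||N hN] := @pvm_op_ex (fun x => x^-1 * \1_B x) e^-1.
- apply: measurable_funM; first exact: measurable_inv.
  exact: measurable_indic.
- move=> x; rewrite indicE; have [|_] := boolP (x \in B); last first.
    by rewrite mulr0 normr0 invr_ge0 ltW.
  rewrite inE => /hB/andP[ex _]; rewrite mulr1 normfV lef_pV2 ?posrE//.
  exact: lt_le_trans ex.
have xn0 x : B x -> x != 0.
  by move=> /hB/andP[h _]; rewrite -normr_gt0 (lt_le_trans e0).
have AN : A (N f) (pvm_proj E B f).
  apply: resolution_op hN _; apply: eq_pvm_op oB => // x.
  rewrite indicE; have [|_] := boolP (x \in B); last by rewrite !mulr0.
  by rewrite inE => /xn0 h; rewrite mulrA mulfV ?mul1r.
have w0 : N f \in mean_zero mu.
  apply: (pvm_op_mean_zero f e0 hN) => x; rewrite mulf_eq0 negb_or => /andP[_].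
  by move=> /B0/hB/andP[].
have invE : op_inv (op_perp A) (Perp g0) = Perp w0.
  have [u [Au uu]] := A_bij (Perp g0).
  rewrite /op_inv; case: xgetP => [v _ /= Av|/(_ u)//].
  by rewrite -(uu v Av); apply: uu.
have [||L hL] := @pvm_op_ex (fun x => x * \1_B x) de.
- by apply: measurable_funM measurable_idTR _; exact: measurable_indic.
- move=> x; rewrite indicE; have [|_] := boolP (x \in B); last by rewrite mulr0 normr0.
  by rewrite inE mulr1 => /hB/andP[].
have LN : L (N f) = pvm_proj E B f.
  apply: (pvm_op_unique ip f (pvm_op_mul ip hL hN)); apply: eq_pvm_op oB => // x.
  rewrite indicE; have [|_] := boolP (x \in B); last by rewrite !mulr0.
  by rewrite inE => /xn0 h; rewrite !mulr1 mulfV.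
have h1 : hnorm dot (N f) <= K * hnorm dot (pvm_proj E B f).
  by have := hK (Perp g0); rewrite invE.
have h2 : hnorm dot (pvm_proj E B f) <= de * hnorm dot (N f).
  rewrite -{1}LN; apply: (pvm_op_norm ip _ hL) => x.
  rewrite indicE; have [|_] := boolP (x \in B); last by rewrite mulr0 normr0.
  by rewrite inE mulr1 => /hB/andP[].
apply: (hnorm_eq0 ip); apply/eqP; rewrite eq_le hnorm_ge0 andbT.
have h3 := le_trans h2 (ler_wpM2l de0 h1).
have : (1 - de * K) * hnorm dot (pvm_proj E B f) <= 0.
  by rewrite mulrBl mul1r subr_le0 -mulrA.
by rewrite pmulr_rle0// subr_gt0.
Qed.

Definition below (de : R) : set TR := `]-oo, (- de)[%classic.

Lemma measurable_below de : measurable (below de).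
Proof. exact: measurable_itv. Qed.

Lemma spectral_gap : exists2 de : R, 0 < de &
  forall f, f \in mean_zero mu -> pvm_proj E (below de) f = f.
Proof.
have [_ [K0 hK0]] := A_bnd.
pose K := `|K0| + 1; have K1 : 0 < K by rewrite ltr_wpDl.
have hK g : hnorm (perp_dot mu) (op_inv (op_perp A) g) <= K * hnorm (perp_dot mu) g.
  rewrite (le_trans (hK0 g))// ler_wpM2r ?hnorm_ge0// (le_trans (ler_norm _))//.
  by rewrite lerDl.
(* This choice gives [de * K = 1 - de < 1]. *)
pose de := (K + 1)^-1; have de0 : 0 < de by rewrite invr_gt0 addr_gt0.
have deK : de * K < 1.
  have : (K + 1) * de = 1 by rewrite mulfV// gt_eqF// addr_gt0.
  by move: de0; rewrite mulrDl mul1r (mulrC K); move: (de * K) => y; lra.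
exists de => // f f0.
have neg0 g : pvm_proj E `[(- de), 0[%classic g = 0.
  have -> : `[(- de), 0[%classic = \bigcup_n `[(- de), (- n.+1%:R^-1)]%classic :> set TR.
    apply/seteqP; split => x /=; rewrite in_itv/= ?andbT.
      move=> /andP[dx x0]; exists (Num.truncn (- x)^-1) => //=.
      rewrite in_itv/= dx /= lerNr invf_ple ?posrE ?oppr_gt0// ltW//.
      exact: truncnS_gt.
    move=> [n _ /=]; rewrite in_itv/= => /andP[-> h] /=.
    by rewrite (le_lt_trans h)// oppr_lt0 invr_gt0.
  apply: pvm_proj_bigcup0 => n; first exact: measurable_itv.
  apply: (@pvm_proj_inv_bound K de n.+1%:R^-1) => //.
  - exact: ltW.
  - move=> x /=; rewrite in_itv/= => /andP[h1 h2].
    have x0 : x <= 0 by rewrite (le_trans h2)// oppr_le0 invr_ge0.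
    by rewrite ler0_norm// lerNr h2 lerNl h1.
have mb := measurable_below de.
pose Z : set TR := [set 0]; have mZ : measurable Z by exact: measurable_set1.
have parts (x : TR) : 1 * \1_(below de) x + (1 * \1_Z x +
    (1 * \1_`[(- de), 0[%classic x + \1_`]0, +oo[%classic x)) = 1 :> R.
  have i1 : \1_(below de) x = (x < - de)%R%:R :> R by rewrite indicE mem_setE in_itv.
  have iZ : \1_Z x = (x == 0)%R%:R :> R.
    by rewrite indicE (_ : (x \in Z) = (x == 0)%R)//; apply/idP/eqP; rewrite inE.
  have i2 : \1_`[(- de), 0[%classic x = (- de <= x < 0)%R%:R :> R.
    by rewrite indicE mem_setE in_itv.
  have i3 : \1_`]0, +oo[%classic x = (0 < x)%R%:R :> R.
    by rewrite indicE mem_setE in_itv/= andbT.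
  rewrite /= !mul1r i1 iZ i2 i3.
  have dn : - de < 0 by rewrite oppr_lt0.
  have [x0|x0|x0] := ltgtP x 0.
  - by rewrite !addr0 add0r andbT leNgt; case: (x < _); rewrite ?addr0 ?add0r.
  - by rewrite andbF !add0r (_ : (x < - de) = false) ?add0r//; apply/negbTE; rewrite -leNgt ltW// (lt_trans dn).
  - by rewrite x0 (_ : (0 < - de) = false) ?andbF ?add0r ?addr0//; apply/negbTE; rewrite -leNgt ltW.
have mN : measurable (`[(- de), 0[%classic : set TR) by exact: measurable_itv.
have mP : measurable (`]0, +oo[%classic : set TR) by exact: measurable_itv.
have split3 g : g = pvm_proj E (below de) g + pvm_proj E Z g.
  have o := pvm_op_lincomb ip 1 (pvm_op_indic E mb) (pvm_op_lincomb ip 1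
    (pvm_op_indic E mZ) (pvm_op_lincomb ip 1 (pvm_op_indic E mN) (pvm_op_indic E mP))).
  have := pvm_op_unique ip g (eq_pvm_op parts (fun=> erefl) o) (pvm_op1 E).
  by rewrite /= neg0 resolution_pos0 !scale1r !addr0.
have bm g : pvm_proj E (below de) g \in mean_zero mu.
  apply: (pvm_op_mean_zero g de0 (pvm_op_indic E mb)) => x.
  rewrite indicE; have [|_] := boolP (x \in below de); last by rewrite eqxx.
  rewrite inE /below /= in_itv/= => h _; rewrite ler0_norm; lra.
(* The norm estimate does not reach the point 0 of the spectrum: [E({0}) f] is a mean-zero vector in
   the kernel of [A], and injectivity on the mean-zero space makes it zero. *)
have z0 : pvm_proj E Z f \in mean_zero mu.
  have -> : pvm_proj E Z f = f - pvm_proj E (below de) f.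
    by rewrite {2}(split3 f) addrAC subrr add0r.
  by rewrite rpredB.
have A00 : A 0 0.
  have h : pvm_op E (fun x => x * cst 0 x) (fun=> 0).
    by apply: eq_pvm_op (pvm_op0 ip E) => // x; rewrite /= mulr0.
  exact: (resolution_op 0 (pvm_op0 ip E) h).
have AZ : A (pvm_proj E Z f) 0.
  have h : pvm_op E (fun x => x * \1_Z x) (fun=> 0).
    apply: eq_pvm_op (pvm_op0 ip E) => // x; rewrite indicE.
    have [|_] := boolP (x \in Z); last by rewrite mulr0.
    by rewrite inE /Z /= => ->; rewrite mul0r.
  exact: (resolution_op f (pvm_op_indic E mZ) h).
have [u [_ uu]] := A_bij 0.
rewrite {2}(split3 f) (_ : pvm_proj E Z f = 0) ?addr0//.
have h1 : u = 0 by apply: uu.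
have h2 : u = Perp z0 by apply: uu.
by rewrite -[LHS]/(perp_val (Perp z0)) -h2 h1.
Qed.

End green.

(** * The Green operator and the transformation T *)

Section green_operators.
Context d (S : measurableType d) (R : realType) (mu : probability S R).
Local Notation dot := (L2_dot mu).
Local Notation H := (L2 mu).
Local Notation TR := (measurableTypeR R).
Let ip := L2_inner_product mu.
Let cpl := @L2_rapid_complete _ _ _ mu.
Context (A : H -> H -> Prop) (E : pvm dot).
Context (A_range : op_range A = [set f | f \in mean_zero mu]).
Context (A_bij : bijective_op (op_perp A)).
Context (A_le0 : forall f g, A f g -> dot g f <= 0).
Context (A_sub : forall f g f' g', A f g -> A f' g' -> A (f - f') (g - g')).
Context (E_res : spectral_resolution E A).
Context (A_bnd : bounded_linear (perp_dot mu) (op_inv (op_perp A))).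
Context (m2 : R) (m2_ge0 : 0 <= m2).

Lemma perp_inner_product : inner_product (perp_dot mu).
Proof.
split.
- by move=> f g; exact: (dotC ip).
- by move=> a f g h; exact: (dot_linl ip).
- by move=> f; exact: (dot_ge0 ip).
- by move=> f f0; apply: val_inj; exact: (dot_eq0 ip).
Qed.

Let rho (x : TR) : R := (Num.sqrt (m2 - x))^-1.
Let sig (x : TR) : R := Num.sqrt (- x).
Let gam (x : TR) : R := (m2 - x)^-1.
Let inv (x : TR) : R := x^-1.

Let mm2 : measurable_fun setT (fun x : TR => m2 - x : R).
Proof. by apply: measurable_funB => //; exact: measurable_id. Qed.

Let measurable_sqrt : measurable_fun setT (fun x : TR => Num.sqrt x : R).
Proof. by apply: continuous_measurable_fun; exact: sqrt_continuous. Qed.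

Let mrho : measurable_fun setT rho.
Proof.
by apply: (measurableT_comp (@measurable_inv R)); exact: (measurableT_comp measurable_sqrt mm2).
Qed.

Let msig : measurable_fun setT sig.
Proof.
apply: (measurableT_comp measurable_sqrt).
by apply: measurable_funN; exact: measurable_id.
Qed.

Let mgam : measurable_fun setT gam.
Proof. exact: (measurableT_comp (@measurable_inv R) mm2). Qed.

Let opK de (phi : TR -> R) m : measurable_fun setT phi -> 0 <= m ->
  (forall x : R, x < - de -> `|phi x| <= m) ->
  exists L, pvm_op E (fun x => \1_(below de) x * phi x) L.
Proof.
move=> mphi m0 h; apply: (pvm_op_exists ip _ (m := m)) => //.
  by apply: measurable_funM => //; apply: measurable_indic; exact: measurable_below.
move=> x; rewrite indicE; have [|_] := boolP (x \in _); last by rewrite mul0r normr0.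
by rewrite inE /below /= in_itv/= mul1r; exact: h.
Qed.

(** [LR], [LT], [LC] and [LI] stand for [(m2 - A)^(-1/2)], [T], [(m2 - A)^-1] and [A^-1]. They are
    built on all of L^2 with symbols cut to a half-line below 0, that is, composed with the
    projection on the mean-zero space. *)
Record green_ops (LR LT LC LI : H -> H) : Prop := {
  go_lin : bounded_linear dot LT ;
  go_linC : bounded_linear dot LC ;
  go_zero : forall f, [/\ LR f \in mean_zero mu, LT f \in mean_zero mu,
    LC f \in mean_zero mu & LI f \in mean_zero mu] ;
  go_rho : forall f, f \in mean_zero mu -> spectral_op E rho f (LR f) ;
  go_sig : forall f, spectral_op E sig (LR f) (LT f) ;
  go_inv : forall f, f \in mean_zero mu -> A (LI f) f ;
  go_green : forall f, f \in mean_zero mu -> A (LC f) (m2 *: LC f - f) ;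
  go_cov : forall f g, dot (LT f) (LI (LT g)) = - dot f (LC g) ;
  go_inj : forall f, f \in mean_zero mu -> dot f (LC f) = 0 -> f = 0 }.

Lemma green_opsP : exists LR LT LC LI, green_ops LR LT LC LI.
Proof.
have [de de0 gap] := spectral_gap A_range A_bij A_le0 E_res A_bnd.
pose K := below de; have mK : measurable K by exact: measurable_below.
have Kx (x : R) : x < - de -> [/\ 0 < m2 - x, de <= m2 - x, x < 0 & de <= - x].
  move=> xd; have x1 : de < - x by rewrite ltrNr.
  have x2 : - x <= m2 - x by rewrite lerDr.
  split; [exact: lt_le_trans (lt_trans de0 x1) x2|exact: le_trans (ltW x1) x2| |exact: ltW].
  by rewrite -oppr_gt0 (lt_trans de0).
have oK := pvm_op_indic E mK.
have [||LR hR] := @opK de rho (Num.sqrt de)^-1 mrho.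
- by rewrite invr_ge0 sqrtr_ge0.
- move=> x /Kx[x0 dx _ _]; rewrite /rho ger0_norm ?invr_ge0 ?sqrtr_ge0//.
  by rewrite lef_pV2 ?posrE ?sqrtr_gt0// ler_sqrt// ltW.
have [||LT hT] := @opK de (fun x => sig x * rho x) 1 (measurable_funM msig mrho).
- by [].
- move=> x /Kx[x0 dx x1 _]; rewrite /sig /rho ger0_norm; last first.
    by rewrite mulr_ge0 ?invr_ge0 ?sqrtr_ge0.
  by rewrite ler_pdivrMr ?sqrtr_gt0// mul1r ler_sqrt ?(ltW x0)// lerDr.
have [||LC hC] := @opK de gam de^-1 mgam.
- by rewrite invr_ge0 ltW.
- move=> x /Kx[x0 dx _ _]; rewrite /gam ger0_norm ?invr_ge0 ?(ltW x0)//.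
  by rewrite lef_pV2 ?posrE.
have [||LI hI] := @opK de inv de^-1 (@measurable_inv R).
- by rewrite invr_ge0 ltW.
- move=> x /Kx[_ _ x0 dx]; rewrite /inv normfV ltr0_norm//.
  by rewrite lef_pV2 ?posrE ?oppr_gt0.
have zero chi L f : pvm_op E (fun x => \1_K x * chi x) L -> L f \in mean_zero mu.
  move=> hL; apply: (pvm_op_mean_zero A_range E_res f de0 hL) => x.
  rewrite mulf_eq0 negb_or indicE => /andP[+ _].
  have [|_] := boolP (x \in _); last by rewrite eqxx.
  by rewrite inE /K /below /= in_itv/= => /Kx[_ _ x0 dx] _; rewrite ltr0_norm.
have lin chi L : pvm_op E chi L -> bounded_linear dot L.
  move=> hL; split; first exact: (pvm_op_lin hL).
  by have [m bm] := pvm_op_bnd hL; exists m => f; exact: pvm_op_norm hL bm.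
(* Identities between symbols cut by [\1_K] are checked with the indicator replaced by 0, and by 1
   below [- de], where [x] and [m2 - x] are nonzero. *)
have onK (P : TR -> R -> Prop) x : P x 0 -> (x < - de -> P x 1) -> P x (\1_K x).
  move=> P0 P1; rewrite indicE; have [|_ //] := boolP (x \in K).
  by rewrite inE /K /below /= in_itv/=; exact: P1.
have greenA f : f \in mean_zero mu -> A (LC f) (m2 *: LC f - f).
  move=> f0; rewrite -{3}(gap f f0).
  have h : pvm_op E (fun x => x * (\1_K x * gam x)) (fun f => m2 *: LC f - pvm_proj E K f).
    have := pvm_op_lincomb ip m2 hC (pvm_op_lincomb ip (-1) oK (pvm_op0 ip E)).
    apply: eq_pvm_op => [x|g]; last by rewrite addr0 scaleN1r.
    apply: (onK (fun x y => m2 * (y * gam x) + (-1 * y + cst 0 x) = x * (y * gam x))).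
      by rewrite /= !mul0r !mulr0 !addr0.
    move=> /Kx[x0 _ _ _]; rewrite /= /gam; field; rewrite gt_eqF//.
  exact: (resolution_op E_res f hC h).
exists LR, LT, LC, LI; split.
- exact: lin hT.
- exact: lin hC.
- by move=> f; split; apply: zero; [exact: hR|exact: hT|exact: hC|exact: hI].
- move=> f f0; rewrite -{1}(gap f f0); apply: (spectral_op_pvm ip cpl f mrho oK).
  by apply: eq_pvm_op hR => // x; rewrite mulrC.
- move=> f; apply: (spectral_op_pvm ip cpl f msig hR).
  by apply: eq_pvm_op hT => // x; rewrite mulrCA.
- move=> f f0; rewrite -{2}(gap f f0); apply: (resolution_op E_res f hI).
  apply: eq_pvm_op oK => // x.
  apply: (onK (fun x y => y = x * (y * inv x))); first by rewrite mul0r mulr0.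
  by move=> /Kx[_ _ x0 _]; rewrite mul1r mulfV// lt_eqF.
- exact: greenA.
(* Once the left [LT] is moved across, the claim is the symbol identity [sig^2 rho^2 / x = (- x) /
   ((m2 - x) x) = - gam] below [- de]. *)
- move=> f g; rewrite (pvm_op_sym hT) -(dotNr ip); congr dot.
  have h1 := pvm_op_mul ip hT (pvm_op_mul ip hI hT).
  have h2 := pvm_op_lincomb ip (-1) hC (pvm_op0 ip E).
  have h3 : pvm_op E (fun x => (\1_K x * (sig x * rho x)) * ((\1_K x * inv x) * (\1_K x * (sig x * rho x))))
      (fun f => (-1) *: LC f + 0).
    apply: eq_pvm_op h2 => // x.
    apply: (onK (fun x y => -1 * (y * gam x) + cst 0 x =
      (y * (sig x * rho x)) * ((y * inv x) * (y * (sig x * rho x))))).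
      by rewrite /= !(mul0r, mulr0) addr0.
    move=> /Kx[x0 _ x1 _].
    have s1 : sig x ^+ 2 = - x by rewrite sqr_sqrtr// oppr_ge0 ltW.
    have s2 : rho x ^+ 2 = gam x by rewrite /rho exprVn sqr_sqrtr// ltW.
    have -> : 1 * (sig x * rho x) * (1 * inv x * (1 * (sig x * rho x))) =
      sig x ^+ 2 * rho x ^+ 2 * inv x by ring.
    rewrite s1 s2 /inv /= addr0; field.
    by rewrite lt_eqF//=.
  by rewrite (pvm_op_unique ip g h1 h3) scaleN1r addr0.
- move=> f f0.
  have h2 := pvm_op_mul ip hR hR.
  have h3 : pvm_op E (fun x => \1_K x * rho x * (\1_K x * rho x)) LC.
    apply: eq_pvm_op hC => // x.
    apply: (onK (fun x y => y * gam x = y * rho x * (y * rho x))).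
      by rewrite !mul0r.
    by move=> /Kx[x0 _ _ _]; rewrite !mul1r -expr2 /rho exprVn sqr_sqrtr// ltW.
  (* [LC] is the square of [LR], so the hypothesis says [LR f = 0], whence [LC f = 0]. Then
     [A 0 = - f], and [A 0 = 0] forces [f = 0]. *)
  rewrite -(pvm_op_unique ip f h2 h3) -(pvm_op_sym hR) => /(dot_eq0 ip) R0.
  have L0 : LR 0 = 0 by case: (linear_hom0 (pvm_op_lin hR)).
  have AC : A (LC f) (m2 *: LC f - f) := greenA f f0.
  rewrite -(pvm_op_unique ip f h2 h3) R0 L0 scaler0 sub0r in AC.
  have A00 := A_sub AC AC; rewrite !subrr in A00.
  have := spectral_op_unique ip cpl ((E_res _ _).1 AC) ((E_res _ _).1 A00).
  by move/eqP; rewrite oppr_eq0 => /eqP.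
Qed.

Let valK (f : perp mu) : perp_val f \in mean_zero mu := perp_valP f.

Lemma perp_ext (f g : perp mu) : (f : H) = g -> f = g.
Proof. exact: val_inj. Qed.

Lemma perpB (f g : perp mu) : perp_val (f - g) = perp_val f - perp_val g.
Proof. exact: (raddfB val). Qed.

Lemma perpN (f : perp mu) : perp_val (- f) = - perp_val f.
Proof. exact: (raddfN val). Qed.

Lemma perpZ a (f : perp mu) : perp_val (a *: f) = a *: perp_val f.
Proof. by []. Qed.

Lemma op_inv_unique (G : perp mu -> perp mu -> Prop) f g :
  (forall u, G u g -> u = f) -> G f g -> op_inv G g = f.
Proof. by move=> uq Gf; apply: uq; rewrite /op_inv; case: xgetP => // /(_ f). Qed.

(** The difference [w] of two solutions satisfies [A w = m2 w]. For [m2 > 0] negativity of [A] gives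
    [w = 0]; for [m2 = 0] this comes from bijectivity of [A] on the mean-zero space. *)
Lemma shift_green_unique (f : perp mu) (u v : perp mu) :
  op_shift m2 (op_opp (op_perp A)) u f -> op_shift m2 (op_opp (op_perp A)) v f ->
  u = v.
Proof.
rewrite /op_shift /op_opp /op_perp => Au Av.
have := A_sub Au Av.
have -> : perp_val (- (f - m2 *: u)) - perp_val (- (f - m2 *: v)) =
    m2 *: (perp_val u - perp_val v).
  by rewrite !(perpN, perpB, perpZ) !opprB subrKA scalerBr.
move=> Aw.
have [m0|mn0] := eqVneq m2 0.
  rewrite m0 scale0r in Aw; have [w [_ uw]] := A_bij 0.
  have h0 : w = 0.
    by apply: uw; have := A_sub Au Au; rewrite !subrr.
  have h1 : w = u - v by apply: uw.
  by apply/eqP; rewrite -subr_eq0 -h1 h0.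
have mp : 0 < m2 by rewrite lt_neqAle eq_sym mn0.
have := A_le0 Aw; rewrite (dotZl ip) pmulr_rle0// => h.
apply: perp_ext; apply/eqP; rewrite -subr_eq0; apply/eqP/(dot_eq0 ip).
by apply/eqP; rewrite eq_le h (dot_ge0 ip).
Qed.

Lemma green_theorem : let T := green_transform E m2 in let C := green m2 A in
  [/\ forall f, green_transform_graph E m2 f (T f),
      bounded_linear (perp_dot mu) T,
      bijective_op (op_shift m2 (op_opp (op_perp A))),
      bounded_linear (perp_dot mu) C &
      forall g, C g = - op_inv (op_shift (- m2) (op_perp A)) g] /\
  (forall f g, perp_dot mu (T f) (op_inv (op_perp A) (T g)) = - perp_dot mu f (C g)) /\
  (forall f, perp_dot mu f (C f) = 0 -> f = 0).
Proof.
move=> T C; have [LR [LT [LC [LI ops]]]] := green_opsP.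
pose pR f : perp mu := let: And4 h _ _ _ := go_zero ops (f : perp mu) in Perp h.
pose pT f : perp mu := let: And4 _ h _ _ := go_zero ops (f : perp mu) in Perp h.
pose pC f : perp mu := let: And4 _ _ h _ := go_zero ops (f : perp mu) in Perp h.
pose pI f : perp mu := let: And4 _ _ _ h := go_zero ops (f : perp mu) in Perp h.
have RE f : pR f = LR f :> H by rewrite /pR; case: go_zero.
have TE f : pT f = LT f :> H by rewrite /pT; case: go_zero.
have CE f : pC f = LC f :> H by rewrite /pC; case: go_zero.
have IE f : pI f = LI f :> H by rewrite /pI; case: go_zero.
have graphT f : green_transform_graph E m2 f (pT f).
  exists (pR f); rewrite /op_perp ?RE ?TE; first exact: (go_rho ops).
  exact: (go_sig ops).
(* [T] is picked by [xget]; both stages of its graph, through the intermediate [u], are functional,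
   so the pick is [pT f]. *)
have Tf f : T f = pT f.
  rewrite /T /green_transform; case: xgetP => [h _ [u fu uh]|/(_ _ (graphT f))//].
  have [v fv vh] := graphT f; apply: perp_ext.
  have uv : u = v by apply: perp_ext; exact: (spectral_op_unique ip cpl fu fv).
  by rewrite uv in uh; exact: (spectral_op_unique ip cpl uh vh).
have shiftC f : op_shift m2 (op_opp (op_perp A)) (pC f) f.
  rewrite /op_shift /op_opp /op_perp CE.
  rewrite !(perpN, perpB, perpZ) CE opprB.
  exact: (go_green ops).
have Cf f : C f = pC f.
  apply: op_inv_unique => // u hu; exact: shift_green_unique hu (shiftC f).
have If f : op_inv (op_perp A) f = pI f.
  have Af : op_perp A (pI f) f by rewrite /op_perp IE; exact: (go_inv ops).
  have [w [_ uw]] := A_bij f; apply: op_inv_unique => // u hu.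
  by rewrite -(uw _ hu) (uw _ Af).
have lift (L : H -> H) (F : perp mu -> perp mu) : bounded_linear dot L ->
    (forall f, perp_val (F f) = L (perp_val f)) -> bounded_linear (perp_dot mu) F.
  move=> [Ll [m Lm]] FL; split; last first.
    by exists m => f; have := Lm (perp_val f); rewrite /hnorm -FL.
  by move=> a f g; apply: perp_ext; rewrite FL Ll -!FL.
split; [split|split].
- by move=> f; rewrite Tf.
- by apply: (lift LT) (go_lin ops) _ => f; rewrite Tf TE.
- move=> f; exists (pC f); split => // u hu.
  exact: shift_green_unique (shiftC f) hu.
- by apply: (lift LC) (go_linC ops) _ => f; rewrite Cf CE.
- move=> g; rewrite Cf; apply/eqP; rewrite -eqr_oppLR; apply/eqP.
  (* Turns a solution [u] of [(A - m2) u = g] into the solution [- u] of [(m2 - A) v = g], for which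
     uniqueness is known. *)
  have opp u : op_shift (- m2) (op_perp A) u g -> op_shift m2 (op_opp (op_perp A)) (- u) g.
    rewrite /op_shift /op_opp /op_perp scaleNr opprK => Au.
    have A00 : A 0 0 by have := A_sub Au Au; rewrite !subrr.
    have := A_sub A00 Au; rewrite !sub0r.
    by rewrite !(perpN, perpB, perpZ) scalerN opprK -!perpZ.
  apply/esym/op_inv_unique => [u /opp hu|].
    by rewrite -(shift_green_unique hu (shiftC g)) opprK.
  have := shiftC g; rewrite /op_shift /op_opp /op_perp => Au.
  have A00 : A 0 0 by have := A_sub Au Au; rewrite !subrr.
  have := A_sub A00 Au; rewrite !sub0r !(perpN, perpB, perpZ).
  by rewrite scaleNr scalerN !opprK.
- move=> f g; rewrite If Tf Cf /perp_dot; have := go_cov ops f g.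
  by rewrite IE !Tf !TE CE.
- move=> f; rewrite Cf /perp_dot CE => h; apply: perp_ext.
  exact: (go_inj ops (valK f) h).
Qed.

End green_operators.

(** * Centered normal laws *)

Lemma scale_exponent (R : realFieldType) (s t x : R) : s != 0 -> t != 0 ->
  - (t / s * x) ^+ 2 / (t ^+ 2 *+ 2) = - x ^+ 2 / (s ^+ 2 *+ 2).
Proof. by move=> s0 t0; field; rewrite s0 t0. Qed.

Lemma scale_inv (R : realFieldType) (s t c : R) : s != 0 -> t != 0 -> c != 0 ->
  (t * c)^-1 * (t / s) = (s * c)^-1.
Proof. by move=> s0 t0 c0; field; rewrite s0 t0 c0. Qed.

Section normal_second_moment.
Context (R : realType).
Local Notation leb := (@lebesgue_measure R).
Implicit Types s t : R.

Lemma integral_normal_prob (m s : R) (f : R -> \bar R) : (forall x, 0 <= f x)%E ->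
  measurable_fun setT f ->
  (\int[normal_prob m s]_x f x = \int[leb]_x (f x * (normal_pdf m s x)%:E))%E.
Proof.
move=> f0 mf.
rewrite -(Radon_Nikodym_SigmaFinite.change_of_variables (@normal_prob_dominates R m s))//.
have mp : measurable_fun setT (EFin \o normal_pdf m s).
  by apply/measurable_EFinP; exact: measurable_normal_pdf.
have iD := Radon_Nikodym_SigmaFinite.f_integrable (@normal_prob_dominates R m s).
apply: ae_eq_integral => //.
- by apply: emeasurable_funM => //; exact: measurable_int iD.
- exact: emeasurable_funM.
- apply: ae_eqe_mul2l => /=; apply: integral_ae_eq => //= B _ mB.
  by rewrite -Radon_Nikodym_SigmaFinite.f_integral//; exact: normal_prob_dominates.
Qed.

Lemma normal_pdf_scale s t x : 0 < s -> 0 < t ->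
  normal_pdf 0 t (t / s * x) * (t / s) = normal_pdf 0 s x.
Proof.
move=> s0 t0; rewrite !normal_pdfE ?gt_eqF//= /normal_fun !subr0.
rewrite mulrAC scale_exponent ?gt_eqF//; congr (_ * _).
rewrite /normal_peak -!mulrnAr (sqrtrM _ (sqr_ge0 t)) (sqrtrM _ (sqr_ge0 s)).
rewrite !sqrtr_sqr !gtr0_norm//.
by rewrite scale_inv ?gt_eqF// sqrtr_gt0 mulrn_wgt0// pi_gt0.
Qed.

(** Substitution of [t / s * x]. Ratios of second moments are enough to identify the variance
    parameter, whatever the value of the moment. *)
Lemma normal_sqr_scale s t : 0 < s -> 0 < t ->
  (\int[normal_prob 0 t]_x (x ^+ 2)%:E =
   ((t / s) ^+ 2)%:E * \int[normal_prob 0 s]_x (x ^+ 2)%:E)%E.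
Proof.
move=> s0 t0; have k0 : 0 < t / s by rewrite divr_gt0.
have msq : measurable_fun setT (fun x : R => (x ^+ 2)%:E).
  by apply/measurable_EFinP; exact: measurable_funX.
have sq0 (x : R) : (0 <= (x ^+ 2)%:E)%E by rewrite lee_fin sqr_ge0.
rewrite !integral_normal_prob//.
pose F (x : R^o) : R^o := t / s * x.
have F'E : F^`()%classic = cst (t / s).
  by apply/funext => x; rewrite /F derive1E deriveM// derive_cst derive_id scaler0 addr0 scaler1.
transitivity (\int[leb]_x (x ^+ 2 * normal_pdf 0 t x)%:E)%E.
  by apply: eq_integral => x _; rewrite EFinM.
rewrite (@increasing_ge0_integration_by_substitutionT _ F (fun x => x ^+ 2 * normal_pdf 0 t x)).
- rewrite -ge0_integralZl//.
  + apply: eq_integral => x _; rewrite F'E /= -!EFinM; congr EFin.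
    by rewrite -(normal_pdf_scale x s0 t0) fctE /= /F exprMn !mulrA.
  + apply: emeasurable_funM => //; apply/measurable_EFinP.
    exact: measurable_normal_pdf.
  + by move=> x _; rewrite mule_ge0// lee_fin normal_pdf_ge0.
- by move=> x y xy; rewrite /F ltr_pM2l.
- by rewrite F'E => ?; exact: cvg_cst.
- by rewrite F'E; exact: is_cvg_cst.
- by rewrite F'E; exact: is_cvg_cst.
- by move=> x; exact: derivableM.
- exact: gt0_cvgMrNy.
- exact: gt0_cvgMry.
- move=> x; apply: cvgM; first exact: sqr_continuous.
  by apply: continuous_normal_pdf; rewrite gt_eqF.
- by move=> x; rewrite mulr_ge0 ?sqr_ge0 ?normal_pdf_ge0.
Qed.

End normal_second_moment.

Section normal_law.
Context d (Om : measurableType d) (R : realType) (P : probability Om R).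
Implicit Types X Y : Om -> R.

Lemma normal_law_integral X v (f : R -> \bar R) : v != 0 -> normal_law P X 0 v ->
  (forall x, 0 <= f x)%E -> measurable_fun setT f ->
  (\int[P]_w f (X w) = \int[normal_prob 0 (Num.sqrt v)]_x f x)%E.
Proof.
move=> v0 [mX vge0]; rewrite (negbTE v0) => h f0 mf.
have mXT : measurable_fun setT (X : Om -> measurableTypeR R) by exact: mX.
pose X' : {RV P >-> measurableTypeR R} := HB.pack (X : Om -> measurableTypeR R)
  (isMeasurableFun.Build _ _ _ _ (X : Om -> measurableTypeR R) mXT).
rewrite -[LHS](@ge0_integral_distribution _ _ _ _ _ P X' f mf f0).
by apply: eq_measure_integral => B mB _; exact: h.
Qed.

(** A zero second moment would concentrate the law on {0}, a null set for a law with a density. *)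
Lemma normal_law_not0 X v : v != 0 -> normal_law P X 0 v ->
  (\int[P]_w (X w ^+ 2)%:E <> 0)%E.
Proof.
move=> v0 nX; have msq : measurable_fun setT (fun x : R => (x ^+ 2)%:E).
  by apply/measurable_EFinP; exact: measurable_funX.
rewrite (@normal_law_integral X v (fun x => (x ^+ 2)%:E))//; last first.
  by move=> x; rewrite lee_fin sqr_ge0.
pose N : probability (measurableTypeR R) R := normal_prob 0 (Num.sqrt v).
rewrite -/N (_ : (\int[N]_x _)%E = (\int[N]_x `|(x ^+ 2)%:E|)%E); last first.
  by apply: eq_integral => x _; rewrite gee0_abs// lee_fin sqr_ge0.
move=> /(ae_eq_integral_abs N measurableT msq) [Z [mZ Z0 hZ]].
have leb0 : @lebesgue_measure R [set 0] = 0%E by exact: lebesgue_measure_set1.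
have N0 : N [set 0] = 0%E.
  by have /null_content_dominatesP := @normal_prob_dominates R 0 (Num.sqrt v); exact.
have : (N setT <= N ([set 0%R] `|` Z))%E.
  apply: le_measure; rewrite ?inE//; first exact: measurableU.
  move=> x _; have [->|x0] := eqVneq x 0; first by left.
  right; apply: hZ => /= /(_ Logic.I) -[] /eqP; rewrite sqrf_eq0.
  by rewrite (negbTE x0).
move=> h; suff : (1 <= (0 : \bar R))%E by rewrite lee_fin ler10.
rewrite -[leLHS](probability_setT N); apply: (le_trans h).
by rewrite measureU0//; rewrite le_eqVlt; apply/orP; left; apply/eqP; exact: N0.
Qed.

(** Recovers the variance parameter, known only to exist, from the second moment: this is finite,
    and nonzero unless the law is degenerate, so it cancels in the scaling relation and leaves
    [v' / v = 1]. *)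
Lemma normal_law_var_unique X Y v v' : normal_law P X 0 v -> normal_law P Y 0 v' ->
  (\int[P]_w (X w ^+ 2)%:E = \int[P]_w (Y w ^+ 2)%:E)%E ->
  (\int[P]_w (X w ^+ 2)%:E < +oo)%E -> v = v'.
Proof.
move=> nX nY XY fX.
have z U u : u = 0 -> normal_law P U 0 u -> (\int[P]_w (U w ^+ 2)%:E = 0)%E.
  move=> u0 [mU _]; rewrite u0 eqxx => U0; transitivity (\int[P]_w (cst 0%E w))%E.
    apply: ae_eq_integral => //.
      by apply/measurable_EFinP; exact: measurable_funX.
    by apply: filterS U0 => w /= -> _; rewrite expr0n.
  by rewrite integral0.
have [v0|v0] := eqVneq v 0; have [v'0|v'0] := eqVneq v' 0.
- by rewrite v0 v'0.
- by have := normal_law_not0 v'0 nY; rewrite -XY (z _ _ v0 nX).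
- by have := normal_law_not0 v0 nX; rewrite XY (z _ _ v'0 nY).
have sq0 (x : R) : (0 <= (x ^+ 2)%:E)%E by rewrite lee_fin sqr_ge0.
have msq : measurable_fun setT (fun x : R => (x ^+ 2)%:E).
  by apply/measurable_EFinP; exact: measurable_funX.
have [_ vge0 _] := nX; have [_ v'ge0 _] := nY.
have vp : 0 < v by rewrite lt_neqAle eq_sym v0.
have v'p : 0 < v' by rewrite lt_neqAle eq_sym v'0.
have hX := @normal_law_integral X v (fun x => (x ^+ 2)%:E) v0 nX sq0 msq.
have hY := @normal_law_integral Y v' (fun x => (x ^+ 2)%:E) v'0 nY sq0 msq.
have s0 : 0 < Num.sqrt v by rewrite sqrtr_gt0.
have t0 : 0 < Num.sqrt v' by rewrite sqrtr_gt0.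
have := etrans XY (etrans hY (etrans (normal_sqr_scale s0 t0) (congr1 _ (esym hX)))).
have i0 : (0 <= \int[P]_w (X w ^+ 2)%:E)%E by apply: integral_ge0 => w _.
rewrite -(fineK (_ : (\int[P]_w (X w ^+ 2)%:E)%E \is a fin_num)) ?ge0_fin_numE//.
rewrite -EFinM => -[]; set I := fine _ => hI.
have I0 : I != 0.
  apply/eqP => I0; apply: (normal_law_not0 v0 nX).
  by rewrite -(fineK (_ : (\int[P]_w (X w ^+ 2)%:E)%E \is a fin_num)) ?ge0_fin_numE// -/I I0.
have : (Num.sqrt v' / Num.sqrt v) ^+ 2 = 1.
  by apply: (mulIf I0); rewrite -hI mul1r.
rewrite exprMn exprVn !sqr_sqrtr// => h.
by rewrite -[RHS](divfK v0) h mul1r.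
Qed.

Lemma normal_law_eq X Y v (B : set R) : normal_law P X 0 v -> normal_law P Y 0 v ->
  measurable B -> P (X @^-1` B) = P (Y @^-1` B).
Proof.
move=> [mX v0 hX] [mY _ hY] mB; move: hX hY; have [_|v0'] := eqVneq v 0; last first.
  by move=> hX hY; rewrite hX// hY.
move=> hX hY.
have mp (U : Om -> R) : measurable_fun setT U -> measurable (U @^-1` B).
  by move=> mU; rewrite -[X in measurable X]setTI; exact: mU.
rewrite -(setIT (X @^-1` B)) -(setIT (Y @^-1` B)) -!integral_indic//; try exact: mp.
apply: ae_eq_integral => //.
- by apply/measurable_EFinP; apply: measurable_indic; apply: mp.
- by apply/measurable_EFinP; apply: measurable_indic; apply: mp.
- apply: filterS2 hX hY => w /= Xw Yw _; rewrite !indicE.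
  suff -> : (w \in X @^-1` B) = (w \in Y @^-1` B) by [].
  by apply/idP/idP; rewrite !inE /preimage /= Xw Yw.
Qed.

End normal_law.

(** * The Cramer-Wold device *)

Lemma pi_system_unique d (T : measurableType d) (R : realType)
    (m1 m2 : {measure set T -> \bar R}) (G : set (set T)) :
  G `<=` measurable -> setI_closed G -> G setT -> (m1 setT < +oo)%E ->
  (forall A, G A -> m1 A = m2 A) -> forall A, <<s G >> A -> m1 A = m2 A.
Proof.
move=> Gm GI GT m1T m12; apply: (@g_sigma_algebra_measure_unique _ _ _ G _ (fun=> setT)) => //.
by apply/seteqP; split => // x _; exists 0%N.
Qed.

(** * Polynomial approximation of a threshold *)

Section threshold.
Context (R : realType).
Implicit Types a : R.

Lemma bernoulli_ge (x : R) n : 0 <= x -> 1 + n%:R * x <= (1 + x) ^+ n.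
Proof.
move=> x0; elim: n => [|n IH]; first by rewrite mul0r addr0 expr0.
rewrite exprS; apply: le_trans (ler_wpM2l _ IH); last by rewrite addr_ge0.
have : 0 <= n%:R * x ^+ 2 by rewrite mulr_ge0 ?sqr_ge0.
by rewrite -natr1 expr2; lra.
Qed.

Lemma one_sub_exp_le (x : R) n : 0 <= x <= 1 -> (1 - x) ^+ n * (1 + n%:R * x) <= 1.
Proof.
move=> /andP[x0 x1]; have y0 : 0 <= 1 - x by rewrite subr_ge0.
apply: (@le_trans _ _ ((1 - x) ^+ n * (1 + x) ^+ n)).
  by rewrite ler_wpM2l ?exprn_ge0// bernoulli_ge.
rewrite -exprMn exprn_ile1//; first by rewrite mulr_ge0// addr_ge0.
by have := sqr_ge0 x; rewrite expr2; lra.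
Qed.

Lemma one_sub_exp_ge (x : R) n : 0 <= x <= 1 -> 1 - n%:R * x <= (1 - x) ^+ n.
Proof.
move=> /andP[x0 x1]; elim: n => [|n IH]; first by rewrite mul0r subr0 expr0.
rewrite exprS; apply: le_trans (ler_wpM2l _ IH); last by rewrite subr_ge0.
have : 0 <= n%:R * x ^+ 2 by rewrite mulr_ge0 ?sqr_ge0.
by rewrite -natr1 expr2; lra.
Qed.

Lemma cvg_natmul_exp (r : R) : 0 <= r < 1 -> n%:R * r ^+ n @[n --> \oo] --> 0.
Proof.
move=> /andP[r0 r1]; have [->|rn0] := eqVneq r 0.
  apply: cvg_near_cst; exists 1%N => // n /= n1.
  by rewrite expr0n gtn_eqF// mulr0.
have rp : 0 < r by rewrite lt_neqAle eq_sym rn0.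
(* With [r = s^2], Bernoulli's inequality for [s^-1 = 1 + h] bounds [n s^n] by [h^-1], and the
   remaining factor [s^n] tends to 0. *)
pose s := Num.sqrt r; have s0 : 0 < s by rewrite sqrtr_gt0.
have ss : s ^+ 2 = r by rewrite sqr_sqrtr.
have s1 : s < 1 by rewrite -(@ltr_pXn2r _ 2)// ?nnegrE ?ltW// ss expr1n.
pose h := s^-1 - 1; have h0 : 0 < h by rewrite subr_gt0 invf_gt1.
have b n : n%:R * s ^+ n <= h^-1.
  have := @bernoulli_ge h n (ltW h0); rewrite (_ : 1 + h = s^-1); last by rewrite /h addrC subrK.
  rewrite exprVn => e.
  have sn : 0 < s ^+ n by rewrite exprn_gt0.
  rewrite -(ler_pM2r h0) mulVf ?gt_eqF//.
  have := ler_wpM2r (ltW sn) e; rewrite mulVf ?gt_eqF//; lra.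
apply: (@squeeze_cvgr _ _ _ _ (cst 0) (fun n => h^-1 * s ^+ n)).
- apply: nearW => n; rewrite mulr_ge0 ?exprn_ge0//= -ss -exprM mulnC exprM expr2.
  by rewrite mulrA ler_wpM2r// exprn_ge0// ltW.
- exact: cvg_cst.
- rewrite -[X in _ --> X](mulr0 h^-1); apply: cvgMr; apply: cvg_expr.
  by rewrite ger0_norm// ltW.
Qed.

(* A polynomial in [a] converging to the indicator of [a < 1/2] on [0, 1]. *)
Definition thresh n a : R := (1 - a ^+ n) ^+ (n * 2 ^ n).

Lemma thresh01 n a : 0 <= a <= 1 -> 0 <= thresh n a <= 1.
Proof.
move=> /andP[a0 a1]; have h : 0 <= 1 - a ^+ n <= 1.
  by rewrite subr_ge0 exprn_ile1// gerBl exprn_ge0.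
by rewrite /thresh; case/andP: h => h1 h2; rewrite exprn_ge0//= exprn_ile1.
Qed.

(** The outer exponent times [a^n] is [n (2 a)^n], which tends to 0 for [a < 1/2] and is at least
    [n] otherwise. The extra factor [n] decides the endpoint [a = 1/2], so the limit is an exact
    indicator. *)
Lemma thresh_cvg a : 0 <= a <= 1 ->
  thresh n a @[n --> \oo] --> ((a < 2^-1)%R%:R : R).
Proof.
move=> a01; have /andP[a0 a1] := a01.
have an n : 0 <= a ^+ n <= 1 by rewrite exprn_ge0// exprn_ile1.
have kE n : (n * 2 ^ n)%:R * a ^+ n = n%:R * (2 * a) ^+ n.
  by rewrite natrM natrX exprMn mulrA.
have [ah|ah] := ltP a 2^-1.
  have h : n%:R * (2 * a) ^+ n @[n --> \oo] --> 0.
    by apply: cvg_natmul_exp; apply/andP; split; lra.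
  apply: (@squeeze_cvgr _ _ _ _ (fun n => 1 - n%:R * (2 * a) ^+ n) (cst 1)).
  - apply: nearW => n; rewrite -kE one_sub_exp_ge//=.
    by have /andP[] := thresh01 n a01.
  - by rewrite -[X in _ --> X](subr0 1); apply: cvgB h; exact: cvg_cst.
  - exact: cvg_cst.
apply: (@squeeze_cvgr _ _ _ _ (cst 0) (fun n => n.+1%:R^-1)).
- apply: nearW => n; have /andP[t0 _] := thresh01 n a01; rewrite t0 /=.
  have := @one_sub_exp_le (a ^+ n) (n * 2 ^ n) (an n); rewrite kE => h.
  have n1 : 0 < n.+1%:R :> R by [].
  rewrite -(ler_pM2r n1) mulVf ?gt_eqF//; apply: le_trans h.
  rewrite ler_wpM2l// -natr1 addrC lerD2l ler_peMr//.
  by rewrite exprn_ege1//; lra.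
- exact: cvg_cst.
- exact: cvg_harmonic.
Qed.

End threshold.

(** * Trigonometric sums in linear forms *)

Section cramer_wold.
Context (R : realType) (n : nat).
Local Notation T := (n.-tuple R).
Implicit Types (u v : 'I_n -> R) (x : T) (g h : T -> R).

Definition lin_form u x : R := \sum_(i < n) u i * tnth x i.

Lemma lin_formD u v x : lin_form (fun i => u i + v i) x = lin_form u x + lin_form v x.
Proof. by rewrite -big_split; apply: eq_bigr => i _; rewrite /= mulrDl. Qed.

Lemma lin_formB u v x : lin_form (fun i => u i - v i) x = lin_form u x - lin_form v x.
Proof.
rewrite /lin_form -sumrN -big_split; apply: eq_bigr => i _.
by rewrite /= mulrBl.
Qed.

Lemma measurable_lin_form u : measurable_fun setT (lin_form u).
Proof.
apply: measurable_sum => i; apply: measurable_funM => //.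
exact: measurable_tnth.
Qed.

(** With a free phase [th], cosines alone suffice: a product of two of them is again a sum of such
    terms, so the class is an algebra. *)
Inductive trigsum : (T -> R) -> Prop :=
| Trigsum0 : trigsum (cst 0)
| TrigsumD c u th g : trigsum g ->
    trigsum (fun x => c * cos (lin_form u x + th) + g x).

Lemma trigsum_add g h : trigsum g -> trigsum h -> trigsum (fun x => g x + h x).
Proof.
move=> tg th; elim: tg => [|c u t {}g _ IH].
  by rewrite (_ : (fun x => _) = h)//; apply/funext => x; rewrite add0r.
rewrite (_ : (fun x => _) = (fun x => c * cos (lin_form u x + t) + (g x + h x))).
  exact: TrigsumD.
by apply/funext => x; rewrite addrA.
Qed.

Lemma trigsum_scale a g : trigsum g -> trigsum (fun x => a * g x).
Proof.
elim=> [|c u t {}g _ IH].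
  by rewrite (_ : (fun x => _) = cst 0); [exact: Trigsum0|apply/funext => x /=; rewrite mulr0].
rewrite (_ : (fun x => _) = (fun x => (a * c) * cos (lin_form u x + t) + a * g x)).
  exact: TrigsumD.
by apply/funext => x; rewrite mulrDr mulrA.
Qed.

Lemma trigsum_cos u t : trigsum (fun x => cos (lin_form u x + t)).
Proof.
rewrite (_ : (fun x => _) = (fun x => 1 * cos (lin_form u x + t) + cst 0 x)).
  exact/TrigsumD/Trigsum0.
by apply/funext => x; rewrite mul1r addr0.
Qed.

Lemma trigsum_cst c : trigsum (cst c).
Proof.
rewrite (_ : cst c = (fun x => c * cos (lin_form (fun=> 0) x + 0) + cst 0 x)).
  exact/TrigsumD/Trigsum0.
apply/funext => x /=; rewrite /lin_form big1 ?addr0 ?cos0 ?mulr1// => i _.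
by rewrite mul0r.
Qed.

Lemma cos_prod (a b : R) : cos a * cos b = 2^-1 * cos (a + b) + 2^-1 * cos (a - b).
Proof. by rewrite cosD cosB; lra. Qed.

Lemma trigsum_mul g h : trigsum g -> trigsum h -> trigsum (fun x => g x * h x).
Proof.
have mulcos u t f : trigsum f -> trigsum (fun x => cos (lin_form u x + t) * f x).
  elim=> [|c v s {}f _ IH].
    rewrite (_ : (fun x => _) = cst 0); first exact: Trigsum0.
    by apply/funext => x /=; rewrite mulr0.
  rewrite (_ : (fun x => _) = (fun x => (c / 2) * cos (lin_form (fun i => u i + v i) x + (t + s)) +
      ((c / 2) * cos (lin_form (fun i => u i - v i) x + (t - s)) +
       cos (lin_form u x + t) * f x))).
    by apply: TrigsumD; exact: TrigsumD.
  apply/funext => x; rewrite lin_formD lin_formB mulrDr mulrCA cos_prod.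
  rewrite (addrACA (lin_form u x)) opprD (addrACA (lin_form u x) _ (- _)).
  by rewrite mulrDr !mulrA !addrA.
move=> tg th; elim: tg => [|c u t {}g _ IH].
  rewrite (_ : (fun x => _) = cst 0); first exact: Trigsum0.
  by apply/funext => x /=; rewrite mul0r.
rewrite (_ : (fun x => _) =
  (fun x => (c * (cos (lin_form u x + t) * h x)) + g x * h x)).
  by apply: trigsum_add IH; apply: trigsum_scale; exact: mulcos.
by apply/funext => x; rewrite mulrDl mulrA.
Qed.

Lemma trigsum_exp g k : trigsum g -> trigsum (fun x => g x ^+ k).
Proof.
move=> tg; elim: k => [|k IH].
  by rewrite (_ : (fun x => _) = cst 1); [exact: trigsum_cst|apply/funext => x; rewrite expr0].
rewrite (_ : (fun x => _) = (fun x => g x * g x ^+ k)); first exact: trigsum_mul.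
by apply/funext => x; rewrite exprS.
Qed.

Lemma trigsum_bounded g : trigsum g ->
  measurable_fun setT g /\ exists m, forall x, `|g x| <= m.
Proof.
elim=> [|c u t {}g _ [mg [m hm]]].
  by split=> //; exists 0 => x; rewrite normr0.
split.
  apply: measurable_funD => //; apply: measurable_funM => //.
  apply: measurableT_comp.
    by apply: continuous_measurable_fun; exact: continuous_cos.
  by apply: measurable_funD => //; exact: measurable_lin_form.
exists (`|c| + m) => x; rewrite (le_trans (ler_normD _ _))// lerD// normrM.
by rewrite ler_piMr// ler_norml cos_geN1 cos_le1.
Qed.

(** Brings the cosine into [0, 1], where [thresh] operates; the cosine is negative exactly when this
    value is below 1/2. *)
Definition half_cos (ut : ('I_n -> R) * R) x : R := (1 + cos (lin_form ut.1 x + ut.2)) / 2.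

Lemma half_cos01 ut x : 0 <= half_cos ut x <= 1.
Proof.
rewrite /half_cos; have := cos_geN1 (lin_form ut.1 x + ut.2).
by have := cos_le1 (lin_form ut.1 x + ut.2) => h1 h2; apply/andP; split; lra.
Qed.

(* These sets form a pi-system generating the Borel sets of R^n, and their
   indicators are bounded limits of trigonometric sums in linear forms, whose
   expectations only depend on the laws of linear forms: this replaces the
   inversion of characteristic functions. *)
Definition cos_neg (s : seq (('I_n -> R) * R)) : set T :=
  [set x | all (fun ut => cos (lin_form ut.1 x + ut.2) < 0) s].

Definition cos_neg_approx s k x : R := \prod_(ut <- s) thresh k (half_cos ut x).

Lemma trigsum_approx s k : trigsum (cos_neg_approx s k).
Proof.
elim: s => [|ut s IH].
  rewrite (_ : cos_neg_approx _ _ = cst 1); first exact: trigsum_cst.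
  by apply/funext => x; rewrite /cos_neg_approx big_nil.
rewrite (_ : cos_neg_approx _ _ = (fun x => thresh k (half_cos ut x) * cos_neg_approx s k x)).
  apply: trigsum_mul IH; apply: trigsum_exp.
  rewrite (_ : (fun x => _) = (fun x => 1 + -1 * half_cos ut x ^+ k)).
    apply: trigsum_add; first exact: trigsum_cst.
    apply: trigsum_scale; apply: trigsum_exp.
    rewrite (_ : half_cos ut = (fun x => 2^-1 * (1 + cos (lin_form ut.1 x + ut.2)))).
      apply: trigsum_scale; apply: trigsum_add; first exact: trigsum_cst.
      exact: trigsum_cos.
    by apply/funext => x; rewrite mulrC.
  by apply/funext => x; rewrite mulN1r.
by apply/funext => x; rewrite /cos_neg_approx big_cons.
Qed.

Lemma cos_neg_approx01 s k x : 0 <= cos_neg_approx s k x <= 1.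
Proof.
rewrite /cos_neg_approx; elim: s => [|ut s /andP[h0 h1]].
  by rewrite big_nil ler01 lexx.
rewrite big_cons; have /andP[t0 t1] := thresh01 k (half_cos01 ut x).
by rewrite mulr_ge0//= mulr_ile1.
Qed.

Lemma cos_neg_approx_cvg s x :
  cos_neg_approx s k x @[k --> \oo] --> (\1_(cos_neg s) x : R).
Proof.
rewrite indicE mem_setE /cos_neg /=; elim: s => [|ut s IH].
  rewrite /cos_neg_approx; under eq_fun do rewrite big_nil.
  exact: cvg_cst.
rewrite (_ : (fun k => _) = (fun k => thresh k (half_cos ut x) * cos_neg_approx s k x)).
  rewrite /= -mulnb natrM; apply: cvgM IH.
  have -> : (cos (lin_form ut.1 x + ut.2) < 0) = (half_cos ut x < 2^-1).
    by rewrite /half_cos; apply/idP/idP; lra.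
  exact: thresh_cvg (half_cos01 ut x).
by apply/funext => k; rewrite /cos_neg_approx big_cons.
Qed.

Lemma measurable_cos_neg s : measurable (cos_neg s).
Proof.
elim: s => [|ut s IH].
  by rewrite (_ : cos_neg [::] = setT)//; apply/seteqP; split.
have -> : cos_neg (ut :: s) =
    (fun x => cos (lin_form ut.1 x + ut.2)) @^-1` `]-oo, 0[ `&` cos_neg s.
  apply/seteqP; split => x; rewrite /cos_neg /= in_itv/=.
    by move=> /andP.
  by move=> [-> ->].
apply: measurableI => //; rewrite -[X in measurable X]setTI.
have [mc _] := trigsum_bounded (trigsum_cos ut.1 ut.2).
exact: mc.
Qed.

(** For large [k], [(x_i - c) / (k + 1)] lies in ]-pi, pi[, where the sine has the sign of its
    argument. So the half-space [x_i > c] is the lower limit in [k] of the sets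
    [sin ((x_i - c) / (k + 1)) > 0], each a [cos_neg] after a phase shift of [pi / 2]. *)
Lemma cos_neg_generate : (measurable : set (set T)) `<=` <<s [set cos_neg s | s in setT] >>.
Proof.
set G := (X in <<s X >>).
have mcos k : @measurable _ (g_sigma_algebraType G) (cos_neg k).
  by apply: sub_sigma_algebra; exists k.
have mid : measurable_fun setT (id : g_sigma_algebraType G -> T).
  apply/measurable_fun_tnthP => i.
  apply: (measurability _ (RGenOInfty.measurableE R)) => // _ [_ [c ->] <-].
  rewrite setTI.
  pose u (k : nat) (j : 'I_n) : R := if j == i then k.+1%:R^-1 else 0.
  have uE k x : lin_form (u k) x = k.+1%:R^-1 * tnth x i.
    rewrite /lin_form (bigD1 i)//= /u eqxx big1 ?addr0// => j ji.
    by rewrite (negbTE ji) mul0r.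
  pose y k (x : T) := k.+1%:R^-1 * (tnth x i - c).
  have cosE k x : (cos (lin_form (u k) x + (k.+1%:R^-1 * - c + pi / 2)) < 0) = (0 < sin (y k x)).
    by rewrite uE addrA -mulrDr cosDpihalf oppr_lt0.
  have y1 k x : `|tnth x i - c| < k.+1%:R -> `|y k x| < pi.
    move=> h; rewrite /y normrM ger0_norm ?invr_ge0//.
    rewrite (@lt_le_trans _ _ 1)//; first by rewrite mulrC ltr_pdivrMr ?mul1r.
    by have := pi_ge2 R; apply: le_trans; rewrite ler1n.
  have -> : ((fun x : T => tnth x i) \o id) @^-1` `]c, +oo[ = \bigcup_N \bigcap_(k in [set k | (N <= k)%N])
      cos_neg [:: (u k, k.+1%:R^-1 * - c + pi / 2)].
    apply/seteqP; split => x /=; rewrite in_itv/= andbT.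
      move=> cx; exists (Num.truncn `|tnth x i - c|) => //= k /= Nk.
      rewrite /cos_neg /= andbT cosE.
      have /y1 : `|tnth x i - c| < k.+1%:R.
        by rewrite (lt_le_trans (truncnS_gt _))// ler_nat.
      rewrite ltr_norml => /andP[_ h]; apply: sin_gt0_pi; rewrite h andbT.
      by rewrite mulr_gt0 ?invr_gt0 ?subr_gt0.
    move=> [N _ h]; pose k := maxn N (Num.truncn `|tnth x i - c|).
    have := h k; rewrite /= leq_maxl => /(_ isT); rewrite /cos_neg /= andbT cosE => sy.
    have /y1 : `|tnth x i - c| < k.+1%:R.
      by rewrite (lt_le_trans (truncnS_gt _))// ler_nat ltnS leq_maxr.
    rewrite ltr_norml => /andP[h1 _]; rewrite ltNge; apply/negP => xc.
    have y0 : y k x <= 0 by rewrite pmulr_rle0 ?invr_gt0// subr_le0.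
    have : 0 <= sin (- y k x).
      by apply: sin_ge0_pi; rewrite oppr_ge0 y0 lerNl ltW.
    by rewrite sinN oppr_ge0 leNgt sy.
  apply: bigcup_measurable => N _; apply: bigcap_measurable => [|k _]; first by exists N => /=.
  exact: mcos.
by move=> B mB; have := mid measurableT B mB; rewrite setTI.
Qed.

Context d (Om : measurableType d) (P : probability Om R).

Lemma same_law_integral (U W : Om -> R) (f : R -> \bar R) :
  measurable_fun setT U -> measurable_fun setT W ->
  (forall B, measurable B -> P (U @^-1` B) = P (W @^-1` B)) ->
  (forall r, 0 <= f r)%E -> measurable_fun setT f ->
  (\int[P]_w f (U w) = \int[P]_w f (W w))%E.
Proof.
move=> mU mW UW f0 mf.
pose U' : {RV P >-> R} := HB.pack U (isMeasurableFun.Build _ _ _ _ U mU).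
pose W' : {RV P >-> R} := HB.pack W (isMeasurableFun.Build _ _ _ _ W mW).
rewrite -[LHS](ge0_integral_distribution U' mf f0).
rewrite -[RHS](ge0_integral_distribution W' mf f0).
by apply: eq_measure_integral => B mB _; exact: UW.
Qed.

Context (X Y : Om -> T).
Context (mX : measurable_fun setT X) (mY : measurable_fun setT Y).
Context (XY : forall u B, measurable B ->
  P ((lin_form u \o X) @^-1` B) = P ((lin_form u \o Y) @^-1` B)).

Lemma bounded_Rintegrable (g : T -> R) (Z : Om -> T) m : measurable_fun setT g ->
  (forall x, `|g x| <= m) -> measurable_fun setT Z ->
  P.-integrable setT (EFin \o (fun w => g (Z w))).
Proof.
move=> mg hg mZ; apply: measurable_bounded_integrable => //.
- by rewrite [ltLHS]probability_setT ltry.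
- exact: measurableT_comp.
- exists m; split; first exact: num_real.
  by move=> r mr w _ /=; rewrite (le_trans (hg _))// ltW.
Qed.

Lemma trigsum_same g : trigsum g -> \int[P]_w g (X w) = \int[P]_w g (Y w).
Proof.
elim=> [//|c u t {}g tg IH].
have [mg [m hm]] := trigsum_bounded tg.
have [mc [m' hc]] := trigsum_bounded (trigsum_cos u t).
pose C x := cos (lin_form u x + t).
have ic Z : measurable_fun setT Z -> P.-integrable setT (EFin \o (fun w => C (Z w))).
  exact: bounded_Rintegrable hc.
have ig Z : measurable_fun setT Z -> P.-integrable setT (EFin \o (fun w => g (Z w))).
  exact: bounded_Rintegrable hm.
have icc Z : measurable_fun setT Z -> P.-integrable setT (EFin \o (fun w => c * C (Z w))).
  move=> mZ; have := integrableZl measurableT c (ic Z mZ).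
  by apply: eq_integrable => // w _.
rewrite !RintegralD ?ig ?icc// IH; congr (_ + _).
rewrite !RintegralZl ?ic//; congr (_ * _).
have i1 : P.-integrable setT (EFin \o cst 1) by exact: finite_measure_integrable_cst.
(* Equality of laws is transported through nonnegative functions, so the cosine is raised by 1. *)
have shift Z : measurable_fun setT Z ->
    \int[P]_w C (Z w) = \int[P]_w (1 + C (Z w)) - 1.
  move=> mZ; have -> := RintegralD measurableT i1 (ic Z mZ).
  by rewrite Rintegral_cst//= probability_setT mulr1 addrAC subrr add0r.
rewrite !shift//; congr (_ - 1); congr fine.
apply: (@same_law_integral (lin_form u \o X) (lin_form u \o Y) (fun r => (1 + cos (r + t))%:E)).
- exact: measurableT_comp (measurable_lin_form u) mX.
- exact: measurableT_comp (measurable_lin_form u) mY.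
- exact: XY.
- by move=> r; rewrite lee_fin -lerBlDl sub0r cos_geN1.
- apply/measurable_EFinP; apply: measurable_funD => //; apply: measurableT_comp.
    by apply: continuous_measurable_fun; exact: continuous_cos.
  exact: measurable_funD.
Qed.

Lemma cramer_wold B : measurable B -> P (X @^-1` B) = P (Y @^-1` B).
Proof.
pose X' : {RV P >-> T} := HB.pack X (isMeasurableFun.Build _ _ _ _ X mX).
pose Y' : {RV P >-> T} := HB.pack Y (isMeasurableFun.Build _ _ _ _ Y mY).
move=> mB.
apply: (@pi_system_unique _ _ _ (distribution P X') (distribution P Y')
  [set cos_neg s | s in setT]) (cos_neg_generate mB).
- by move=> _ [s _ <-]; exact: measurable_cos_neg.
- move=> _ _ [s _ <-] [s' _ <-]; exists (s ++ s') => //.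
  apply/seteqP; split => x; rewrite /cos_neg /= all_cat; first by move/andP.
  by move=> [-> ->].
- by exists [::] => //; apply/seteqP; split.
- by rewrite [ltLHS]probability_setT ltry.
- move=> _ [s _ <-]; rewrite /distribution /pushforward /=.
  have mp (Z : Om -> T) : measurable_fun setT Z -> measurable (Z @^-1` cos_neg s).
    by move=> mZ; rewrite -[X in measurable X]setTI; exact: (mZ measurableT _ (measurable_cos_neg s)).
  have mapp k : measurable_fun setT (cos_neg_approx s k).
    by have [] := trigsum_bounded (trigsum_approx s k).
  have lim Z : measurable_fun setT Z ->
      \int[P]_w cos_neg_approx s k (Z w) @[k --> \oo] --> fine (P (Z @^-1` cos_neg s)).
    move=> mZ; have -> : fine (P (Z @^-1` cos_neg s)) = \int[P]_w \1_(cos_neg s) (Z w).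
      by rewrite -[in LHS](setIT (Z @^-1` _)) -(integral_indic P measurableT (mp Z mZ)).
    apply: (@Rintegral_dominated_cvg _ _ _ _ _ _ (cst 1)).
    + by move=> k; exact: measurableT_comp.
    + apply: measurableT_comp mZ; apply: measurable_indic; exact: measurable_cos_neg.
    + by move=> w; exact: cos_neg_approx_cvg.
    + exact: finite_measure_integrable_cst.
    + by move=> k w; have /andP[h0 h1] := cos_neg_approx01 s k (Z w); rewrite ger0_norm.
  have e : fine (P (X @^-1` cos_neg s)) = fine (P (Y @^-1` cos_neg s)).
    apply: (cvg_unique _ (lim X mX)) => //.
    apply: cvg_trans (lim Y mY); apply: near_eq_cvg; apply: nearW => k.
    by rewrite (trigsum_same (trigsum_approx s k)).
  have f1 : P (X @^-1` cos_neg s) \is a fin_num by apply: fin_num_measure; apply: mp.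
  have f2 : P (Y @^-1` cos_neg s) \is a fin_num by apply: fin_num_measure; apply: mp.
  exact: (etrans (esym (fineK f1)) (etrans (congr1 EFin e) (fineK f2))).
Qed.

End cramer_wold.

(** * Independence of sigma-algebras *)

Section sub_sigma_algebra.
Context d (Om : measurableType d) (R : realType).
Implicit Types (G H : set (set Om)) (f g : Om -> R).

Lemma sigma_algebraI G A B : sigma_algebra setT G -> G A -> G B -> G (A `&` B).
Proof.
move=> sG; rewrite -{1 2 3}(sigma_algebra_id sG).
exact: (@measurableI _ (g_sigma_algebraType G)).
Qed.

Lemma sigma_algebraT G : sigma_algebra setT G -> G setT.
Proof. by move=> [G0 GC _]; rewrite -(setD0 setT); exact: GC. Qed.

Definition adapted G f := forall B : set R, measurable B -> G (f @^-1` B).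

Lemma adaptedP G f : sigma_algebra setT G ->
  adapted G f <-> measurable_fun setT (f : g_sigma_algebraType G -> R).
Proof.
move=> sG; split=> [Gf _ B mB|mf B mB].
  by rewrite setTI; apply: sub_sigma_algebra; exact: Gf.
have := mf measurableT B mB; rewrite setTI.
by rewrite /measurable /= sigma_algebra_id.
Qed.

Lemma adapted_lin G a f g : sigma_algebra setT G ->
  adapted G f -> adapted G g -> adapted G (fun w => a * f w + g w).
Proof.
move=> sG /(adaptedP _ sG) mf /(adaptedP _ sG) mg; apply/(adaptedP _ sG).
by apply: measurable_funD => //; exact: measurable_funM.
Qed.

Lemma adapted_measurable G f : G `<=` measurable -> adapted G f -> measurable_fun setT f.
Proof. by move=> Gm Gf _ B mB; rewrite setTI; apply: Gm; exact: Gf. Qed.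

Lemma sigma_ofP (I : Type) (Y : I -> Om -> R) D : sigma_algebra setT (sigma_of Y D).
Proof. exact: smallest_sigma_algebra. Qed.

Lemma sigma_of_adapted (I : Type) (Y : I -> Om -> R) (D : set I) i :
  D i -> adapted (sigma_of Y D) (Y i).
Proof.
move=> Di B mB; apply: sub_sigma_algebra; exists i => //.
by exists B => //; rewrite setTI.
Qed.

Lemma sigma_of_sub (I : Type) (Y : I -> Om -> R) (D : set I) G :
  sigma_algebra setT G -> (forall i, D i -> adapted G (Y i)) -> sigma_of Y D `<=` G.
Proof.
move=> sG h; apply: smallest_sub => // _ [i Di [B mB <-]].
by rewrite setTI; exact: h.
Qed.

Lemma measurable_sigma_algebra : sigma_algebra setT (measurable : set (set Om)).
Proof. exact: sigma_algebra_measurable. Qed.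

Lemma sigma_of_measurable (I : Type) (Y : I -> Om -> R) (D : set I) :
  (forall i, D i -> measurable_fun setT (Y i)) -> sigma_of Y D `<=` measurable.
Proof.
move=> mY; apply: sigma_of_sub; first exact: measurable_sigma_algebra.
by move=> i Di B mB; rewrite -[X in measurable X]setTI; exact: mY.
Qed.

(** Reduces questions about a field with infinitely many indices to finitely many: the sets
    determined by finitely many variables form a pi-system. *)
Lemma sigma_of_finite (I : choiceType) (Y : I -> Om -> R) (D : set I) :
  let Fin := [set A | exists2 s : seq I, {in s, forall i, D i} & sigma_of Y [set` s] A] in
  [/\ setI_closed Fin, Fin setT & sigma_of Y D `<=` <<s Fin >>].
Proof.
move=> Fin; split.
- move=> A B [s Ds sA] [s' Ds' sB]; exists (s ++ s').
    by move=> i; rewrite mem_cat => /orP[/Ds|/Ds'].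
  have up s1 : {subset s1 <= s ++ s'} -> sigma_of Y [set` s1] `<=` sigma_of Y [set` s ++ s'].
    move=> h; apply: sigma_of_sub; first exact: sigma_ofP.
    by move=> i /= /h si; exact: sigma_of_adapted.
  apply: (sigma_algebraI (sigma_ofP Y [set` s ++ s'])).
    by apply: up sA => i si; rewrite mem_cat si.
  by apply: up sB => i si; rewrite mem_cat si orbT.
- by exists [::] => //; exact: (sigma_algebraT (sigma_ofP Y _)).
- apply: sigma_of_sub; first exact: smallest_sigma_algebra.
  move=> i Di B mB; apply: sub_sigma_algebra; exists [:: i].
    by move=> j; rewrite inE => /eqP ->.
  by apply: sigma_of_adapted => //=; rewrite inE.
Qed.

Lemma join_pi (J K : set (set Om)) : sigma_algebra setT J -> sigma_algebra setT K ->
  let JK := [set A | exists B C, [/\ J B, K C & A = B `&` C]] in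
  [/\ setI_closed JK, JK setT & <<s J `|` K >> `<=` <<s JK >>].
Proof.
move=> sJ sK JK; split.
- move=> _ _ [B [C [JB KC ->]]] [B' [C' [JB' KC' ->]]].
  exists (B `&` B'), (C `&` C'); split; [exact: sigma_algebraI|exact: sigma_algebraI|].
  by rewrite setIACA.
- by exists setT, setT; split; [exact: sigma_algebraT|exact: sigma_algebraT|rewrite setIT].
- apply: smallest_sub; first exact: smallest_sigma_algebra.
  move=> A [JA|KA]; apply: sub_sigma_algebra.
    by exists A, setT; split => //; [exact: sigma_algebraT|rewrite setIT].
  by exists setT, A; split => //; [exact: sigma_algebraT|rewrite setTI].
Qed.

End sub_sigma_algebra.

Section independence.
Context d (Om : measurableType d) (R : realType) (P : probability Om R).
Implicit Types (F G H J K : set (set Om)).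

Definition indep F G := forall A B, F A -> G B -> P (A `&` B) = (P A * P B)%E.

(** For fixed [B], both sides are finite measures in [A]: [P] restricted to [B], and [P] multiplied
    by the number [P B]. *)
Lemma indep_pi F G : F `<=` measurable -> setI_closed F -> F setT ->
  G `<=` measurable -> indep F G -> indep <<s F >> G.
Proof.
move=> Fm FI FT Gm FG A B sA GB.
have mB := Gm _ GB.
have PB0 : 0 <= fine (P B) by rewrite fine_ge0.
have PBE : (fine (P B))%:E = P B by rewrite fineK// fin_num_measure.
pose m1 := mrestr P mB; pose m2 := mscale (NngNum PB0) P.
have m2E C : m2 C = (P C * P B)%E by rewrite muleC -PBE.
suff : m1 A = m2 A by move=> h; exact: (etrans h (m2E A)).
apply: (@pi_system_unique _ _ _ m1 m2 F) => //.
- by rewrite /m1 /mrestr (le_lt_trans (probability_le1 _ _)) ?ltry//; exact: measurableI.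
- by move=> C FC; exact: (etrans (FG _ _ FC GB) (esym (m2E C))).
Qed.

Lemma indepC F G : indep F G -> indep G F.
Proof. by move=> FG A B GA FB; rewrite setIC FG// muleC. Qed.

Lemma sub_indep F G F' G' : F' `<=` F -> G' `<=` G -> indep F G -> indep F' G'.
Proof. by move=> FF GG h A B /FF FA /GG GB; exact: h. Qed.

Lemma indep_sigma_of (I I' : choiceType) (Y : I -> Om -> R) (Y' : I' -> Om -> R)
  (D : set I) (D' : set I') :
  (forall i, D i -> measurable_fun setT (Y i)) ->
  (forall i, D' i -> measurable_fun setT (Y' i)) ->
  (forall (s : seq I) (s' : seq I'), {in s, forall i, D i} -> {in s', forall i, D' i} ->
    indep (sigma_of Y [set` s]) (sigma_of Y' [set` s'])) ->
  indep (sigma_of Y D) (sigma_of Y' D').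
Proof.
move=> mY mY' h.
have [FI FT FS] := sigma_of_finite Y D; have [FI' FT' FS'] := sigma_of_finite Y' D'.
set F := (X in <<s X >>) in FI FT FS; set F' := (X in <<s X >>) in FI' FT' FS'.
have mF : F `<=` measurable.
  move=> A [s Ds]; apply: sigma_of_measurable => i /= si; exact: mY (Ds _ si).
have mF' : F' `<=` measurable.
  move=> A [s Ds]; apply: sigma_of_measurable => i /= si; exact: mY' (Ds _ si).
apply: sub_indep FS FS' _.
have sF' : <<s F' >> `<=` measurable.
  by apply: smallest_sub => //; exact: measurable_sigma_algebra.
apply: indep_pi => //; apply: indepC; apply: indep_pi => //; apply: indepC.
by move=> A B [s Ds sA] [s' Ds' sB]; exact: (h s s').
Qed.

(** The last hypothesis splits off the event of [K], the other one that of [J]. This is the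
    induction step by which increments over successive intervals are added. *)
Lemma indep_join F J K : F `<=` measurable -> J `<=` measurable -> K `<=` measurable ->
  sigma_algebra setT F -> sigma_algebra setT J -> sigma_algebra setT K ->
  indep F J -> indep <<s F `|` J >> K -> indep F <<s J `|` K >>.
Proof.
move=> mF mJ mK sF sJ sK FJ FJK.
have [JKI JKT JKS] := join_pi sJ sK.
apply: sub_indep (@subset_refl _ _) JKS _; apply: indepC; apply: indep_pi => //.
  by move=> _ [B [C [JB KC ->]]]; apply: measurableI; [exact: mJ|exact: mK].
apply: indepC => A _ FA [B [C [JB KC ->]]].
have sFJ := smallest_sigma_algebra setT (F `|` J).
have FJA : <<s F `|` J >> A by apply: sub_sigma_algebra; left.
have FJB : <<s F `|` J >> B by apply: sub_sigma_algebra; right.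
rewrite setIA FJK//; last exact: (sigma_algebraI sFJ).
by rewrite FJ// FJK// muleA.
Qed.

End independence.

(** * Conditional probabilities and conditional independence *)

Section sub_measure.
Context d (T : measurableType d) (R : realType) (G : set (set T)).
Context (Gm : <<s G >> `<=` measurable) (m : {measure set T -> \bar R}).

(* The measure [m] restricted to the sub-sigma-algebra generated by [G]. *)
Definition sub_measure of <<s G >> `<=` measurable : set (g_sigma_algebraType G) -> \bar R := m.

Let sub_measure0 : sub_measure Gm set0 = 0%E.
Proof. exact: measure0. Qed.

Let sub_measure_ge0 A : (0 <= sub_measure Gm A)%E.
Proof. exact: measure_ge0. Qed.

Let sub_measure_sigma_additive : semi_sigma_additive (sub_measure Gm).
Proof.
move=> F mF tF mU; apply: measure_semi_sigma_additive => //.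
  by move=> n; apply: Gm; exact: mF.
by apply: Gm; exact: mU.
Qed.

HB.instance Definition _ := isMeasure.Build _ _ _ (sub_measure Gm)
  sub_measure0 sub_measure_ge0 sub_measure_sigma_additive.

Lemma measurable_id_sub : measurable_fun setT (id : T -> g_sigma_algebraType G).
Proof. by move=> _ B mB; rewrite setTI; exact: Gm. Qed.

Lemma integral_sub_measure (f : g_sigma_algebraType G -> \bar R) (D : set T) :
  <<s G >> D -> (forall x, 0 <= f x)%E -> measurable_fun setT f ->
  (\int[sub_measure Gm]_(x in D) f x = \int[m]_(x in D) f x)%E.
Proof.
move=> GD f0 mf.
rewrite -[RHS](@ge0_integral_pushforward _ _ T (g_sigma_algebraType G) R id measurable_id_sub m D f
  GD (measurable_funTS mf) (fun x _ => f0 x)).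
by [].
Qed.

End sub_measure.

Section density.
Context d (T : measurableType d) (R : realType) (m : {measure set T -> \bar R}).
Context (f : T -> \bar R) (f0 : forall x, (0 <= f x)%E) (mf : measurable_fun setT f).

Definition density of (forall x, (0 <= f x)%E) & measurable_fun setT f : set T -> \bar R :=
  fun A => (\int[m]_(x in A) f x)%E.

Let density0 : density f0 mf set0 = 0%E.
Proof. exact: integral_set0. Qed.

Let density_ge0 A : (0 <= density f0 mf A)%E.
Proof. by apply: integral_ge0 => x _; exact: f0. Qed.

Let density_sigma_additive : semi_sigma_additive (density f0 mf).
Proof.
move=> F mF tF mU; rewrite /density ge0_integral_bigcup//; last exact: measurable_funTS.
by apply: is_cvg_nneseries => n _ _; apply: integral_ge0 => x _.
Qed.

HB.instance Definition _ := isMeasure.Build _ _ _ (density f0 mf)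
  density0 density_ge0 density_sigma_additive.

End density.

Lemma ge0_integral_mrestr d (T : measurableType d) (R : realType)
    (m : {measure set T -> \bar R}) (D : set T) (mD : measurable D) (A : set T) (f : T -> \bar R) :
  measurable A -> (forall x, 0 <= f x)%E -> measurable_fun setT f ->
  (\int[mrestr m mD]_(x in A) f x = \int[m]_(x in A `&` D) f x)%E.
Proof.
move=> mA f0 mf; rewrite (@ge0_negligible_integral _ _ _ _ A (~` D))//.
- rewrite setDE setCK; apply: eq_measure_integral => B mB BD.
  exact: (congr1 m (setIidl (subset_trans BD (@subIsetr _ _ _)))).

- exact: measurableC.
- exact: measurable_funTS.
- exact: (etrans (congr1 m (setICl D)) (measure0 m)).
Qed.

Section independent_integral.
Context d (Om : measurableType d) (R : realType) (P : probability Om R).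
Implicit Types (F G J : set (set Om)).

(** On [F], independence says that [P] restricted to [B] and [P] multiplied by [P B] are the same
    measure; [h] is measurable for [F], so its integrals against both agree. *)
Lemma indep_integral_ge0 F J B (h : Om -> \bar R) : sigma_algebra setT F ->
  F `<=` measurable -> indep P F J -> J B -> measurable B -> (forall w, 0 <= h w)%E ->
  measurable_fun setT (h : g_sigma_algebraType F -> \bar R) ->
  (\int[P]_(w in B) h w = P B * \int[P]_w h w)%E.
Proof.
move=> sF Fm FJ JB mB h0 mh.
have Fm' : <<s F >> `<=` measurable by rewrite sigma_algebra_id.
have mh' : measurable_fun setT h by move=> _ C mC; apply: Fm'; exact: mh.
have PB0 : 0 <= fine (P B) by rewrite fine_ge0.
have PBE : (fine (P B))%:E = P B by rewrite fineK// fin_num_measure.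
have FT : <<s F >> setT by apply: sigma_algebraT; exact: smallest_sigma_algebra.
transitivity (\int[mrestr P mB]_w h w)%E.
  by rewrite ge0_integral_mrestr// setTI.
transitivity (\int[mscale (NngNum PB0) P]_w h w)%E; last first.
  by rewrite ge0_integral_mscale//= PBE.
rewrite -(integral_sub_measure Fm' _ FT h0 mh) -(integral_sub_measure Fm' _ FT h0 mh).
apply: eq_measure_integral => A mA _.
have FA : F A by move: mA; rewrite /measurable /= sigma_algebra_id.
exact: (etrans (FJ _ _ FA JB) (etrans (muleC _ _) (congr1 (fun z => z * P A)%E (esym PBE)))).
Qed.

Lemma indep_integral F J B (W : Om -> R) : sigma_algebra setT F ->
  F `<=` measurable -> indep P F J -> J B -> measurable B ->
  adapted F W -> P.-integrable setT (EFin \o W) ->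
  \int[P]_(w in B) W w = fine (P B) * \int[P]_w W w.
Proof.
move=> sF Fm FJ JB mB /(adaptedP _ sF) mW iW.
have mWE : measurable_fun setT ((EFin \o W) : g_sigma_algebraType F -> \bar R).
  exact/measurable_EFinP.
have key : (\int[P]_(w in B) (EFin \o W) w = P B * \int[P]_w (EFin \o W) w)%E.
  rewrite integralE [in RHS]integralE.
  rewrite (indep_integral_ge0 sF Fm FJ JB mB) //; last exact: measurable_funepos.
  rewrite (indep_integral_ge0 sF Fm FJ JB mB) //; last exact: measurable_funeneg.
  by apply/esym/muleBr; [rewrite fin_num_measure|exact: integrable_add_def].
rewrite /Rintegral [X in fine X]key fineM ?fin_num_measure//.
exact: integrable_fin_num.
Qed.

End independent_integral.

Section sub_finite_measure.
Context d (T : measurableType d) (R : realType) (G : set (set T)).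
Context (Gm : <<s G >> `<=` measurable) (m : {finite_measure set T -> \bar R}).

Let sub_measure_finite : fin_num_fun (sub_measure m Gm).
Proof. by move=> A mA; apply: fin_num_measure; exact: Gm. Qed.

HB.instance Definition _ := Measure_isFinite.Build _ _ _ (sub_measure m Gm) sub_measure_finite.

End sub_finite_measure.

Section conditional_probability.
Context d (Om : measurableType d) (R : realType) (P : probability Om R).
Context (G : set (set Om)) (sG : sigma_algebra setT G) (Gm : G `<=` measurable).

(** [U] is the Radon-Nikodym derivative, on [G], of the trace of [P] on [A]. Allowing a weight [W],
    and not only indicators, provides the rule for pulling out known factors. *)
Lemma cond_prob_ex A : measurable A -> exists U : Om -> R,
  [/\ adapted G U, forall w, 0 <= U w & forall (W : Om -> \bar R) C,
    (forall w, 0 <= W w)%E -> measurable_fun setT (W : g_sigma_algebraType G -> \bar R) ->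
    G C -> (\int[P]_(w in C) (W w * (U w)%:E) = \int[P]_(w in C `&` A) W w)%E].
Proof.
move=> mA; have Gm' : <<s G >> `<=` measurable by rewrite sigma_algebra_id.
pose mu : {sigma_finite_measure set (g_sigma_algebraType G) -> \bar R} := sub_measure P Gm'.
pose nu : {finite_measure set (g_sigma_algebraType G) -> \bar R} :=
  sub_measure (mrestr P mA) Gm'.
have numu : nu `<< mu.
  apply/null_content_dominatesP => B /Gm' mB B0.
  have BA : measurable (B `&` A : set Om) by exact: measurableI.
  exact: (@subset_measure0 _ _ _ P _ _ BA mB (@subIsetl _ _ _) B0).
pose f := Radon_Nikodym_SigmaFinite.f nu mu.
have f0 := Radon_Nikodym_SigmaFinite.f_ge0 numu.
have ff := Radon_Nikodym_SigmaFinite.f_fin_num numu.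
have mf : measurable_fun setT f.
  exact: measurable_int (Radon_Nikodym_SigmaFinite.f_integrable numu).
exists (fun w => fine (f w)); split.
- by apply/(adaptedP _ sG); apply: measurableT_comp mf.
- by move=> w; rewrite fine_ge0.
- move=> W C W0 mW GC.
  have GC' : <<s G >> C by exact: sub_sigma_algebra.
  have fE w : (fine (f w))%:E = f w by rewrite fineK.
  under eq_integral do rewrite fE.
  have := Radon_Nikodym_SigmaFinite.change_of_variables numu W0 GC' (measurable_funTS mW).
  rewrite (integral_sub_measure Gm' (mrestr P mA) GC' W0 mW).
  rewrite (integral_sub_measure Gm' P GC') => [->| |].
  + rewrite ge0_integral_mrestr//; first exact: Gm.
    by move=> _ B mB; exact: (Gm' _ (mW measurableT _ mB)).
  + by move=> w; rewrite mule_ge0.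
  + exact: emeasurable_funM.
Qed.

Lemma cond_exp_ge0 A U : measurable A -> adapted G U -> (forall w, 0 <= U w) ->
  (forall C, G C -> (\int[P]_(w in C) (U w)%:E = P (A `&` C))%E) ->
  cond_exp P G \1_A U.
Proof.
move=> mA GU U0 UE; have mU := adapted_measurable Gm GU.
split=> //.
- exact: integrable_indic.
- apply/integrableP; split; first exact/measurable_EFinP.
  under eq_integral do rewrite gee0_abs ?lee_fin//.
  by rewrite UE ?setIT ?(le_lt_trans (probability_le1 _ _)) ?ltry//; exact: sigma_algebraT.
- by move=> C GC; rewrite /Rintegral UE// integral_indic//; exact: Gm.
Qed.

(** Here [F] is the past, [G] the present, [I] the innovation and [H] the future. The point is that
    the conditional probability of a past event given [G] also serves given [G] and [I], since the
    innovation is independent of the past. *)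
Lemma cond_indep_of_indep (F I H : set (set Om)) :
  sigma_algebra setT F -> sigma_algebra setT I ->
  F `<=` measurable -> I `<=` measurable -> G `<=` F -> indep P F I ->
  H `<=` <<s G `|` I >> -> cond_indep P G F H.
Proof.
move=> sF sI Fm Im GF FI HGI A B FA /HGI GB.
have GIm : <<s G `|` I >> `<=` measurable.
  apply: smallest_sub; first exact: measurable_sigma_algebra.
  by move=> C [/Gm|/Im].
have mA := Fm _ FA; have mB := GIm _ GB.
have [U [GU U0 UE]] := cond_prob_ex mA; have [V [GV V0 VE]] := cond_prob_ex mB.
have GT : G setT by exact: sigma_algebraT.
have mUE : measurable_fun setT ((EFin \o U) : g_sigma_algebraType G -> \bar R).
  exact/measurable_EFinP/adaptedP.
have mU : measurable_fun setT (EFin \o U).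
  exact/measurable_EFinP/(adapted_measurable Gm).
have U0' w : (0 <= (EFin \o U) w)%E by rewrite lee_fin.
have prob D (W : Om -> R) : (forall (Z : Om -> \bar R) C, (forall w, 0 <= Z w)%E ->
      measurable_fun setT (Z : g_sigma_algebraType G -> \bar R) -> G C ->
      (\int[P]_(w in C) (Z w * (W w)%:E) = \int[P]_(w in C `&` D) Z w)%E) -> measurable D ->
    forall C, G C -> (\int[P]_(w in C) (W w)%:E = P (D `&` C))%E.
  move=> WE mD C GC.
  have := WE (cst 1%E) C (fun=> lee01) (measurable_cst _) GC.
  rewrite integral_cst ?mul1e 1?setIC; last by apply: measurableI => //; exact: Gm.
  by under eq_integral do rewrite mul1e.
have UP := prob _ _ UE mA; have VP := prob _ _ VE mB.
(* For [g] in [G] and [i] in [I], independence factors [P i] out of both sides, and what is left is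
   the defining property of [U] on [g]. *)
have key D : <<s G `|` I >> D -> (\int[P]_(w in D) (EFin \o U) w = P (A `&` D))%E.
  have [GII GIT GIS] := join_pi sG sI; move=> /GIS.
  set K := (X in <<s X >> D) in GII GIT GIS *.
  suff h E : <<s K >> E -> density P U0' mU E = mrestr P mA E.
    by move=> KD; exact: (etrans (h _ KD) (congr1 P (setIC D A))).
  have Km : K `<=` measurable.
    by move=> _ [g [i [/Gm mg /Im mi ->]]]; exact: measurableI.
  apply: (pi_system_unique Km GII GIT).
    apply: (@le_lt_trans _ _ (P A)); last by rewrite (le_lt_trans (probability_le1 _ _)) ?ltry.
    by have := UP _ GT; rewrite setIT /density => <-.
  move=> _ [g [i [Gg Ii ->]]].
  have mg := Gm Gg; have mi := Im _ Ii.
  have FgA : F (A `&` g) by apply: sigma_algebraI => //; exact: GF.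
  transitivity (\int[P]_(w in i `&` g) (EFin \o U) w)%E.
    by rewrite [X in integral _ X]setIC.
  rewrite integral_mkcondr.
  rewrite (indep_integral_ge0 sG Gm (sub_indep GF (@subset_refl _ I) FI) Ii mi).
  - rewrite -integral_mkcond [X in (_ * X)%E]UP// muleC.
    exact: (etrans (esym (FI _ _ FgA Ii))
      (congr1 P (etrans (esym (setIA A g i)) (setIC A (g `&` i))))).
  - by move=> w; apply: erestrict_ge0.
  - by apply/(measurable_restrictT _ _).1; [exact: sub_sigma_algebra|exact: measurable_funTS].
exists U, V; split.
- exact: cond_exp_ge0.
- exact: cond_exp_ge0.
apply: cond_exp_ge0 => //.
- exact: measurableI.
- by apply/(adaptedP _ sG); apply: measurable_funM; exact/(adaptedP _ sG).
- by move=> w; rewrite mulr_ge0.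
- move=> C GC; rewrite -setIA -key; last first.
    have GC' : <<s G `|` I >> C by apply: sub_sigma_algebra; left.
    exact: (sigma_algebraI (smallest_sigma_algebra _ _) GB GC').
  by rewrite setIC -(VE _ _ U0' mUE GC); apply: eq_integral => w _; rewrite EFinM.
Qed.

End conditional_probability.

(** * Second moments *)

Section second_moments.
Context d (Om : measurableType d) (R : realType) (P : probability Om R).
Implicit Types X Y : Om -> R.
Local Notation L2P := (Lfun P 2%:E).

Definition mom2 X Y : R := \int[P]_w (X w * Y w).

Lemma mom2_integrable X Y : X \in L2P -> Y \in L2P -> P.-integrable setT (EFin \o (X \* Y)).
Proof. by move=> hX hY; apply/Lfun1_integrable; exact: Lfun2_mul_Lfun1. Qed.

Lemma Lfun2_measurable X : X \in L2P -> measurable_fun setT X.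
Proof. by move=> /Lfun2P[]. Qed.

Lemma expectation_mom2 X Y : X \in L2P -> Y \in L2P -> ('E_P[X \* Y] = (mom2 X Y)%:E)%E.
Proof.
move=> hX hY; rewrite unlock /mom2 /Rintegral fineK//.
exact: integrable_fin_num (mom2_integrable hX hY).
Qed.

Lemma mom2C X Y : mom2 X Y = mom2 Y X.
Proof. by rewrite /mom2; congr fine; apply: eq_integral => w _; rewrite mulrC. Qed.

Lemma mom2_lin a X X' Y : X \in L2P -> X' \in L2P -> Y \in L2P ->
  mom2 (fun w => a * X w + X' w) Y = a * mom2 X Y + mom2 X' Y.
Proof.
move=> hX hX' hY; have i1 := mom2_integrable hX hY; have i2 := mom2_integrable hX' hY.
have i1' : P.-integrable setT (EFin \o (fun w => a * (X w * Y w))).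
  by apply: eq_integrable (integrableZl measurableT a i1).
rewrite /mom2 -RintegralZl// -RintegralD//.
by congr fine; apply: eq_integral => w _; rewrite mulrDl mulrA.
Qed.

Lemma Lfun2_0 : (fun=> 0) \in L2P.
Proof.
apply/Lfun2P; split; first exact: measurable_cst.
by rewrite integral0_eq ?ltry// => w _; rewrite expr0n.
Qed.

Lemma mom2_0 Y : mom2 (fun=> 0) Y = 0.
Proof. by rewrite /mom2 /Rintegral integral0_eq// => w _; rewrite mul0r. Qed.

Lemma Lfun2_sum n (c : 'I_n -> R) (X : 'I_n -> Om -> R) : (forall i, X i \in L2P) ->
  (fun w => \sum_(i < n) c i * X i w) \in L2P.
Proof.
elim: n c X => [|n IH] c X hX.
  by under eq_fun do rewrite big_ord0; exact: Lfun2_0.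
under eq_fun do rewrite big_ord_recl.
by apply: Lfun2_lin => //; exact: IH.
Qed.

Lemma mom2_suml n (c : 'I_n -> R) (X : 'I_n -> Om -> R) Y : (forall i, X i \in L2P) ->
  Y \in L2P -> mom2 (fun w => \sum_(i < n) c i * X i w) Y = \sum_(i < n) c i * mom2 (X i) Y.
Proof.
move=> + hY; elim: n c X => [|n IH] c X hX.
  by under eq_fun do rewrite big_ord0; rewrite mom2_0 big_ord0.
under eq_fun do rewrite big_ord_recl.
rewrite mom2_lin//; last exact: Lfun2_sum.
by rewrite IH// big_ord_recl.
Qed.

Lemma mom2_sum n (c : 'I_n -> R) (X : 'I_n -> Om -> R) : (forall i, X i \in L2P) ->
  mom2 (fun w => \sum_(i < n) c i * X i w) (fun w => \sum_(i < n) c i * X i w) =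
  \sum_(i < n) c i * \sum_(j < n) c j * mom2 (X j) (X i).
Proof.
move=> hX; rewrite mom2_suml//; last exact: Lfun2_sum.
by apply: eq_bigr => i _; rewrite mom2C mom2_suml.
Qed.

Lemma sqr_integral_mom2 X : X \in L2P -> (\int[P]_w (X w ^+ 2)%:E = (mom2 X X)%:E)%E.
Proof.
move=> hX; rewrite -(expectation_mom2 hX hX) unlock.
by apply: eq_integral => w _; rewrite expr2.
Qed.

Lemma Lfun2_of_expectation X v : measurable_fun setT X -> ('E_P[X \* X] = v%:E)%E -> X \in L2P.
Proof.
move=> mX; rewrite unlock => h; apply/Lfun2P; split => //.
rewrite (_ : (\int[P]_x _)%E = v%:E) ?ltry// -h.
Qed.

Lemma normal_law_mom2_eq X Y v v' B : normal_law P X 0 v -> normal_law P Y 0 v' ->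
  X \in L2P -> Y \in L2P -> mom2 X X = mom2 Y Y -> measurable B ->
  P (X @^-1` B) = P (Y @^-1` B).
Proof.
move=> nX nY hX hY XY mB; apply: (normal_law_eq nX _ mB).
suff -> : v = v' by [].
apply: (normal_law_var_unique nX nY); first by rewrite !sqr_integral_mom2 ?XY.
by rewrite sqr_integral_mom2 ?ltry.
Qed.

(* [X] and [- X] have the same normal law. *)
Lemma normal_law_integral0 X v v' : normal_law P X 0 v -> normal_law P (fun w => - X w) 0 v' ->
  X \in L2P -> \int[P]_w X w = 0.
Proof.
move=> nX nNX hX; have [mX _ _] := nX; have [mNX _ _] := nNX.
have hNX : (fun w => - X w) \in L2P.
  rewrite (_ : (fun w => _) = fun w => (-1) * X w + (fun=> 0) w); first exact: Lfun2_lin Lfun2_0.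
  by apply/funext => w; rewrite mulN1r addr0.
have NXX : mom2 (fun w => - X w) (fun w => - X w) = mom2 X X.
  by rewrite /mom2; congr fine; apply: eq_integral => w _; rewrite mulrNN.
have iX : P.-integrable setT (EFin \o X).
  by apply/Lfun1_integrable; apply: Lfun_subset12 hX; exact: fin_num_measure.
rewrite /Rintegral integralE.
have -> : (\int[P]_w (EFin \o X)^\- w = \int[P]_w (EFin \o X)^\+ w)%E.
  transitivity (\int[P]_w (Num.max (- X w) 0)%:E)%E.
    by apply: eq_integral => w _; rewrite funenegE /= EFin_max EFinN.
  transitivity (\int[P]_w (Num.max (X w) 0)%:E)%E; last first.
    by apply: eq_integral => w _; rewrite funeposE /= EFin_max.
  apply: (same_law_integral mNX mX (f := fun r => (Num.max r 0)%:E)).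
  - by move=> B mB; exact: normal_law_mom2_eq nNX nX hNX hX NXX mB.
  - by move=> r; rewrite lee_fin le_max lexx orbT.
  - by apply/measurable_EFinP; exact: measurable_maxr.
by rewrite subee//; exact: integrable_pos_fin_num.
Qed.


End second_moments.

(** * The Lamperti transform of a Brownian field *)

Section lamperti_field.
Context d (Om : measurableType d) (R : realType) (P : probability Om R).
Context (V : lmodType R) (dot : V -> V -> R) (K : V -> V -> R) (B : V -> R -> Om -> R).
Context (BK : brownian_field P K B) (T Q : V -> V).
Context (T_lin : forall a f g, T (a *: f + g) = a *: T f + T g).
Context (KT : forall f g, K (T f) (T g) = 2 * dot f (Q g)).
Local Notation L2P := (Lfun P 2%:E).

Definition lamperti_transform (f : V) (t : R) (w : Om) : R := lamperti B (T f) t w.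
Local Notation X := lamperti_transform.

Let scale (t : R) : R := expR (- t) / Num.sqrt 2.

Lemma lamperti_transformE f t w : X f t w = scale t * B (T f) (expR (2 * t)) w.
Proof. by []. Qed.

Lemma brownian_Lfun2 f s : 0 <= s -> B f s \in L2P.
Proof.
move=> s0; have [[mB _] _ _ BB] := BK.
exact: Lfun2_of_expectation (mB f s s0) (BB f f s s s0 s0).
Qed.

Lemma brownian_mom2 f g s t : 0 <= s -> 0 <= t -> mom2 P (B f s) (B g t) = Num.min s t * K f g.
Proof.
move=> s0 t0; have [_ _ _ BB] := BK; apply: EFin_inj.
by rewrite -(BB f g s t s0 t0) expectation_mom2// brownian_Lfun2.
Qed.

Lemma LfunZ a Y : Y \in L2P -> (fun w => a * Y w) \in L2P.
Proof.
move=> hY; rewrite (_ : (fun w => _) = (fun w => a * Y w + (fun=> 0) w)).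
  exact: Lfun2_lin hY (Lfun2_0 P).
by apply/funext => w; rewrite addr0.
Qed.

Lemma mom2Z a Y Z : Y \in L2P -> Z \in L2P -> mom2 P (fun w => a * Y w) Z = a * mom2 P Y Z.
Proof.
move=> hY hZ; have := mom2_lin a hY (Lfun2_0 P) hZ.
by rewrite mom2_0 addr0 => <-; congr mom2; apply/funext => w; rewrite addr0.
Qed.

Lemma lamperti_Lfun2 f t : X f t \in L2P.
Proof. by apply: LfunZ; apply: brownian_Lfun2; exact: expR_ge0. Qed.

(** The smaller of [e^2s] and [e^2t], times [e^-s e^-t], is [e^-|s - t|]; the two factors
    [1 / sqrt 2] cancel the 2 that [KT] carries. *)
Lemma scale_min s t : scale s * (scale t * (Num.min (expR (2 * s)) (expR (2 * t)) * 2)) =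
  expR (- `|s - t|).
Proof.
have s2 : Num.sqrt 2 != 0 :> R by rewrite gt_eqF// sqrtr_gt0.
have h (a b m : R) : a / Num.sqrt 2 * (b / Num.sqrt 2 * (m * 2)) = a * b * m.
  have : Num.sqrt 2 ^+ 2 = 2 :> R by rewrite sqr_sqrtr.
  by move: (Num.sqrt 2) s2 => r r0 r2; rewrite -[X in m * X]r2; field.
rewrite /scale h -expRD; have [st|ts] := leP s t.
- rewrite min_l ?ler_expR ?ler_pM2l// -expRD; congr expR.
  by rewrite ler0_norm ?subr_le0//; ring.
- rewrite min_r ?ler_expR ?ler_pM2l ?(ltW ts)// -expRD; congr expR.
  by rewrite ger0_norm ?subr_ge0 ?(ltW ts)//; ring.
Qed.

Lemma lamperti_mom2 f g s t : mom2 P (X f s) (X g t) = expR (- `|s - t|) * dot f (Q g).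
Proof.
have e0 (u : R) : 0 <= expR u by exact: expR_ge0.
rewrite mom2Z ?lamperti_Lfun2 ?brownian_Lfun2// mom2C mom2Z ?brownian_Lfun2//.
by rewrite mom2C brownian_mom2// KT -scale_min !mulrA.
Qed.

Lemma lamperti_field_lin a f g t : {ae P, forall w, X (a *: f + g) t w = a * X f t w + X g t w}.
Proof.
have [[_ BL] _ _ _] := BK.
have := BL a (T f) (T g) (expR (2 * t)) (expR_ge0 _); apply: filterS => w h.
by rewrite !lamperti_transformE T_lin h mulrDr; congr (_ + _); rewrite mulrCA.
Qed.

Lemma lamperti_LE_process : LE_process P setT X.
Proof.
split=> [f t _|a f g t _]; first exact: Lfun2_measurable (lamperti_Lfun2 f t).
exact: lamperti_field_lin.
Qed.

Lemma lamperti_gaussian : centered_gaussian P setT X.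
Proof.
move=> n c f t _; have [_ BG _ _] := BK.
have [v nv] := BG n (fun i => c i * scale (t i)) (T \o f) (fun i => expR (2 * t i))
  (fun=> expR_ge0 _).
exists v; move: nv; congr (normal_law P _ 0 v).
by apply/funext => w; apply: eq_bigr => i _; rewrite lamperti_transformE mulrA.
Qed.

Lemma lamperti_stationary : stationary_field P X.
Proof.
move=> n f t h D mD.
have mX i s : measurable_fun setT (X (f i) s) by exact: Lfun2_measurable (lamperti_Lfun2 _ _).
have mtuple (s : 'I_n -> R) : measurable_fun setT (fun w => [tuple X (f i) (s i) w | i < n]).
  apply/measurable_fun_tnthP => i; rewrite (_ : _ \o _ = X (f i) (s i)) //.
  by apply/funext => w; rewrite /= tnth_mktuple.
apply: (cramer_wold (mtuple _) (mtuple _)) => // u E mE.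
have linE (s : 'I_n -> R) : lin_form u \o (fun w => [tuple X (f i) (s i) w | i < n]) =
    (fun w => \sum_(i < n) u i * X (f i) (s i) w).
  by apply/funext => w; apply: eq_bigr => i _; rewrite tnth_mktuple.
rewrite !linE.
have [v nv] := lamperti_gaussian u f (t := fun i => t i + h) (fun=> I).
have [v' nv'] := lamperti_gaussian u f (t := t) (fun=> I).
(* Both variances come from existential statements; the laws coincide because the second moments do,
   as these only involve differences of times. *)
apply: (normal_law_mom2_eq nv nv' _ _ _ mE).
- by apply: Lfun2_sum => i; exact: lamperti_Lfun2.
- by apply: Lfun2_sum => i; exact: lamperti_Lfun2.
rewrite !mom2_sum; [|by move=> i; exact: lamperti_Lfun2..].
apply: eq_bigr => i _; congr *%R; apply: eq_bigr => j _; congr *%R.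
have ts : t j + h - (t i + h) = t j - t i by ring.
by rewrite !lamperti_mom2 ts.
Qed.

Lemma lamperti_sub_mom2 f s t : mom2 P (fun w => X f s w - X f t w) (fun w => X f s w - X f t w) =
  2 * (1 - expR (- `|s - t|)) * dot f (Q f).
Proof.
have hX u := lamperti_Lfun2 f u.
have subE : (fun w => X f s w - X f t w) = (fun w => (-1) * X f t w + X f s w).
  by apply/funext => w; rewrite mulN1r addrC.
have hD : (fun w => (-1) * X f t w + X f s w) \in L2P by exact: Lfun2_lin.
rewrite subE mom2_lin// (mom2C P (X f t)) (mom2C P (X f s)) !mom2_lin//.
by rewrite !lamperti_mom2 !subrr !normr0 !oppr0 !expR0 (distrC t s); ring.
Qed.

Lemma lamperti_mean_continuous : mean_continuous P X.
Proof.
move=> f t.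
have hD s : (fun w => X f s w - X f t w) \in L2P.
  have := Lfun2_lin (-1) (lamperti_Lfun2 f t) (lamperti_Lfun2 f s).
  by under eq_fun do rewrite mulN1r addrC.
pose F s := 2 * (1 - expR (- `|s - t|)) * dot f (Q f).
have Ft : F t = 0 by rewrite /F subrr normr0 oppr0 expR0 subrr mulr0 mul0r.
have cF : F s @[s --> t] --> F t.
  apply: cvgM; last exact: cvg_cst.
  apply: cvgM; first exact: cvg_cst.
  apply: cvgB; first exact: cvg_cst.
  apply: (@cvg_comp _ _ _ (fun s => - `|s - t|) expR _ (nbhs (- `|t - t|))).
    by apply: cvgN; apply: cvg_norm; apply: cvgB; [exact: cvg_id|exact: cvg_cst].
  exact: continuous_expR.
rewrite (_ : (fun s => _) = EFin \o F); last first.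
  apply/funext => s /=; rewrite unlock /F -lamperti_sub_mom2.
  by rewrite [LHS](sqr_integral_mom2 (hD s)).
by rewrite Ft in cF; apply: cvg_EFin => //; near=> s.
Unshelve. all: by end_near. Qed.

Lemma lamperti_covariance f g s t :
  ('E_P[X f s \* X g t] = (expR (- `|s - t|) * dot f (Q g))%:E)%E.
Proof. by rewrite expectation_mom2 ?lamperti_Lfun2// lamperti_mom2. Qed.

Lemma lamperti_equilibrium : equilibrium_covariance P dot X Q.
Proof. by move=> f g t; rewrite lamperti_covariance subrr normr0 oppr0 expR0 mul1r. Qed.

End lamperti_field.

(** * Independence of Brownian increments *)

Section brownian_increments.
Context d (Om : measurableType d) (R : realType) (P : probability Om R).
Context (V : lmodType R) (K : V -> V -> R) (B : V -> R -> Om -> R).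
Context (BK : brownian_field P K B).
Implicit Types (s t r : R).

Definition past t := sigma_of (fun x : V * R => B x.1 x.2) [set x | 0 <= x.2 <= t].
Definition increment_field t r := sigma_of (fun f w => B f r w - B f t w) [set: V].
Definition future_increments t :=
  sigma_of (fun (x : V * R) w => B x.1 x.2 w - B x.1 t w) [set x | t <= x.2].

Lemma brownian_measurable f t : 0 <= t -> measurable_fun setT (B f t).
Proof. by move=> t0; have [[mB _] _ _ _] := BK; exact: mB. Qed.

Lemma increment_measurable f t r : 0 <= t -> 0 <= r ->
  measurable_fun setT (fun w => B f r w - B f t w).
Proof. by move=> t0 r0; apply: measurable_funB; exact: brownian_measurable. Qed.

Lemma past_measurable t : past t `<=` measurable.
Proof. by apply: sigma_of_measurable => x /andP[x0 _]; exact: brownian_measurable. Qed.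

Lemma increment_field_measurable t r : 0 <= t -> 0 <= r -> increment_field t r `<=` measurable.
Proof. by move=> t0 r0; apply: sigma_of_measurable => f _; exact: increment_measurable. Qed.

Lemma future_increments_measurable t : 0 <= t -> future_increments t `<=` measurable.
Proof.
move=> t0; apply: sigma_of_measurable => x tx; apply: increment_measurable => //.
exact: le_trans tx.
Qed.

Lemma past_adapted f s t : 0 <= s <= t -> adapted (past t) (B f s).
Proof.
by move=> st; exact: (@sigma_of_adapted _ _ _ _ (fun x : V * R => B x.1 x.2) _ (f, s)).
Qed.

Lemma past_sub s t : s <= t -> past s `<=` past t.
Proof.
move=> st; apply: sigma_of_sub; first exact: sigma_ofP.
move=> -[f u] /= /andP[u0 us]; apply: past_adapted; rewrite u0 /=; exact: le_trans us st.
Qed.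

Lemma increment_field_past t r : 0 <= t -> t <= r -> increment_field t r `<=` past r.
Proof.
move=> t0 tr; apply: sigma_of_sub; first exact: sigma_ofP.
move=> f _; rewrite (_ : (fun w => _) = (fun w => (-1) * B f t w + B f r w)); last first.
  by apply/funext => w; rewrite mulN1r addrC.
apply: adapted_lin; first exact: sigma_ofP.
- by apply: past_adapted; rewrite t0.
- by apply: past_adapted; rewrite lexx andbT (le_trans t0).
Qed.

(** Brownian independence concerns a finite family of test functions and the past of that same
    family, so one list [l] collects the test functions of both events. *)
Lemma indep_past_increment t r : 0 <= t -> t <= r -> indep P (past t) (increment_field t r).
Proof.
move=> t0 tr; have r0 := le_trans t0 tr.
apply: indep_sigma_of => [x /andP[x0 _]|f _|s s' sD _].
- exact: brownian_measurable.
- exact: increment_measurable.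
pose l := map fst s ++ s'; pose k := size l.
pose fs (i : 'I_k) := nth 0 l i.
have fsE f : f \in l -> exists i, fs i = f.
  rewrite -index_mem => fl; exists (Ordinal fl).
  by rewrite /fs nth_index// -index_mem.
have [_ _ BM _] := BK; have [C [_ _ _ ind _]] := BM k fs.
pose incr w := [tuple B (fs i) r w - B (fs i) t w | i < k].
have mincr : measurable_fun setT incr.
  apply/measurable_fun_tnthP => i.
  rewrite (_ : _ \o _ = fun w => B (fs i) r w - B (fs i) t w).
    exact: increment_measurable.
  by apply/funext => w; rewrite /= tnth_mktuple.
have sA : sigma_of (fun x : V * R => B x.1 x.2) [set` s] `<=`
    sigma_of (fun x : 'I_k * R => B (fs x.1) x.2) [set x | 0 <= x.2 <= t].
  apply: sigma_of_sub; first exact: sigma_ofP.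
  move=> -[f u] /= fus; have [i <-] : exists i, fs i = f.
    by apply: fsE; rewrite mem_cat (map_f fst fus).
  exact: (@sigma_of_adapted _ _ _ _ (fun x : 'I_k * R => B (fs x.1) x.2) _ (i, u) (sD _ fus)).
have sB : sigma_of (fun f w => B f r w - B f t w) [set` s'] `<=`
    preimage_set_system setT incr measurable.
  apply: sigma_of_sub.
    by apply: sigma_algebra_preimage; exact: sigma_algebra_measurable.
  move=> f /= fs'; have [i <-] : exists i, fs i = f by apply: fsE; rewrite mem_cat fs' orbT.
  move=> D mD; exists ((fun x => tnth x i) @^-1` D).
    by rewrite -[X in measurable X]setTI; exact: measurable_tnth.
  by rewrite setTI; apply/seteqP; split=> w; rewrite /= tnth_mktuple.
move=> A D /sA hA /sB[D' mD' <-]; rewrite setTI.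
exact: ind.
Qed.

(** Generated by the increments of the whole field over the successive intervals that the times in
    [l] cut off after [t]; the nesting matches an induction by [indep_join]. *)
Fixpoint increment_chain t (l : seq R) : set (set Om) :=
  if l is r :: l' then <<s increment_field t r `|` increment_chain r l' >> else <<s set0 >>.

Lemma increment_chainP t l : sigma_algebra setT (increment_chain t l).
Proof. by case: l => [|r l]; exact: smallest_sigma_algebra. Qed.

Lemma increment_chain_measurable t l : 0 <= t -> path <=%R t l ->
  increment_chain t l `<=` measurable.
Proof.
elim: l t => [|r l IH] t t0 /=.
  by move=> _; apply: smallest_sub; [exact: measurable_sigma_algebra|].
move=> /andP[tr rl]; have r0 := le_trans t0 tr.
apply: smallest_sub; first exact: measurable_sigma_algebra.
by move=> A [|]; [exact: increment_field_measurable|exact: IH].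
Qed.

Lemma indep_past_chain t l : 0 <= t -> path <=%R t l -> indep P (past t) (increment_chain t l).
Proof.
elim: l t => [|r l IH] t t0 /=.
  (* The empty chain generates the trivial sigma-algebra. *)
  move=> _ A D _ /(_ [set E | E = set0 \/ E = setT]).
  case; last 2 first.
  - by move=> ->; rewrite setI0 measure0 mule0.
  - by move=> ->; rewrite setIT probability_setT mule1.
  split => //; split=> [|E|F FE]; first by left.
  - by move=> [->|->]; [right; rewrite setD0|left; rewrite setDv].
  - have [[n Fn]|nF] := pselect (exists n, F n = setT).
      by right; apply/seteqP; split=> // w _; exists n; rewrite ?Fn.
    left; apply/seteqP; split=> // w [n _]; have [->//|Fn] := FE n.
    by case: nF; exists n.
move=> /andP[tr rl]; have r0 := le_trans t0 tr.
apply: indep_join.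
- exact: past_measurable.
- exact: increment_field_measurable.
- exact: increment_chain_measurable.
- exact: sigma_ofP.
- exact: sigma_ofP.
- exact: increment_chainP.
- exact: indep_past_increment.
(* The past of [t] and the increment over [t, r] both belong to the past of [r], to which the
   induction hypothesis applies. *)
apply: sub_indep (IH r r0 rl) => //.
apply: smallest_sub; first exact: sigma_ofP.
by move=> A [|]; [exact: past_sub|exact: increment_field_past].
Qed.

Lemma increment_chain_adapted f u t l : u \in l ->
  adapted (increment_chain t l) (fun w => B f u w - B f t w).
Proof.
elim: l t => // r l IH t; rewrite inE => /orP[/eqP->|ul] /=.
  move=> D mD; apply: sub_sigma_algebra; left.
  exact: (@sigma_of_adapted _ _ _ _ (fun f w => B f r w - B f t w) setT f).
rewrite (_ : (fun w => _) = (fun w => 1 * (B f u w - B f r w) + (B f r w - B f t w))); last first.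
  by apply/funext => w; rewrite mul1r subrKA.
apply: adapted_lin; first exact: smallest_sigma_algebra.
- by move=> D mD; apply: sub_sigma_algebra; right; exact: IH.
- move=> D mD; apply: sub_sigma_algebra; left.
  exact: (@sigma_of_adapted _ _ _ _ (fun f w => B f r w - B f t w) setT f).
Qed.

(** Finitely many later times can be sorted into a chain starting at [t], and each increment from
    [t] is a sum of increments of that chain. *)
Lemma indep_past_future t : 0 <= t -> indep P (past t) (future_increments t).
Proof.
move=> t0; apply: indep_sigma_of => [x /andP[x0 _]|x tx|s s' sD s'D].
- exact: brownian_measurable.
- by apply: increment_measurable => //; exact: le_trans tx.
pose l := sort <=%R (map snd s').
have tl : path <=%R t l.
  have : all (fun u => t <= u) l.
    by rewrite all_sort; apply/allP => _ /mapP[x /s'D tx ->].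
  by have := sort_sorted (@le_total _ R) (map snd s'); rewrite -/l; case: (l) => //= r l' -> /andP[->].
apply: sub_indep (indep_past_chain t0 tl).
- apply: sigma_of_sub; first exact: sigma_ofP.
  by move=> -[f u] /= us; apply: past_adapted; exact: (sD _ us).
- apply: sigma_of_sub; first exact: increment_chainP.
  move=> -[f u] /= us; apply: increment_chain_adapted.
  by rewrite mem_sort (map_f snd us).
Qed.

End brownian_increments.

(** * Markov property and characteristic operator *)

(** The difference of two versions is measurable for [G], and so are the sets where it is
    nonnegative or negative; its integral over each is 0, hence so is that of its absolute value. *)
Lemma cond_exp_unique d (Om : measurableType d) (R : realType) (P : probability Om R)
    (G : set (set Om)) (Z W W' : Om -> R) :
  sigma_algebra setT G -> G `<=` measurable ->
  cond_exp P G Z W -> cond_exp P G Z W' -> {ae P, forall w, W w = W' w}.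
Proof.
move=> sG Gm [_ iW GW WZ] [_ iW' GW' WZ'].
pose N w := W w - W' w.
have iN : P.-integrable setT (EFin \o N).
  by apply: eq_integrable (integrableB measurableT iW iW').
have GN : adapted G N.
  rewrite (_ : N = fun w => (-1) * W' w + W w); first exact: adapted_lin.
  by apply/funext => w; rewrite mulN1r addrC.
have mN : measurable_fun setT N by exact: adapted_measurable GN.
have N0 A : G A -> \int[P]_(w in A) N w = 0.
  move=> GA; rewrite RintegralB ?WZ ?WZ' ?subrr//; first exact: Gm.
  - exact: integrableS (Gm _ GA) _ iW.
  - exact: integrableS (Gm _ GA) _ iW'.
pose A := N @^-1` `[0, +oo[.
have GA : G A by apply: GN; exact: measurable_itv.
have GCA : G (~` A) by rewrite -setTD; case: sG => _ + _; exact.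
have mA := Gm _ GA; have mCA := Gm _ GCA.
have iabs : P.-integrable setT (EFin \o (fun w => `|N w|)).
  by apply: eq_integrable (integrable_abse iN).
have abs0 : \int[P]_w `|N w| = 0.
  rewrite -(setUv A) Rintegral_setU//; last 2 first.
  - by rewrite setUv.
  - by rewrite disj_set2E setICr.
  rewrite -[RHS]addr0; congr (_ + _).
    rewrite -(N0 A)//; apply: eq_Rintegral => w; rewrite inE /A /= in_itv /= andbT => w0.
    by rewrite ger0_norm.
  rewrite -[RHS](mulr0 (-1)) -(N0 (~` A))// -RintegralZl//; last exact: integrableS iN.
  apply: eq_Rintegral => w; rewrite inE /A /= in_itv /= andbT => /negP; rewrite -ltNge => w0.
  by rewrite mulN1r ltr0_norm.
have : (\int[P]_w `|(EFin \o N) w| = 0)%E.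
  rewrite -[LHS]fineK; last first.
    exact: (integrable_fin_num measurableT (integrable_abse iN)).
  by congr EFin; exact: abs0.
move=> /(ae_eq_integral_abs _ measurableT).
have mNE : measurable_fun setT (EFin \o N) by exact/measurable_EFinP.
move=> /(_ mNE); apply: filterS => w /(_ I) /= [] /eqP.
by rewrite subr_eq0 => /eqP.
Qed.

(** * The semigroup generated by the opposite of the identity *)

Section dilation_semigroup.
Context (R : realType) (V : lmodType R) (dot : V -> V -> R) (ip : inner_product dot).
Local Notation hnorm := (hnorm dot).

Lemma hnorm_scale_cvg0 (c : R -> R) f : (forall t, 0 < t -> `|c t| <= t) ->
  hnorm (c t *: f) @[t --> 0^'+] --> (0 : R).
Proof.
move=> ct; apply: (@squeeze_cvgr _ _ _ _ (cst 0) (fun t : R => t * hnorm f)).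
- near=> t; rewrite hnorm_ge0 hnorm_scale//= ler_wpM2r ?hnorm_ge0// ct//.
- exact: cvg_cst.
- rewrite -[X in _ --> X](mul0r (hnorm f)); apply: cvgM; last exact: cvg_cst.
  by apply: cvg_at_right_filter; exact: cvg_id.
Unshelve. all: by end_near. Qed.

Definition dilation (t : R) (f : V) : V := expR (- t) *: f.

(** Both bounds are [1 + x <= e^x], at [x = - t] and at [x = t]. *)
Lemma expRN_le (t : R) : 0 < t -> 1 - t <= expR (- t) <= (1 + t)^-1.
Proof.
move=> t0; rewrite expR_ge1Dx /= expRN lef_pV2 ?expR_ge1Dx// posrE ?expR_gt0//.
by rewrite addr_gt0.
Qed.

Lemma dilation_C0 : C0_semigroup dot dilation.
Proof.
split=> [t _|f|s t f _ _|f].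
- split=> [a f g|]; first by rewrite /dilation scalerDr !scalerA mulrC.
  by exists (expR (- t)) => f; rewrite hnorm_scale// ger0_norm ?expR_ge0.
- by rewrite /dilation oppr0 expR0 scale1r.
- by rewrite /dilation scalerA -expRD opprD.
- rewrite (_ : (fun t => _) = (fun t => hnorm ((expR (- t) - 1) *: f))); last first.
    by apply/funext => t; rewrite scalerBl scale1r.
  apply: hnorm_scale_cvg0 => t t0; have /andP[h1 h2] := expRN_le t0.
  by rewrite distrC ger0_norm ?subr_ge0; [lra|rewrite -[leRHS]expR0 ler_expR oppr_le0 ltW].
Qed.

Lemma dilation_generator f g : generator dot dilation f g <-> g = - f.
Proof.
have gen : generator dot dilation f (- f).
  rewrite /generator (_ : (fun t => _) =
      (fun t => hnorm ((t^-1 * (expR (- t) - 1) + 1) *: f))); last first.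
    by apply/funext => t; rewrite /dilation opprK scalerDl scale1r -scalerA scalerBl scale1r.
  apply: hnorm_scale_cvg0 => t t0; have /andP[h1 h2] := expRN_le t0.
  have t1 : 0 < 1 + t by rewrite addr_gt0.
  have -> : t^-1 * (expR (- t) - 1) + 1 = t^-1 * (expR (- t) - 1 + t).
    by rewrite [RHS]mulrDr mulVf ?gt_eqF.
  rewrite ger0_norm; last by rewrite mulr_ge0 ?invr_ge0 ?(ltW t0)//; lra.
  rewrite mulrC ler_pdivrMr//.
  (* Holds since [(1 + t) (1 - t + t^2) = 1 + t^3]; it bounds [e^-t - 1 + t] by [t^2], as
     [hnorm_scale_cvg0] requires after division by [t]. *)
  have : (1 + t)^-1 <= 1 - t + t * t.
    rewrite -[leLHS]mul1r ler_pdivrMr//.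
    have : 0 <= t * t * t by rewrite !mulr_ge0// ltW.
    nra.
  lra.
split=> [gfg|-> //]; exact: (hnorm_cvg_unique ip gfg gen).
Qed.

End dilation_semigroup.

Lemma adapted_scale d (Om : measurableType d) (R : realType) (G : set (set Om)) a (f : Om -> R) :
  sigma_algebra setT G -> adapted G f -> adapted G (fun w => a * f w).
Proof.
by move=> sG /(adaptedP _ sG) mf; apply/(adaptedP _ sG); exact: measurable_funM.
Qed.

(** * Markov property and conditional expectations of the Lamperti field *)

Section lamperti_markov.
Context d (Om : measurableType d) (R : realType) (P : probability Om R).
Context (V : lmodType R) (dot : V -> V -> R) (ip : inner_product dot).
Context (K : V -> V -> R) (B : V -> R -> Om -> R).
Context (BK : brownian_field P K B) (T Q : V -> V).
Context (T_lin : forall a f g, T (a *: f + g) = a *: T f + T g).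
Context (KT : forall f g, K (T f) (T g) = 2 * dot f (Q g)).
Context (Q_pos : forall f, dot f (Q f) = 0 -> f = 0).
Local Notation X := (lamperti_transform B T).

Lemma lamperti_past t : sigma_field X [set s | s <= t] `<=` past B (expR (2 * t)).
Proof.
apply: sigma_of_sub; first exact: sigma_ofP.
move=> -[f s] /= st; apply: adapted_scale; first exact: sigma_ofP.
by apply: past_adapted; rewrite expR_ge0 ler_expR ler_pM2l.
Qed.

Lemma lamperti_increment f s t w : X f t w - expR (- (t - s)) * X f s w =
  expR (- t) / Num.sqrt 2 * (B (T f) (expR (2 * t)) w - B (T f) (expR (2 * s)) w).
Proof.
rewrite /lamperti_transform /lamperti.
have -> : expR (- t) = expR (- (t - s)) * expR (- s) :> R.
  by rewrite -expRD; congr expR; ring.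
by ring.
Qed.

Lemma lamperti_increment_adapted f s t : s <= t ->
  adapted (future_increments B (expR (2 * s))) (fun w => X f t w - expR (- (t - s)) * X f s w).
Proof.
move=> st; rewrite (funext (lamperti_increment f s t)).
apply: adapted_scale; first exact: sigma_ofP.
apply: (@sigma_of_adapted _ _ _ _ _ _ (T f, expR (2 * t))) => /=.
by rewrite ler_expR ler_pM2l.
Qed.

Lemma lamperti_Lfun f t : X f t \in Lfun P 2%:E. Proof. exact: (lamperti_Lfun2 BK). Qed.

Lemma sigma_field_measurable D : sigma_field X D `<=` measurable.
Proof.
by apply: sigma_of_measurable => x _; exact: Lfun2_measurable (lamperti_Lfun _ _).
Qed.

Lemma sigma_field_adapted (D : set R) f s : D s -> adapted (sigma_field X D) (X f s).
Proof. exact: (@sigma_of_adapted _ _ _ _ (fun x : V * R => X x.1 x.2) [set x | D x.2] (f, s)). Qed.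

Lemma indep_lamperti_past t :
  indep P (sigma_field X [set s | s <= t]) (future_increments B (expR (2 * t))).
Proof.
have h : indep P (past B (expR (2 * t))) (future_increments B (expR (2 * t))).
  exact: (indep_past_future BK (expR_ge0 _)).
by apply: sub_indep h => //; exact: lamperti_past.
Qed.

Lemma lamperti_markov : markov_field P X.
Proof.
move=> t; apply: (@cond_indep_of_indep _ _ _ _ _ _ _ _ (future_increments B (expR (2 * t)))).
- exact: sigma_ofP.
- exact: sigma_field_measurable.
- exact: sigma_ofP.
- exact: sigma_ofP.
- exact: sigma_field_measurable.
- exact: future_increments_measurable BK _ (expR_ge0 _).
- apply: sigma_of_sub; first exact: sigma_ofP.
  move=> -[f s] /= ->.
  by apply: sigma_field_adapted => /=.
- exact: indep_lamperti_past.
apply: sigma_of_sub; first exact: smallest_sigma_algebra.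
move=> -[f s] /= ts.
rewrite (_ : X f s = fun w => expR (- (s - t)) * X f t w +
    (X f s w - expR (- (s - t)) * X f t w)); last first.
  by apply/funext => w; rewrite addrC subrK.
apply: adapted_lin; first exact: smallest_sigma_algebra.
- move=> D mD; apply: sub_sigma_algebra; left; exact: sigma_field_adapted.
- by move=> D mD; apply: sub_sigma_algebra; right; exact: lamperti_increment_adapted.
Qed.

(** Linearity is given for [a *: f + g], outside a null set; writing [a *: f] as [(a - 1) *: f + f]
    avoids treating the zero vector apart. *)
Lemma lamperti_field_scale a f t : {ae P, forall w, X (a *: f) t w = a * X f t w}.
Proof.
have := lamperti_field_lin BK T_lin (a - 1) f f t; apply: filterS => w.
by rewrite scalerBl scale1r subrK => ->; ring.
Qed.

Lemma lamperti_increment_mean f s t :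
  \int[P]_w (X f t w - expR (- (t - s)) * X f s w) = 0.
Proof.
set a := expR _.
(* Used at [b = 1] and [b = -1]: the increment and its opposite are both centered normal, which
   forces mean 0. *)
have nD (b : R) : exists v, normal_law P (fun w => b * (X f t w - a * X f s w)) 0 v.
  have [v nv] := lamperti_gaussian BK T (fun i : 'I_2 => nth 0 [:: b; - b * a] i) (fun=> f)
    (t := fun i : 'I_2 => nth 0 [:: t; s] i) (fun=> I).
  exists v; move: nv; congr (normal_law P _ 0 v); apply/funext => w.
  by rewrite big_ord_recl big_ord1 /=; ring.
have hD : (fun w => X f t w - a * X f s w) \in Lfun P 2%:E.
  rewrite (_ : (fun w => _) = fun w => (- a) * X f s w + X f t w).
    exact: Lfun2_lin (lamperti_Lfun _ _) (lamperti_Lfun _ _).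
  by apply/funext => w; rewrite mulNr addrC.
have [v nv] := nD 1; have [v' nv'] := nD (-1).
apply: (@normal_law_integral0 _ _ _ _ _ v v' _ _ hD).
- by move: nv; congr (normal_law P _ 0 v); apply/funext => w; rewrite mul1r.
- by move: nv'; congr (normal_law P _ 0 v'); apply/funext => w; rewrite mulN1r.
Qed.

Lemma lamperti_conditional : conditional_semigroup P X (@dilation R V).
Proof.
move=> f t t0; set G := sigma_field X [set s | s <= 0].
have sG : sigma_algebra setT G by exact: sigma_ofP.
have Gm : G `<=` measurable by exact: sigma_field_measurable.
have int g s : P.-integrable setT (EFin \o X g s).
  by apply/Lfun1_integrable; apply: Lfun_subset12 (lamperti_Lfun g s); exact: fin_num_measure.
split => [||C mC|A GA]; [exact: int|exact: int| |].
  by move: C mC; apply: sigma_field_adapted => /=.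
have mA := Gm _ GA; have iA g s : P.-integrable A (EFin \o X g s).
  exact: integrableS (int g s).
have ia g s a : P.-integrable A (EFin \o (fun w => a * X g s w)).
  by apply: eq_integrable (integrableZl mA a (iA g s)).
transitivity (\int[P]_(w in A) (expR (- t) * X f 0 w)).
  congr fine; apply: ae_eq_integral => //.
  - exact: measurable_int (iA _ _).
  - exact: measurable_int (ia _ _ _).
  have := lamperti_field_scale (expR (- t)) f 0; apply: filterS => w /= h _.
  by rewrite /dilation h.
apply/eqP; rewrite eq_sym -subr_eq0; apply/eqP.
rewrite -RintegralB//.
transitivity (\int[P]_(w in A) (X f t w - expR (- (t - 0)) * X f 0 w)); first by rewrite subr0.
have F0 : future_increments B (expR (2 * 0)) `<=` measurable.
  exact: (future_increments_measurable BK (expR_ge0 _)).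
(* The increment after time 0 is independent of [A], so the integral is [P A] times its mean, which
   is 0. *)
rewrite (indep_integral (sigma_ofP _ _) F0 (indepC (@indep_lamperti_past 0)) GA mA).
- by rewrite lamperti_increment_mean mulr0.
- exact: lamperti_increment_adapted.
- apply: eq_integrable (integrableB measurableT (int f t)
    (integrableZl measurableT (expR (- (t - 0))) (int f 0))) => //.
Qed.

(** Two versions of a conditional expectation agree almost surely, so the field at time 0 vanishes
    at the difference [g] of the two vectors. Its variance [dot g (Q g)] is then 0, and [Q_pos]
    gives [g = 0]. *)
Lemma lamperti_conditional_unique U' : conditional_semigroup P X U' ->
  forall t f, 0 <= t -> U' t f = dilation t f.
Proof.
move=> hU t f t0; set G := sigma_field X [set s | s <= 0].
have Gm : G `<=` measurable by exact: sigma_field_measurable.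
have XX := cond_exp_unique (sigma_ofP _ _) Gm (hU f t t0) (lamperti_conditional f t0).
apply/eqP; rewrite -subr_eq0; apply/eqP; apply: Q_pos.
set g := _ - _.
have g0 : {ae P, forall w, X g 0 w = 0}.
  have := lamperti_field_lin BK T_lin (-1) (dilation t f) (U' t f) 0.
  move: XX; apply: filterS2 => w h.
  by rewrite scaleN1r addrC => ->; rewrite h mulN1r addNr.
have := lamperti_mom2 BK KT g g 0 0; rewrite subrr normr0 oppr0 expR0 mul1r => <-.
have mX := Lfun2_measurable (lamperti_Lfun g 0).
rewrite /mom2 /Rintegral (ae_eq_integral (cst 0%E))//.
- by rewrite integral0.
- by apply/measurable_EFinP; exact: measurable_funM.
- by apply: filterS g0 => w /= h _; rewrite h mul0r.
Qed.

Lemma lamperti_characteristic :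
  characteristic_operator P dot X (fun f g => g = - f).
Proof.
exists (@dilation R V); split.
- exact: dilation_C0.
- exact: lamperti_conditional.
- exact: lamperti_conditional_unique.
- exact: dilation_generator.
Qed.

Lemma lamperti_OU : OU_LE_process P X.
Proof.
split.
- exact: (lamperti_LE_process BK T_lin).
- exact: (lamperti_gaussian BK T).
- exact: lamperti_markov.
- exact: (lamperti_stationary BK KT).
- exact: (lamperti_mean_continuous BK KT).
Qed.

End lamperti_markov.

(** A self-adjoint graph equals that of its adjoint, which is cut out by linear equations. *)
Lemma self_adjoint_sub (R : realType) (V : lmodType R) (dot : V -> V -> R)
    (G : V -> V -> Prop) f g f' g' : inner_product dot -> self_adjoint dot G ->
  G f g -> G f' g' -> G (f - f') (g - g').
Proof.
move=> ip [_ GE] /GE h /GE h'; apply/GE => u v Guv.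
by rewrite !(dotBr ip) (h u v Guv) (h' u v Guv).
Qed.

Theorem theorem4p1 (R : realType) (d : measure_display) (S : measurableType d)
  (* the Markov process X, with transition function p and initial law mu *)
  (dX : measure_display) (OmX : measurableType dX) (PX : probability OmX R)
  (PX_complete : measure_is_complete PX)
  (F : R -> set (set OmX)) (X : R -> OmX -> S)
  (p : R -> R.-pker S ~> S) (mu : probability S R)
  (F_filtration : filtration F) (X_progressive : progressively_measurable F X)
  (p_transition : transition_function p) (X_markov : markov_process PX F p X)
  (X_initial : initial_distribution PX X mu)
  (mu_invariant : invariant_law p mu) (mu_ergodic : ergodic p mu)
  (* its generator A on L^2(mu), with resolution of the identity E *)
  (U_C0 : C0_semigroup (L2_dot mu) (transition_semigroup p mu))
  (A : L2 mu -> L2 mu -> Prop) (A_generator : A = markov_generator p mu)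
  (A_selfadjoint : self_adjoint (L2_dot mu) A)
  (A_range : op_range A = [set f | f \in mean_zero mu])
  (A_bijective : bijective_op (op_perp A))
  (A_inv_bounded : bounded_linear (perp_dot mu) (op_inv (op_perp A)))
  (E : pvm (L2_dot mu)) (E_resolution : spectral_resolution E A)
  (* the Brownian field B with spatial covariance operator - 2 A^{-1} *)
  (dO : measure_display) (Om : measurableType dO) (P : probability Om R)
  (B : perp mu -> R -> Om -> R)
  (B_brownian : brownian_field P
     (fun f g => - 2 * perp_dot mu f (op_inv (op_perp A) g)) B)
  (m2 : R) (m2_ge0 : 0 <= m2) :
  let T := green_transform E m2 in
  let C := green m2 A in
  let Z := lamperti B in
  let TZ := fun f t => Z (T f) t in
  [/\ (forall f, green_transform_graph E m2 f (T f)) /\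
        bounded_linear (perp_dot mu) T,
      [/\ bijective_op (op_shift m2 (op_opp (op_perp A))),
          bounded_linear (perp_dot mu) C &
          forall g, C g = - op_inv (op_shift (- m2) (op_perp A)) g],
      OU_LE_process P TZ,
      characteristic_operator P (perp_dot mu) TZ (fun f g => g = - f) &
      equilibrium_covariance P (perp_dot mu) TZ C /\
        forall f g t,
          ('E_P[TZ f t \* TZ g t])%E = (perp_dot mu f (C g))%:E].
Proof.
move=> T C Z TZ.
have A_le0 f g : A f g -> L2_dot mu g f <= 0.
  by rewrite A_generator; exact: markov_generator_le0.
have A_sub f g f' g' : A f g -> A f' g' -> A (f - f') (g - g').
  exact: self_adjoint_sub (L2_inner_product mu) A_selfadjoint.
have [[T_graph T_bounded shift_bij C_bounded C_inv] [TK C_pos]] :=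
  green_theorem A_range A_bijective A_le0 A_sub E_resolution A_inv_bounded m2_ge0.
have [T_lin _] := T_bounded.
(* [T] carries [- A^-1] to [C], so the covariance operator [-2 A^-1] becomes [2 C]; the Lamperti
   scaling removes the 2. *)
have KT f g : - 2 * perp_dot mu (T f) (op_inv (op_perp A) (T g)) = 2 * perp_dot mu f (C g).
  by rewrite TK; ring.
have ip := perp_inner_product mu.
split=> //.
- exact: (lamperti_OU B_brownian T_lin KT).
- exact: (lamperti_characteristic ip B_brownian T_lin KT C_pos).
- split; first exact: (lamperti_equilibrium B_brownian KT).
  exact: (lamperti_equilibrium B_brownian KT).
Qed.
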